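(* Let $s,t,r,n_1,n_2,\dots,n_r$ be positive integers with $2\le s\le r$, $t\ge 2$ and $n_1\ge 2$. Then for all sufficiently large $n$ (in terms of $s,t,r,n_1,\dots,n_r$), the graph $K_{t-1}+T_r(n-t+1)$ is, up to isomorphism, the unique graph attaining the maximum $s$-clique spectral radius among all $n$-vertex graphs that are $tK^+(n_1,n_2,\dots,n_r)$-free.
   Context: All graphs are finite and simple. A graph is $F$-free if it does not contain $F$ as a (not necessarily induced) subgraph. $K(n_1,\dots,n_r)$ is the complete $r$-partite graph with parts of sizes $n_1,\dots,n_r$. $T_r(m)$ is the $r$-partite Turán graph: the complete $r$-partite graph on $m$ vertices whose part sizes differ pairwise by at most $1$. For $n_1\ge 2$, $K^+(n_1,\dots,n_r)$ is the graph obtained from $K(n_1,\dots,n_r)$ by adding one edge inside the first part. $tG$ is the disjoint union of $t$ copies of $G$. The join $G_1+G_2$ of two disjoint graphs is obtained from $G_1\cup G_2$ by adding all edges between vertices of $G_1$ and vertices of $G_2$. An $s$-clique of $G$ is a set of $s$ vertices inducing a complete subgraph; $C_s(G)$ is the set of all $s$-cliques of $G$. For a graph $G$ on vertex set $\{1,\dots,n\}$, the $s$-clique tensor $\mathcal{A}_s(G)=(a_{i_1\cdots i_s})$ is the order-$s$, dimension-$n$ tensor with $a_{i_1\cdots i_s}=\frac{1}{(s-1)!}$ if $\{i_1,\dots,i_s\}\in C_s(G)$ and $0$ otherwise. For an order-$k$, dimension-$n$ tensor $\mathcal{A}$ and $x\in\mathbb{C}^n$, $(\mathcal{A}x^{k-1})_i=\sum_{i_2,\dots,i_k=1}^n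 a_{ii_2\cdots i_k}x_{i_2}\cdots x_{i_k}$; a number $\lambda\in\mathbb{C}$ is an eigenvalue of $\mathcal{A}$ if there is a nonzero $x$ with $(\mathcal{A}x^{k-1})_i=\lambda x_i^{k-1}$ for all $i$. The spectral radius of $\mathcal{A}$ is the maximum modulus of its eigenvalues. The $s$-clique spectral radius $\rho_s(G)$ is the spectral radius of $\mathcal{A}_s(G)$. *)

(* Defs.v *)
From HB Require Import structures.
From mathcomp Require Import all_boot all_order all_algebra.
From mathcomp Require Import classical_sets reals.
From mathcomp Require Import complex.
From mathcomp Require Import zify.

Set Implicit Arguments.
Unset Strict Implicit.
Unset Printing Implicit Defensive.

Import Order.TTheory GRing.Theory Num.Theory.

Local Open Scope nat_scope.

Record sgraph := SGraph {
  vertex :> finType;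
  adj : rel vertex;
  adj_sym : symmetric adj;
  adj_irr : irreflexive adj }.

Arguments adj {s} : rename.

Definition isomorphic (G H : sgraph) : Prop :=
  exists2 f : G -> H, bijective f & forall u v, adj (f u) (f v) = adj u v.

(* F is a subgraph of G, not necessarily induced. *)
Definition contains (F G : sgraph) : Prop :=
  exists2 f : F -> G, injective f & forall u v, adj u v -> adj (f u) (f v).

Definition free_of (F G : sgraph) : Prop := ~ contains F G.

Section Complete.
Variable m : nat.
Definition complete_adj : rel 'I_m := fun u v => u != v.
Lemma complete_sym : symmetric complete_adj.
Proof. by move=> u v; rewrite /complete_adj eq_sym. Qed.
Lemma complete_irr : irreflexive complete_adj.
Proof. by move=> u; rewrite /complete_adj eqxx. Qed.
Definition complete_graph : sgraph := SGraph complete_sym complete_irr.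
End Complete.

Section Turan.
Variables r m : nat.
Definition turan_adj : rel 'I_m := fun u v => u %% r != v %% r.
Lemma turan_sym : symmetric turan_adj.
Proof. by move=> u v; rewrite /turan_adj eq_sym. Qed.
Lemma turan_irr : irreflexive turan_adj.
Proof. by move=> u; rewrite /turan_adj eqxx. Qed.
(* T_r(m): the parts are the residue classes modulo r (see turan_balanced). *)
Definition turan_graph : sgraph := SGraph turan_sym turan_irr.

Definition turan_part (c : nat) : {set turan_graph} := [set u : 'I_m | u %% r == c].

Lemma turan_balanced (c c' : nat) : c < r -> c' < r ->
  #|turan_part c| <= #|turan_part c'|.+1.
Proof.
move=> cr c'r; set A := turan_part c; set B := [set u : 'I_m | u < r].
rewrite -(cardsID B A) -add1n; apply: leq_add.
  apply/card_le1_eqP => u v; rewrite !inE => /andP[/eqP uc ur] /andP[/eqP vc vr].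
  by apply: val_inj; rewrite /= -(modn_small ur) -(modn_small vr) uc vc.
pose g (u : 'I_m) : nat := u - c - r + c'.
have uE (u : 'I_m) : u \in A :\: B -> exists2 q, u = q * r + r + c :> nat & g u = q * r + c'.
  rewrite !inE -leqNgt => /andP[ru /eqP uc].
  have := divn_eq u r; rewrite uc.
  have : 0 < u %/ r by rewrite divn_gt0 //; lia.
  case: (u %/ r) => // q _; rewrite mulSn => uq.
  by exists q; rewrite ?/g uq; lia.
pose f (u : 'I_m) : 'I_m := insubd u (g u).
have fE (u : 'I_m) : u \in A :\: B -> f u = g u :> nat.
  move=> /uE[q uq gq]; rewrite /f val_insubd; case: ifP => //.
  by have := ltn_ord u; lia.
have finj : {in A :\: B &, injective f}.
  move=> u v uA vA /(congr1 val) /=; rewrite !fE // => guv.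
  apply: val_inj => /=.
  by have [q -> +] := uE _ uA; have [p -> +] := uE _ vA; lia.
rewrite -(card_in_imset finj); apply/subset_leq_card/fintype.subsetP => _ /imsetP[u uA ->].
rewrite inE fE //; have [q _ ->] := uE _ uA.
by rewrite modnMDl modn_small.
Qed.
End Turan.

Section KPlus.
Variables (r : nat) (ns : r.-tuple nat).
(* K^+(n_1, ..., n_r).  Parts are numbered from 0; the vertex Tagged _ a in
   part i has position a < n_i.  The edge added inside part 0 joins its
   positions 0 and 1, so it is present exactly when n_1 >= 2. *)
Definition kplus_adj : rel {i : 'I_r & 'I_(tnth ns i)} := fun u v =>
  (tag u != tag v) ||
  [&& tag u == 0 :> nat, tag v == 0 :> nat,
      tagged u != tagged v :> nat, tagged u < 2 & tagged v < 2].
Lemma kplus_sym : symmetric kplus_adj.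
Proof.
move=> u v; rewrite /kplus_adj eq_sym; congr (_ || _).
by apply/and5P/and5P => -[? ? ? ? ?]; split; rewrite // eq_sym.
Qed.
Lemma kplus_irr : irreflexive kplus_adj.
Proof. by move=> u; rewrite /kplus_adj !eqxx /= !andbF. Qed.
Definition kplus : sgraph := SGraph kplus_sym kplus_irr.
End KPlus.

Section Copies.
Variables (t : nat) (G : sgraph).
Definition copies_adj : rel ('I_t * G) :=
  fun u v => (u.1 == v.1) && adj u.2 v.2.
Lemma copies_sym : symmetric copies_adj.
Proof. by move=> u v; rewrite /copies_adj eq_sym adj_sym. Qed.
Lemma copies_irr : irreflexive copies_adj.
Proof. by move=> u; rewrite /copies_adj adj_irr andbF. Qed.
Definition copies : sgraph := SGraph copies_sym copies_irr.
End Copies.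

Section Join.
Variables G1 G2 : sgraph.
Definition join_adj : rel (G1 + G2) := fun u v =>
  match u, v with
  | inl u, inl v => adj u v
  | inr u, inr v => adj u v
  | _, _ => true
  end.
Lemma join_sym : symmetric join_adj.
Proof. by move=> [u|u] [v|v] //=; rewrite adj_sym. Qed.
Lemma join_irr : irreflexive join_adj.
Proof. by move=> [u|u] /=; rewrite adj_irr. Qed.
Definition graph_join : sgraph := SGraph join_sym join_irr.
End Join.

Definition cliques (s : nat) (G : sgraph) : {set {set G}} :=
  [set S : {set G} | (#|S| == s) &&
     [forall u in S, forall v in S, (u != v) ==> adj u v]].

Local Open Scope ring_scope.

Section Tensor.
Variables (R : realType) (k : nat) (V : finType).

(* Order-k tensors whose index set is V instead of {1, ..., n}. *)
Definition tensor := k.-tuple V -> R[i].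

(* (A x^(k-1))_i: the sum ranges over the index tuples (i, i_2, ..., i_k). *)
Definition tensor_app (A : tensor) (x : {ffun V -> R[i]}) (i : V) : R[i] :=
  \sum_(j : k.-tuple V | ohead j == Some i) A j * \prod_(l <- behead j) x l.

Definition tensor_eigenvalue (A : tensor) (lambda : R[i]) : Prop :=
  exists2 x : {ffun V -> R[i]}, x != 0 &
    forall i, tensor_app A x i = lambda * x i ^+ k.-1.

Definition eigenvalue_moduli (A : tensor) : set R :=
  [set Normc.normc lambda | lambda in tensor_eigenvalue A]%classic.

(* The greatest element of the set of moduli (0 if there is none). *)
Definition spectral_radius (A : tensor) : R :=
  xget 0 (eigenvalue_moduli A `&` ubound (eigenvalue_moduli A))%classic.
End Tensor.

Definition clique_tensor (R : realType) (s : nat) (G : sgraph) :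
    tensor R s G :=
  fun j => if [set v in j] \in cliques s G then ((s.-1)`!)%:R^-1 else 0.

Arguments clique_tensor : clear implicits.

Definition clique_spectral_radius (R : realType) (s : nat) (G : sgraph) : R :=
  spectral_radius (clique_tensor R s G).

(* Main.v *)
From mathcomp Require Import boolp classical_sets reals topology normedtype.
From mathcomp Require Import derive realfun exp complex.
From mathcomp Require Import all_boot all_order all_algebra perm.
From mathcomp Require Import zify ring lra.
Require Import Defs.

(** Why the theorem holds.  Write T_s(x) for the sum of x(v_1)...x(v_s) over the
    ordered s-cliques of G (clique_sum).  Up to the constant (s-1)!, the s-clique
    spectral radius is the maximum of T_s(x) over nonnegative x with
    sum x(v)^s = 1: a maximiser exists by compactness, the first-order conditions
    make it an eigenvector, and the triangle inequality shows that no complex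
    eigenvector does better (spectral_radiusE; form_max is the maximum).  So graphs
    are compared through the values of one polynomial form.

    Let G be a large F-free graph, F = tK^+, whose radius is at least that of the
    host H = K_(t-1) + T_r(n-t+1), and let x be a maximiser normalised by
    sum x(v)^s = n.  Evaluating the form of H at the constant vector shows that
    T_s(x) is at least about the density of s-cliques in T_r times n^s
    (host_form_max_lower).  A bounded set W meets every copy of K^+ in G
    (hitting_set), and outside W a positive density of (r+1)-cliques would contain
    a large complete (r+1)-partite graph, hence K^+ (dense_box, sparse_cliques).  So
    (r+1)-cliques are sparse while s-cliques are as dense as they can be, and the
    Moon--Moser inequalities for weighted cliques (moon_moser) then force all
    intermediate ratios to their values in T_r (turan_sequence_stability).  Hence
    x is nearly constant and almost all degrees are at least about (1 - 1/r)n
    (good_vertices).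

    Such degrees produce many r-cliques, thus a complete r-partite graph with large
    constant parts.  A vertex outside W joined to much of all these parts but one
    has no neighbour in the last one, since an edge there would complete a K^+.
    This splits almost all vertices into r independent classes between which few
    edges are missing (near_complete_partition).  A vertex joined to many vertices
    of every class lies in a copy of K^+ avoiding any prescribed bounded set, so
    there are at most t-1 such universal vertices (card_universal), and if there
    are exactly t-1 of them, no edge between vertices typical for the same class
    survives, since it would supply the t-th copy.

    Now recolour G: universal vertices, and if necessary some further ones so that
    there are t-1, are joined to everything; every other vertex goes to a class in
    which it has few neighbours, and adjacency becomes being in different classes.
    Each clique lost contains a lost edge, and lost edges are few near each
    vertex, whereas each atypical or newly promoted vertex creates cliques in a
    quantity of order n^(s-1); so T_s(x) does not decrease, and it increases
    strictly unless nothing changed (compare_clique_sums, compare_equality).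
    Finally, among complete r-partite graphs joined to K_(t-1) the balanced one has
    the largest radius: moving a vertex from a class to one smaller by at least 2
    increases the maximum, by convexity (recolour_increases).  Both
    comparisons are equalities only if G is isomorphic to H. *)

Set Implicit Arguments.
Unset Strict Implicit.
Unset Printing Implicit Defensive.
Import Order.TTheory GRing.Theory Num.Theory.
Import numFieldNormedType.Exports.
Local Open Scope ring_scope.

(** * Sums over ordered cliques *)

Section InsertCoordinate.
Variables (V : finType) (n : nat).

Definition finsert (i : 'I_n.+1) (v : V) (g : {ffun 'I_n -> V}) :
    {ffun 'I_n.+1 -> V} := [ffun j => oapp g v (unlift i j)].

Lemma finsert_at i v g : finsert i v g i = v.
Proof. by rewrite ffunE unlift_none. Qed.

Lemma finsert_lift i v g k : finsert i v g (lift i k) = g k.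
Proof. by rewrite ffunE liftK. Qed.

Lemma sum_finsert (K : nmodType) (i : 'I_n.+1) (F : {ffun 'I_n.+1 -> V} -> K) :
  \sum_f F f = \sum_v \sum_g F (finsert i v g).
Proof.
rewrite pair_bigA /=.
rewrite (reindex (fun p : V * {ffun 'I_n -> V} => finsert i p.1 p.2)) //=.
exists (fun f => (f i, [ffun k => f (lift i k)])) => [[v g] _|f _] /=.
  by rewrite finsert_at; congr pair; apply/ffunP => k; rewrite ffunE finsert_lift.
by apply/ffunP => j; rewrite ffunE; case: unliftP => [k|] -> //=; rewrite ffunE.
Qed.

Lemma prod_finsert (K : comPzSemiRingType) i v g (x : V -> K) :
  \prod_j x (finsert i v g j) = x v * \prod_k x (g k).
Proof.
rewrite (bigD1_ord i) //= finsert_at; congr (_ * _).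
by apply: eq_bigr => k _; rewrite finsert_lift.
Qed.

End InsertCoordinate.

Lemma sum_ffun_prod (K : comPzSemiRingType) (V : finType) k (x : V -> K) :
  \sum_(f : {ffun 'I_k -> V}) \prod_i x (f i) = (\sum_v x v) ^+ k.
Proof. by rewrite -(bigA_distr_bigA (fun _ => x)) prodr_const card_ord. Qed.

Lemma sum_ffun0 (K : nmodType) (V : finType) (F : {ffun 'I_0 -> V} -> K) g :
  \sum_f F f = F g.
Proof.
have only f : f = g by apply/ffunP => -[].
by rewrite (bigD1 g) //= big1 ?addr0 // => f /eqP[].
Qed.

Section CliqueSums.
Variable G : sgraph.

Definition clique_map k (f : {ffun 'I_k -> G}) : bool :=
  [forall i, forall j, (i != j) ==> adj (f i) (f j)].

Definition nbr_of k (f : {ffun 'I_k -> G}) (v : G) : bool :=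
  [forall i, adj v (f i)].

(** A clique on k vertices is counted once for each of its k! orderings, so
    no factorial enters the identities and inequalities between these sums. *)
Definition clique_sum (K : comPzSemiRingType) k (x : G -> K) : K :=
  \sum_(f : {ffun 'I_k -> G} | clique_map f) \prod_i x (f i).

Definition link_sum (K : comPzSemiRingType) k (x : G -> K) (v : G) : K :=
  \sum_(f : {ffun 'I_k -> G} | clique_map f && nbr_of f v) \prod_i x (f i).

Lemma clique_mapP k (f : {ffun 'I_k -> G}) :
  reflect (forall i j, i != j -> adj (f i) (f j)) (clique_map f).
Proof.
apply: (iffP forallP) => [H i j ij|H i]; first by have /forallP/(_ j)/implyP/(_ ij) := H i.
by apply/forallP => j; apply/implyP => ij; apply: H.
Qed.

Lemma clique_map_inj k (f : {ffun 'I_k -> G}) : clique_map f -> injective f.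
Proof.
move/clique_mapP => H i j fij; apply/eqP; apply: contraT => ij.
by have := H i j ij; rewrite fij adj_irr.
Qed.

Lemma clique_finsert n (i : 'I_n.+1) v (g : {ffun 'I_n -> G}) :
  clique_map (finsert i v g) = clique_map g && nbr_of g v.
Proof.
apply/clique_mapP/andP => [H|[/clique_mapP Hg /forallP Hv] j k].
  split.
    apply/clique_mapP => j k jk.
    rewrite -(finsert_lift i v g j) -(finsert_lift i v g k); apply: H.
    by rewrite (inj_eq lift_inj).
  apply/forallP => j; rewrite -{1}(finsert_at i v g) -(finsert_lift i v g j).
  by apply: H; rewrite neq_lift.
case: (unliftP i j) => [j'|] ->; case: (unliftP i k) => [k'|] ->.
- by rewrite (inj_eq lift_inj) !finsert_lift => /Hg.
- by rewrite finsert_lift finsert_at adj_sym.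
- by rewrite finsert_lift finsert_at.
- by rewrite eqxx.
Qed.

Lemma clique_sum_finsert (K : comPzSemiRingType) n (i : 'I_n.+1) (x : G -> K)
    (F : G -> {ffun 'I_n -> G} -> K) :
  \sum_(f : {ffun 'I_n.+1 -> G} | clique_map f)
     F (f i) [ffun k => f (lift i k)] =
  \sum_v \sum_(g | clique_map g && nbr_of g v) F v g.
Proof.
rewrite big_mkcond (sum_finsert i); apply: eq_bigr => v _.
rewrite [RHS]big_mkcond; apply: eq_bigr => g _.
rewrite clique_finsert finsert_at; case: ifP => // _; congr F.
by apply/ffunP => k; rewrite ffunE finsert_lift.
Qed.

Lemma clique_sumS (K : comPzSemiRingType) k (x : G -> K) :
  clique_sum k.+1 x = \sum_v x v * link_sum k x v.
Proof.
rewrite /clique_sum big_mkcond (sum_finsert ord0); apply: eq_bigr => v _.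
rewrite /link_sum big_distrr [RHS]big_mkcond; apply: eq_bigr => g _.
by rewrite clique_finsert prod_finsert; case: ifP.
Qed.

Lemma clique_map0 (f : {ffun 'I_0 -> G}) : clique_map f.
Proof. by apply/clique_mapP => -[]. Qed.

Lemma nbr_of0 (f : {ffun 'I_0 -> G}) v : nbr_of f v.
Proof. by apply/forallP => -[]. Qed.

Lemma nbr_of1 (g : {ffun 'I_0 -> G}) u v : nbr_of (finsert ord0 u g) v = adj v u.
Proof.
apply/forallP/idP => [/(_ ord0)|H i]; first by rewrite finsert_at.
by have -> : i = ord0 by [rewrite ord1]; rewrite finsert_at.
Qed.

Lemma clique_sum0 (K : comPzSemiRingType) (x : G -> K) : clique_sum 0 x = 1.
Proof.
pose g : {ffun 'I_0 -> G} := [ffun i : 'I_0 => match i with Ordinal _ h => False_rect _ (notF h) end].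
by rewrite /clique_sum big_mkcond (sum_ffun0 _ g) clique_map0 big_ord0.
Qed.

Lemma link_sum0 (K : comPzSemiRingType) (x : G -> K) v : link_sum 0 x v = 1.
Proof.
rewrite -(clique_sum0 x); apply: eq_bigl => f.
by rewrite nbr_of0 andbT.
Qed.

Lemma clique_sum1 (K : comPzSemiRingType) (x : G -> K) : clique_sum 1 x = \sum_v x v.
Proof. by rewrite clique_sumS; apply: eq_bigr => v _; rewrite link_sum0 mulr1. Qed.

Lemma link_sum1E (K : comPzSemiRingType) (x : G -> K) v :
  link_sum 1 x v = \sum_(u | adj v u) x u.
Proof.
rewrite /link_sum big_mkcond (sum_finsert ord0) [RHS]big_mkcond.
apply: eq_bigr => u _; rewrite (sum_ffun0 _ [ffun i => v]).
by rewrite clique_finsert prod_finsert big_ord0 mulr1 clique_map0 nbr_of0 nbr_of1.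
Qed.

Lemma eq_clique_sum (K : comPzSemiRingType) k (x y : G -> K) :
  x =1 y -> clique_sum k x = clique_sum k y.
Proof. by move=> xy; apply: eq_bigr => f _; apply: eq_bigr => i _. Qed.

Section Real.
Variable R : numDomainType.
Variable x : G -> R.
Hypothesis x0 : forall v, 0 <= x v.

Lemma clique_sum_ge0 k : 0 <= clique_sum k x.
Proof. by apply: sumr_ge0 => f _; apply: prodr_ge0. Qed.

Lemma link_sum_ge0 k v : 0 <= link_sum k x v.
Proof. by apply: sumr_ge0 => f _; apply: prodr_ge0. Qed.

Lemma link_sum_le k v : link_sum k x v <= (\sum_v x v) ^+ k.
Proof.
rewrite -sum_ffun_prod /link_sum big_mkcond; apply: ler_sum => f _.
by case: ifP => // _; apply: prodr_ge0.
Qed.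

End Real.

(** Clique sums are affine in each weight separately, because the entries of a
    clique are pairwise distinct. *)
Lemma clique_sum_bump (K : comPzRingType) k (x : G -> K) v h :
  clique_sum k.+1 (fun u => x u + h *+ (u == v)) =
  clique_sum k.+1 x + h * link_sum k x v *+ k.+1.
Proof.
have E (f : {ffun 'I_k.+1 -> G}) : clique_map f ->
    \prod_i (x (f i) + h *+ (f i == v)) = \prod_i x (f i) +
    \sum_i (if f i == v then h * \prod_j x (f (lift i j)) else 0).
  move=> /clique_map_inj finj.
  case: (pickP (fun i => f i == v)) => [i0 /eqP fi0|nov].
    rewrite [X in _ = _ + X](bigD1 i0) //= fi0 eqxx.
    rewrite [X in _ = _ + (_ + X)]big1 => [|i ii0]; last first.
      by rewrite -fi0 (inj_eq finj) (negbTE ii0).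
    rewrite addr0 !(bigD1_ord i0) //= fi0 eqxx mulrDl.
    congr (_ * _ + _ * _);
      apply: eq_bigr => j _; rewrite -fi0 (inj_eq finj) eq_sym;
      by rewrite (negbTE (neq_lift _ _)) addr0.
  rewrite [X in _ = _ + X]big1 ?addr0 => [|i _]; last by rewrite nov.
  by apply: eq_bigr => i _; rewrite nov addr0.
rewrite {1}/clique_sum (eq_bigr _ E) big_split; congr (_ + _).
rewrite exchange_big /= -[k.+1 in RHS]card_ord -sumr_const.
apply: eq_bigr => i _.
rewrite big_mkcond (sum_finsert i) (bigD1 v) //= [X in _ + X]big1 ?addr0.
  rewrite /link_sum big_distrr /= [RHS]big_mkcond; apply: eq_bigr => g _.
  rewrite clique_finsert finsert_at; case: ifP => // _.
  rewrite eqxx; congr (_ * _).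
  by apply: eq_bigr => j _; rewrite finsert_lift.
move=> u uv; rewrite big1 // => g _; rewrite finsert_at (negbTE uv).
by case: ifP.
Qed.

End CliqueSums.

(** * The spectral radius as a maximum *)

Section Maximum.
Variables (R : realType).

Lemma continuous_sum (T : topologicalType) (I : Type) (r : seq I) (P : pred I)
    (f : I -> T -> R) :
  (forall i, continuous (f i)) -> continuous (fun M => \sum_(i <- r | P i) f i M).
Proof.
move=> cf; elim: r => [|i r IH] x.
  by under eq_fun do rewrite big_nil; exact: cvg_cst.
under eq_fun do rewrite big_cons.
by case: (P i); [apply: cvgD; [exact: cf|exact: IH]|exact: IH].
Qed.

Lemma continuous_prod (T : topologicalType) (I : Type) (r : seq I)
    (f : I -> T -> R) :
  (forall i, continuous (f i)) -> continuous (fun M => \prod_(i <- r) f i M).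
Proof.
move=> cf; elim: r => [|i r IH] x.
  by under eq_fun do rewrite big_nil; exact: cvg_cst.
under eq_fun do rewrite big_cons.
by apply: cvgM; [exact: cf|exact: IH].
Qed.

Lemma exists_root (k : nat) (a : R) : (0 < k)%N -> 0 < a ->
  exists2 b, 0 < b & b ^+ k = a.
Proof.
move=> k0 a0; exists (a `^ k%:R^-1)%R; first exact: powR_gt0.
by rewrite -powR_mulrn ?powR_ge0 // -powRrM mulVf ?powRr1 ?ltW // pnatr_eq0 -lt0n.
Qed.

Variables (G : sgraph) (k : nat).
Hypothesis k0 : (0 < k)%N.

Definition form_bound (c : R) : Prop :=
  forall y : G -> R, (forall v, 0 <= y v) ->
    clique_sum k y <= c * \sum_v y v ^+ k.

Lemma sum_pow_gt0 (y : G -> R) v : (forall v, 0 <= y v) -> y v != 0 ->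
  0 < \sum_v y v ^+ k.
Proof.
move=> y0 yv; rewrite (bigD1 v) //=; apply: ltr_pwDl.
  by rewrite exprn_gt0 // lt_def yv y0.
by apply: sumr_ge0 => u _; apply: exprn_ge0.
Qed.

Lemma clique_sumZ (y : G -> R) (a : R) :
  clique_sum k (fun v => a * y v) = a ^+ k * clique_sum k y.
Proof.
rewrite /clique_sum big_distrr /=; apply: eq_bigr => f _.
by rewrite big_split /= prodr_const card_ord.
Qed.

Lemma sum_powZ (y : G -> R) (a : R) :
  \sum_v (a * y v) ^+ k = a ^+ k * \sum_v y v ^+ k.
Proof. by rewrite big_distrr; apply: eq_bigr => v _; rewrite exprMn. Qed.

Lemma exists_maximiser (v0 : G) :
  exists x : G -> R, [/\ forall v, 0 <= x v, \sum_v x v ^+ k = 1 &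
    form_bound (clique_sum k x)].
Proof.
pose w (M : 'rV[R]_#|G|) (v : G) : R := M ord0 (enum_rank v).
have cw v : continuous (w^~ v) by exact: coord_continuous.
have csum : continuous (fun M => \sum_v w M v ^+ k).
  apply: continuous_sum => v M.
  by apply: (@continuous_comp _ _ _ (w^~ v) (fun a : R => a ^+ k));
    [exact: cw|exact: exprn_continuous].
have cT : continuous (fun M => clique_sum k (w M)).
  by apply: continuous_sum => f; apply: continuous_prod => i; exact: cw.
pose box := [set M : 'rV[R]_#|G| | forall i, `[0, 1]%classic (M ord0 i)]%classic.
pose A := (box `&` (fun M => \sum_v w M v ^+ k)%R @^-1` [set 1])%classic.
have cA : compact A.
  apply: compact_closedI.
    by apply: (@rV_compact R _ (fun=> `[0, 1]%classic)) => i; exact: segment_compact.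
  by apply: preimage_closed => [M _|]; [exact: csum|exact: closed_eq].
have A0 : (A !=set0)%classic.
  exists (\row_i (i == enum_rank v0)%:R); split=> [i|] /=.
    by rewrite mxE in_itv /=; case: eqP; rewrite /= ?ler01 ?lexx.
  rewrite /w (bigD1 v0) //= mxE eqxx expr1n big1 ?addr0 // => v vv0.
  by rewrite mxE (inj_eq enum_rank_inj) (negbTE vv0) expr0n eqn0Ngt k0.
have [M /set_mem[Mbox MS] Mmax] := compact_EVT_max A0 cA (continuous_subspaceT cT).
have wM0 v : 0 <= w M v by have := Mbox (enum_rank v); rewrite /= in_itv /= => /andP[].
exists (w M); split => // y y0.
have [y00|[v yv]] : (forall v, y v = 0) \/ (exists v, y v != 0).
  case: (pickP (fun v => y v != 0)) => [v yv|H]; first by right; exists v.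
  by left => v; have /negbFE/eqP := H v.
  have -> : clique_sum k y = 0.
    rewrite /clique_sum big1 // => f _; rewrite (bigD1 (Ordinal k0)) //= y00 mul0r //.
  rewrite mulr_ge0 ?clique_sum_ge0 //; apply: sumr_ge0 => v _; exact: exprn_ge0.
have S0 := sum_pow_gt0 y0 yv.
have [b b0 bk] := exists_root k0 S0.
pose z (u : G) := b^-1 * y u.
pose N : 'rV[R]_#|G| := \row_i z (enum_val i).
have wN u : w N u = z u by rewrite /w mxE enum_rankK.
have z0 u : 0 <= z u by rewrite mulr_ge0 ?y0 // invr_ge0 ltW.
have zS : \sum_u z u ^+ k = 1.
  by rewrite sum_powZ exprVn bk mulVf ?gt_eqF.
have NA : N \in A.
  apply/mem_set; split => [i|] /=; last first.
    by rewrite -zS; apply: eq_bigr => u _; rewrite wN.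
  rewrite mxE in_itv /= z0 /= leNgt; apply/negP => z1.
  suff : 1 < \sum_u z u ^+ k by rewrite zS ltxx.
  rewrite (bigD1 (enum_val i)) //= ltr_wpDr //.
    by apply: sumr_ge0 => u _; apply: exprn_ge0.
  by rewrite exprn_egt1 // -lt0n.
have := Mmax _ NA; rewrite (eq_clique_sum _ wN) clique_sumZ exprVn bk.
by rewrite mulrC ler_pdivrMr.
Qed.

(** Comparing the form with its bound along one coordinate: the left side is
    affine in that coordinate, so at a point of equality both sides have the
    same derivative.  At the boundary point 0 only increments b > 0 are allowed,
    which still gives L <= 0, and L is nonnegative. *)
Lemma affine_below_power (j : nat) (a c L : R) : (0 < j)%N -> 0 <= a -> 0 <= c ->
  0 <= L ->
  (forall b, 0 <= b -> (b - a) * L *+ j.+1 <= c * (b ^+ j.+1 - a ^+ j.+1)) ->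
  L = c * a ^+ j.
Proof.
move=> j0 a0 c0 L0 H.
have slope b : (b - a) * (c * \sum_(i < j.+1) b ^+ (j - i) * a ^+ i) =
    c * (b ^+ j.+1 - a ^+ j.+1).
  by rewrite subrXX mulrCA; congr (_ * (_ * _)); apply: eq_bigr => i _; rewrite subSS.
have near_a (P : R -> Prop) : (\forall b \near a, P b) ->
    exists2 e, 0 < e & forall b, `|a - b| < e -> P b.
  by move=> /nbhs_ballP[e /= e0 He]; exists e => // b ab; apply: He.
have cvX : ((fun b : R => c * b ^+ j) x @[x --> a] --> c * a ^+ j)%classic.
  by apply: cvgM; [exact: cvg_cst|exact: exprn_continuous].
apply/eqP; rewrite eq_le; apply/andP; split; rewrite leNgt; apply/negP => Lc.
  have [e e0 He] := near_a _ (cvgr_lt _ cvX _ Lc).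
  have ea : 0 < e / 2 by rewrite divr_gt0.
  have b0 : 0 <= a + e / 2 by lra.
  have := He (a + e / 2); rewrite opprD addNKr normrN gtr0_norm //.
  move=> /(_ ltac:(lra)) Lt.
  have := H _ b0; rewrite -slope [a + _ - a]addrAC subrr add0r -mulrnAr ler_pM2l //.
  rewrite leNgt => /negP; apply.
  apply: le_lt_trans (_ : c * (a + e / 2) ^+ j *+ j.+1 < _).
    rewrite -mulrnAr ler_wpM2l // -[j.+1 in leRHS]card_ord -sumr_const.
    apply: ler_sum => i _.
    have -> : (a + e / 2) ^+ j = (a + e / 2) ^+ (j - i) * (a + e / 2) ^+ i.
      by rewrite -exprD subnK // -ltnS.
    rewrite ler_wpM2l ?exprn_ge0 // lerXn2r ?nnegrE //; lra.
  by rewrite ltrMn2r.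
have a_gt0 : 0 < a.
  rewrite lt_def a0 andbT; apply: contraTneq Lc => ->.
  by rewrite expr0n gtn_eqF // mulr0 -leNgt.
have [e e0 He] := near_a _ (cvgr_gt _ cvX _ Lc).
pose h := Num.min (e / 2) a.
have h0 : 0 < h by rewrite lt_min a_gt0 divr_gt0.
have he : h < e by rewrite gt_min; apply/orP; left; lra.
have ha : h <= a by rewrite ge_min lexx orbT.
have b0 : 0 <= a - h by lra.
have := He (a - h); rewrite opprD opprK addNKr gtr0_norm // => /(_ he) Lt.
have := H _ b0; rewrite -slope [a - _ - a]addrAC subrr add0r -mulrnAr.
rewrite !mulNr lerN2 ler_pM2l // leNgt => /negP; apply.
apply: lt_le_trans (_ : c * (a - h) ^+ j *+ j.+1 <= _); first by rewrite ltrMn2r.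
rewrite -mulrnAr ler_wpM2l // -[j.+1 in leLHS]card_ord -sumr_const.
apply: ler_sum => i _.
have -> : (a - h) ^+ j = (a - h) ^+ (j - i) * (a - h) ^+ i.
  by rewrite -exprD subnK // -ltnS.
rewrite ler_wpM2l ?exprn_ge0 // lerXn2r ?nnegrE //; lra.
Qed.

(** Vary the weight of v alone and apply affine_below_power. *)
Lemma maximiser_eigen (j : nat) (c : R) (x : G -> R) : k = j.+1 -> (0 < j)%N ->
  form_bound c -> (forall v, 0 <= x v) ->
  clique_sum k x = c * \sum_v x v ^+ k ->
  forall v, link_sum j x v = c * x v ^+ j.
Proof.
move=> kj j0 cB x0 xmax v.
have c0 : 0 <= c.
  have := cB (fun u => (u == v)%:R) (fun u => ler0n _ _).
  rewrite (bigD1 v) //= eqxx expr1n big1 => [|u uv]; last first.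
    by rewrite (negbTE uv) expr0n eqn0Ngt k0.
  rewrite addr0 mulr1; apply: le_trans; apply: clique_sum_ge0 => u.
  exact: ler0n.
apply: affine_below_power => // [|b b0]; first exact: link_sum_ge0.
pose y u := x u + (b - x v) *+ (u == v).
have y0 u : 0 <= y u.
  by rewrite /y; case: eqP => [->|_]; rewrite ?mulr1n ?mulr0n ?addr0 // addrC subrK.
have := cB y y0; rewrite kj clique_sum_bump -kj xmax.
have -> : \sum_u y u ^+ k = b ^+ k + \sum_(u | u != v) x u ^+ k.
  rewrite (bigD1 v) //= /y eqxx mulr1n subrKC; congr (_ + _).
  by apply: eq_bigr => u /negbTE ->; rewrite addr0.
by rewrite (bigD1 v) //= !mulrDr mulrN addrAC lerD2r lerBrDl.
Qed.

End Maximum.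

Section SpectralRadius.
Variables (R : realType) (G : sgraph) (j : nat).
Hypothesis j0 : (0 < j)%N.
Let k := j.+1.

Lemma mem_cliques (f : {ffun 'I_k -> G}) :
  ([set w in [tuple f i | i < k]] \in cliques k G) = clique_map f.
Proof.
have mem_f i : f i \in [set w in [tuple f i | i < k]].
  by rewrite inE; apply/mapP; exists i; rewrite ?mem_enum.
have uniq_f : injective f -> uniq [tuple f i | i < k].
  by move=> inj_f; rewrite map_inj_uniq // enum_uniq.
rewrite inE; apply/andP/idP => [[card_f adj_f]|cf].
  have inj_f : injective f.
    apply/injectiveP; apply/card_uniqP; rewrite cardsE in card_f.
    by rewrite (eqP card_f) size_map size_enum_ord.
  apply/clique_mapP => i i' ii'.
  have /forall_inP/(_ _ (mem_f i))/forall_inP/(_ _ (mem_f i'))/implyP := adj_f.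
  by apply; rewrite (inj_eq inj_f).
have inj_f := clique_map_inj cf.
rewrite cardsE (card_uniqP (uniq_f inj_f)) size_tuple eqxx; split=> //.
apply/forall_inP => u; rewrite inE => /mapP[i _ ->].
apply/forall_inP => w; rewrite inE => /mapP[i' _ ->].
by apply/implyP; rewrite (inj_eq inj_f); apply/clique_mapP.
Qed.

Lemma val_mktupleS (f : {ffun 'I_k -> G}) :
  [tuple f i | i < k] = f ord0 :: [seq f (lift ord0 i) | i <- enum 'I_j] :> seq G.
Proof. by rewrite /= enum_ordSl /= -map_comp. Qed.

Lemma clique_tensor_app (x : {ffun G -> R[i]}) v :
  tensor_app (clique_tensor R k G) x v = (j`!)%:R^-1 * link_sum j x v.
Proof.
rewrite /tensor_app big_mkcond /=.
pose tup (f : {ffun 'I_k -> G}) : k.-tuple G := [tuple f i | i < k].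
rewrite (reindex tup) /=; last first.
  exists (fun s => [ffun i => tnth s i]) => [f _|s _].
    by apply/ffunP => i; rewrite ffunE tnth_mktuple.
  by apply: eq_from_tnth => i; rewrite tnth_mktuple ffunE.
rewrite (sum_finsert ord0) (bigD1 v) //= [X in _ + X]big1 ?addr0 => [|u uv].
  rewrite /link_sum big_distrr /= [RHS]big_mkcond; apply: eq_bigr => g _.
  rewrite val_mktupleS /= finsert_at eqxx big_map big_enum /=.
  rewrite /clique_tensor mem_cliques clique_finsert; case: ifP; rewrite ?mul0r //.
  by move=> _; congr (_ * _); apply: eq_bigr => i _; rewrite finsert_lift.
rewrite big1 // => g _; rewrite val_mktupleS /= finsert_at.
by rewrite (negbTE (uv : Some u != Some v)).
Qed.

Lemma normc_link_sum (x : G -> R[i]) v :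
  Normc.normc (link_sum j x v) <= link_sum j (fun u => Normc.normc (x u)) v.
Proof.
have norm_sum (I : finType) (P : pred I) (F : I -> R[i]) :
    Normc.normc (\sum_(i | P i) F i) <= \sum_(i | P i) Normc.normc (F i).
  elim/big_ind2: _ => [|a b a' b' Ha Hb|//]; first by rewrite Normc.normc0.
  by apply: le_trans (le_normcD _ _) _; apply: lerD.
apply: le_trans (norm_sum _ _ _) _; apply: ler_sum => f _.
by rewrite (big_morph _ (@Normc.normcM R) (@Normc.normc1 R)).
Qed.

Lemma normc_ge0 (z : R[i]) : 0 <= Normc.normc z.
Proof. by case: z => a b /=; rewrite sqrtr_ge0. Qed.

Lemma normc_real (a : R) : 0 <= a -> Normc.normc a%:C%C = a.
Proof. by move=> a0; rewrite /= expr0n addr0 sqrtr_sqr ger0_norm. Qed.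

(** Complex eigenvectors do no better than nonnegative vectors: by the triangle
    inequality the entrywise modulus of an eigenvector for an eigenvalue l
    gives the form a value at least the modulus of l.  Conversely a nonnegative
    maximiser is an eigenvector. *)
Lemma spectral_radiusE (c : R) (x : G -> R) :
  (forall v, 0 <= x v) -> 0 < \sum_v x v ^+ k -> form_bound G k c ->
  clique_sum k x = c * \sum_v x v ^+ k ->
  clique_spectral_radius R k G = c / (j`!)%:R.
Proof.
move=> x0 xS cB xmax.
have eig := maximiser_eigen (ltn0Sn j) (erefl _) j0 cB x0 xmax.
have c0 : 0 <= c.
  by rewrite -(pmulr_lge0 _ xS) -xmax clique_sum_ge0.
have f0 : 0 < (j`!)%:R :> R by rewrite ltr0n fact_gt0.
have cf0 : 0 <= c / (j`!)%:R by rewrite divr_ge0 // ltW.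
set S := eigenvalue_moduli (clique_tensor R k G).
have inS : S (c / (j`!)%:R).
  exists (c / (j`!)%:R)%:C%C; last exact: normc_real.
  exists [ffun v => (x v)%:C%C].
    apply: contraTneq xS => /ffunP xE; rewrite big1 ?ltxx // => v _.
    by have := xE v; rewrite !ffunE => -[->]; rewrite expr0n.
  move=> v; rewrite clique_tensor_app ffunE.
  have -> : link_sum j [ffun v => (x v)%:C%C] v = (link_sum j x v)%:C%C.
    rewrite /link_sum rmorph_sum; apply: eq_bigr => f _; rewrite rmorph_prod.
    by apply: eq_bigr => i _; rewrite ffunE.
  rewrite eig rmorphM rmorphXn mulrA; congr (_ * _).
  by rewrite rmorphM mulrC fmorphV rmorph_nat.
have ubS : ubound S (c / (j`!)%:R).
  move=> _ [l [y y0 eigy] <-].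
  pose z v := Normc.normc (y v).
  have z0 v : 0 <= z v by exact: normc_ge0.
  have zS : 0 < \sum_v z v ^+ k.
    case: (pickP (fun v => y v != 0)) => [v yv|y00].
      apply: (sum_pow_gt0 _ (v := v)) => //.
      by apply: contra yv => /eqP/Normc.eq0_normc/eqP.
    by case/eqP: y0; apply/ffunP => v; rewrite ffunE; have /negbFE/eqP := y00 v.
  have step v : Normc.normc l * z v ^+ j <= (j`!)%:R^-1 * link_sum j z v.
    have := congr1 (@Normc.normc R) (eigy v); rewrite clique_tensor_app.
    rewrite !Normc.normcM Normc.normcV -(rmorph_nat (real_complex R)) normc_real ?ler0n //.
    have -> : Normc.normc (y v ^+ j) = z v ^+ j.
      elim: (j) => [|i IH]; first by rewrite Normc.normc1.
      by rewrite !exprS Normc.normcM IH.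
    by move=> <-; rewrite ler_wpM2l ?invr_ge0 ?ler0n // normc_link_sum.
  rewrite -(ler_pM2r zS) mulrAC ler_pdivlMr // [leLHS]mulrC mulrA.
  apply: le_trans (cB z z0); rewrite clique_sumS big_distrr; apply: ler_sum => v _ /=.
  rewrite exprS.
  rewrite mulrCA ler_wpM2l // -mulrA [leLHS]mulrC -ler_pdivlMr //.
  by rewrite [leRHS]mulrC; apply: step.
apply: xget_unique; first by split.
move=> y [yS yub]; apply/eqP; rewrite eq_le; apply/andP; split.
  by apply: ubS.
by apply: yub.
Qed.

End SpectralRadius.

Section FormMax.
Variable R : realType.

(** The factorial cancels the normalisation of the clique tensor, which makes this
    the maximum of the plain clique sum. *)
Definition form_max (k : nat) (G : sgraph) : R :=
  clique_spectral_radius R k G * (k.-1)`!%:R.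

Variable k : nat.
Hypothesis k2 : (2 <= k)%N.
Let k0 : (0 < k)%N := ltnW k2.
Let kS : k = k.-1.+1. Proof. by case: k k2. Qed.
Let k1 : (0 < k.-1)%N. Proof. by case: k k2 => [|[]]. Qed.
Let kf : (k.-1)`!%:R != 0 :> R. Proof. by rewrite pnatr_eq0 -lt0n fact_gt0. Qed.

Lemma form_maxE (G : sgraph) (c : R) (x : G -> R) :
  (forall v, 0 <= x v) -> 0 < \sum_v x v ^+ k -> form_bound G k c ->
  clique_sum k x = c * \sum_v x v ^+ k -> form_max k G = c.
Proof.
move=> x0 xS cB xmax; rewrite /form_max.
have := @spectral_radiusE R G k.-1 k1 c x x0; rewrite -kS.
by move=> -> //; rewrite mulfVK.
Qed.

Lemma form_max_attained (G : sgraph) (a : R) : (0 < #|G|)%N -> 0 < a ->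
  exists x : G -> R, [/\ forall v, 0 <= x v, \sum_v x v ^+ k = a &
    clique_sum k x = form_max k G * a].
Proof.
move=> /card_gt0P[v0 _] a0.
have [x [x0 xS xB]] := @exists_maximiser R G k k0 v0.
have [b b0 bk] := exists_root k0 a0.
have <- : clique_sum k x = form_max k G.
  by symmetry; apply: (@form_maxE G _ x); rewrite ?xS ?mulr1 ?ltr01.
exists (fun v => b * x v); split.
- by move=> v; rewrite mulr_ge0 // ltW.
- by rewrite sum_powZ xS bk mulr1.
- by rewrite clique_sumZ bk mulrC.
Qed.

Lemma form_max_bound (G : sgraph) : form_bound G k (form_max k G).
Proof.
move=> y y0; have [|/card_gt0P[v0 _]] := posnP #|G|.
  move/card0_eq => G0.
  rewrite /clique_sum !big1 ?mulr0 // => [v|f] _; first by have := G0 v.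
  by have := G0 (f (Ordinal k0)).
have [x [x0 xS xB]] := @exists_maximiser R G k k0 v0.
by rewrite (@form_maxE G (clique_sum k x) x) ?xS ?mulr1 ?ltr01 //; apply: xB.
Qed.

End FormMax.

(** * Moon--Moser inequalities for weighted clique sums *)

Section MoonMoser.
Variables (R : realDomainType) (G : sgraph) (x : G -> R).
Hypothesis x0 : forall v, 0 <= x v.

Definition degree_sum k (f : {ffun 'I_k -> G}) : R := \sum_(v | nbr_of f v) x v.

Local Notation w f := (\prod_i x (f i)).

Lemma clique_sum_degree k :
  clique_sum k.+1 x = \sum_(f : {ffun 'I_k -> G} | clique_map f) w f * degree_sum f.
Proof.
rewrite clique_sumS; under eq_bigr do rewrite /link_sum big_distrr big_mkcondr.
rewrite exchange_big; apply: eq_bigr => f _; rewrite /degree_sum big_distrr /=.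
by rewrite -big_mkcond; apply: eq_bigr => v _; rewrite mulrC.
Qed.

Lemma sum_degree_remove k (f : {ffun 'I_k.+1 -> G}) :
  \sum_i degree_sum [ffun j => f (lift i j)] <= \sum_v x v + degree_sum f *+ k.
Proof.
rewrite /degree_sum -sumrMnl [X in _ <= _ + X]big_mkcond -big_split /=.
under eq_bigr do rewrite big_mkcond; rewrite exchange_big; apply: ler_sum => v _.
case: ifP => [fv|/negbT].
  rewrite -mulrS -[X in _ *+ X]card_ord -sumr_const; apply: ler_sum => i _.
  by case: ifP.
rewrite negb_forall => /existsP[i0 vi0].
rewrite addr0 (bigD1 i0) //= [X in _ + X]big1 => [|i ii0].
  by rewrite addr0; case: ifP.
case: ifP => // /forallP fv; have [j i0E|] := unliftP i i0.
  by have := fv j; rewrite ffunE -i0E (negbTE vi0).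
by move=> /eqP; rewrite eq_sym (negbTE ii0).
Qed.

(** Double count pairs of a clique on k+1 vertices and a vertex v joined to all
    but at most one of them: if v is joined to the whole clique, each of the
    k+1 ways of removing a vertex leaves v joined to the rest; otherwise at most
    one does. *)
Lemma sum_degree_sqr k :
  (\sum_(f : {ffun 'I_k -> G} | clique_map f) w f * degree_sum f ^+ 2) *+ k.+1 <=
  (\sum_v x v) * clique_sum k.+1 x + clique_sum k.+2 x *+ k.
Proof.
have -> : (\sum_(f : {ffun 'I_k -> G} | clique_map f) w f * degree_sum f ^+ 2) *+ k.+1
    = \sum_(f : {ffun 'I_k.+1 -> G} | clique_map f) w f *
        \sum_i degree_sum [ffun j => f (lift i j)].
  under [RHS]eq_bigr do rewrite big_distrr; rewrite exchange_big /=.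
  rewrite -[X in _ *+ X = _]card_ord -sumr_const; apply: eq_bigr => i _.
  pose F v (g : {ffun 'I_k -> G}) := x v * w g * degree_sum g.
  have E := @clique_sum_finsert G R k i x F.
  transitivity (\sum_v \sum_(g | clique_map g && nbr_of g v) F v g).
    under [RHS]eq_bigr do rewrite big_mkcondr.
    rewrite exchange_big; apply: eq_bigr => g _; rewrite /F.
    rewrite -big_mkcond /= -!big_distrl /= -/(degree_sum g); ring.
  rewrite -E; apply: eq_bigr => f _; rewrite /F (bigD1_ord i) //=.
  by congr (_ * _ * _); apply: eq_bigr => j _; rewrite ffunE.
rewrite (clique_sum_degree k.+1) -sumrMnl /clique_sum big_distrr -big_split /=.
apply: ler_sum => f _; rewrite [_ * w f]mulrC -mulrnAr -mulrDr.
by rewrite ler_wpM2l ?prodr_ge0 // sum_degree_remove.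
Qed.

Lemma weighted_cauchy (I : finType) (P : pred I) (p d : I -> R) :
  (forall i, 0 <= p i) ->
  (\sum_(i | P i) p i * d i) ^+ 2 <=
  (\sum_(i | P i) p i) * \sum_(i | P i) p i * d i ^+ 2.
Proof.
move=> p0; set S := \sum_(i | P i) p i * d i.
set W := \sum_(i | P i) p i; set Q := \sum_(i | P i) _.
have : 0 <= \sum_(i | P i) \sum_(j | P j) p i * p j * (d i - d j) ^+ 2.
  by apply: sumr_ge0 => i _; apply: sumr_ge0 => i' _;
    apply: mulr_ge0; [exact: mulr_ge0|exact: sqr_ge0].
suff -> : \sum_(i | P i) \sum_(j | P j) p i * p j * (d i - d j) ^+ 2 =
  (W * Q - S ^+ 2) *+ 2 by rewrite pmulrn_lge0 // subr_ge0.
transitivity (\sum_(i | P i) \sum_(j | P j) (p i * d i ^+ 2 * p j +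
   p i * (p j * d j ^+ 2) - p i * d i * (p j * d j) *+ 2)).
  by apply: eq_bigr => i _; apply: eq_bigr => i' _; ring.
under eq_bigr do rewrite sumrB big_split sumrMnl /=.
by rewrite sumrB big_split sumrMnl /= -!big_distrlr /= -/S -/W -/Q; ring.
Qed.

(** Cauchy--Schwarz on the degree sums of the k-cliques, whose first moment is
    the (k+1)-clique sum; sum_degree_sqr bounds the second moment. *)
Lemma moon_moser k :
  clique_sum k.+1 x ^+ 2 *+ k.+1 <= clique_sum k x *
   ((\sum_v x v) * clique_sum k.+1 x + clique_sum k.+2 x *+ k).
Proof.
apply: le_trans (_ : _ <= clique_sum k x * ((\sum_(f : {ffun 'I_k -> G} | clique_map f) w f * degree_sum f ^+ 2) *+ k.+1)) _.
  rewrite mulrnAr lerMn2r /= clique_sum_degree.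
  by apply: weighted_cauchy => f; apply: prodr_ge0.
by rewrite ler_wpM2l ?clique_sum_ge0 ?sum_degree_sqr.
Qed.

End MoonMoser.

(** * Dense families of tuples contain boxes *)

Lemma leq_ffact_exp d m : ((d - m) ^ m <= d ^_ m)%N.
Proof.
elim: m d => [|m IH] d; first by rewrite ffactn0.
case: d => [|d]; first by rewrite exp0n.
by rewrite ffactnS expnS subSS leq_mul //; lia.
Qed.

Section Boxes.
Variable R : realType.

Lemma archimedean_le (K c : R) : 0 < c ->
  exists N : nat, forall n : nat, (N <= n)%N -> K <= c * n%:R.
Proof.
move=> c0; exists (Num.bound (`|K| / c)) => n Nn.
have : `|K| / c < (Num.bound (`|K| / c))%:R.
  by apply: archi_boundP; rewrite divr_ge0 // ltW.
rewrite ltr_pdivrMr // mulrC => h; apply: le_trans (ler_norm K) _; apply: le_trans (ltW h) _.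
by rewrite ler_pM2l // ler_nat.
Qed.

(** Write the tuples as a coordinate v followed by a shorter tuple z.  A constant
    fraction of the z have linearly many partners v, so on average over the
    injective m-tuples y of vertices, a constant fraction of the z are partners
    of every entry of y; fix such a y and repeat with those z. *)
Lemma dense_box k m (eps : R) : 0 < eps ->
  exists N : nat, forall (V : finType) (H : {set {ffun 'I_k -> V}}),
    (N <= #|V|)%N -> eps * #|V|%:R ^+ k <= #|H|%:R ->
    exists S : 'I_k -> {set V}, (forall i, (m <= #|S i|)%N) /\
      forall f : {ffun 'I_k -> V}, (forall i, f i \in S i) -> f \in H.
Proof.
elim: k eps => [|k IH] eps eps0.
  exists 0%N => V H _; rewrite expr0 mulr1 => HS.
  have /card_gt0P[f fH] : (0 < #|H|)%N.
    by rewrite -(ltr0n R); apply: lt_le_trans HS.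
  exists (fun _ => set0); split => [[]//|g _].
  by rewrite (_ : g = f) //; apply/ffunP => -[].
pose eps' := (eps / 4) ^+ m * (eps / 4).
have eps'0 : 0 < eps' by rewrite mulr_gt0 ?exprn_gt0 // divr_gt0.
have [N0 HN0] := IH eps' eps'0.
have [N1 arch] := archimedean_le (4 * m%:R) eps0.
exists (maxn 1 (maxn N0 N1)) => V H; rewrite !geq_max => /and3P[n0 nN0 nN1] HS.
set n : R := #|V|%:R in HS *.
have npos : 0 < n by rewrite ltr0n.
have en : 0 < eps * n by rewrite mulr_gt0.
have mn : m%:R <= eps * n / 4 by have := arch _ nN1; rewrite -/n; lra.
pose D (z : {ffun 'I_k -> V}) := [set v | finsert ord0 v z \in H].
pose Y (y : {ffun 'I_m -> V}) : {set {ffun 'I_k -> V}} :=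
  [set z | [forall j, y j \in D z]].
have sumD : \sum_z #|D z|%:R = #|H|%:R :> R.
  have -> : #|H| = \sum_(f : {ffun 'I_k.+1 -> V}) (f \in H : nat).
    by rewrite -sum1_card big_mkcond; apply: eq_bigr => f _; case: (f \in H).
  rewrite -natr_sum (sum_finsert ord0) exchange_big /=.
  congr (_%:R); apply: eq_bigr => z _; rewrite -sum1_card big_mkcond.
  by apply: eq_bigr => v _; rewrite inE; case: (_ \in H).
have sumY : \sum_(y : {ffun 'I_m -> V} | injectiveb y) #|Y y|%:R =
    \sum_z (#|D z| ^_ m)%:R :> R.
  rewrite -!natr_sum; congr (_%:R).
  transitivity (\sum_(y : {ffun 'I_m -> V} | injectiveb y) \sum_z (z \in Y y : nat))%N.
    apply: eq_bigr => y _; rewrite -sum1_card big_mkcond.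
    by apply: eq_bigr => z _; case: (z \in Y y).
  rewrite exchange_big; apply: eq_bigr => z _ /=.
  rewrite -[X in _ ^_ X]card_ord -card_inj_ffuns_on -sum1_card big_mkcond [RHS]big_mkcond.
  apply: eq_bigr => y _; rewrite !inE; case: (injectiveb y); rewrite ?andbF ?andbT //.
have term z : (eps / 4) ^+ m * n ^+ m * (#|D z|%:R / n - eps / 2) <= (#|D z| ^_ m)%:R.
  set d := #|D z|; have dn : d%:R <= n by rewrite ler_nat max_card.
  have [small|big] := ltP (d%:R / n) (eps / 2).
    apply: le_trans (ler0n _ _); apply: mulr_ge0_le0; last by lra.
    by rewrite mulr_ge0 ?exprn_ge0 ?divr_ge0 ?ltW.
  have d1 : d%:R / n <= 1 by rewrite ler_pdivrMr ?mul1r.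
  have md : (m <= d)%N.
    rewrite -(ler_nat R); apply: le_trans mn _.
    by move: big; rewrite ler_pdivlMr //; lra.
  apply: le_trans (_ : (eps / 4 * n) ^+ m <= _).
    by rewrite [leRHS]exprMn ler_piMr ?mulr_ge0 ?exprn_ge0 ?divr_ge0 ?ltW //; lra.
  apply: le_trans (_ : ((d - m) ^ m)%:R <= _); last by rewrite ler_nat leq_ffact_exp.
  rewrite natrX lerXn2r ?nnegrE ?ler0n //; first by lra.
  by rewrite natrB //; move: big; rewrite ler_pdivlMr //; lra.
have total : (eps / 4) ^+ m * (eps / 2) * n ^+ (m + k) <=
    \sum_(y : {ffun 'I_m -> V} | injectiveb y) #|Y y|%:R.
  rewrite sumY; apply: le_trans (ler_sum _ (fun z _ => term z)).
  rewrite -big_distrr sumrB -big_distrl /= sumD sumr_const card_ffun card_ord.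
  rewrite -[X in _ - X]mulr_natr natrX -/n exprD.
  have : eps * n ^+ k <= #|H|%:R / n by rewrite ler_pdivlMr // -mulrA -exprSr.
  set A := (eps / 4) ^+ m; set B := n ^+ m; set C := n ^+ k => h.
  have A0 : 0 <= A by rewrite exprn_ge0 // divr_ge0 // ltW.
  have B0 : 0 <= B by rewrite exprn_ge0 // ltW.
  rewrite [leLHS](_ : _ = A * B * (eps * C - eps / 2 * C)); last by field.
  by rewrite ler_wpM2l ?mulr_ge0 //; lra.
have [y /injectiveP inj_y Yy] : exists2 y : {ffun 'I_m -> V}, injectiveb y &
    eps' * n ^+ k <= #|Y y|%:R.
  case: (pickP (fun y : {ffun 'I_m -> V} => injectiveb y && (eps' * n ^+ k <= #|Y y|%:R))).
    by move=> y /andP[]; exists y.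
  move=> none; move: total; rewrite leNgt => /negP[].
  apply: le_lt_trans (_ : \sum_(y : {ffun 'I_m -> V}) eps' * n ^+ k < _).
    rewrite big_mkcond; apply: ler_sum => y _; case: ifP => [iy|_].
      by have := none y; rewrite iy /= => /negbT; rewrite -ltNge => /ltW.
    by rewrite mulr_ge0 ?exprn_ge0 // ltW.
  rewrite sumr_const card_ffun card_ord -[ltLHS]mulr_natr natrX -/n exprD /eps'.
  rewrite [ltLHS](_ : _ = (eps / 4) ^+ m * n ^+ k * n ^+ m * (eps / 4)); last by ring.
  rewrite [ltRHS](_ : _ = (eps / 4) ^+ m * n ^+ k * n ^+ m * (eps / 2)); last by ring.
  by rewrite ltr_pM2l ?mulr_gt0 ?exprn_gt0 ?divr_gt0 //; lra.
have [S [mS SH]] := HN0 V (Y y) nN0 Yy.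
pose S1 (i : 'I_k.+1) := oapp S [set y j | j in 'I_m] (unlift ord0 i).
exists S1; split => [i|f fS].
  rewrite /S1; case: unliftP => [j|] _ /=; first exact: mS.
  by rewrite card_imset // card_ord.
have := fS ord0; rewrite /S1 unlift_none => /imsetP[j _ fj].
have -> : f = finsert ord0 (y j) [ffun i => f (lift ord0 i)].
  apply/ffunP => i; rewrite ffunE; case: unliftP => [i' ->|-> //] /=.
  by rewrite ffunE.
have /SH : forall i, [ffun i => f (lift ord0 i)] i \in S i.
  by move=> i; rewrite ffunE; have := fS (lift ord0 i); rewrite /S1 liftK.
by rewrite inE => /forallP/(_ j); rewrite inE.
Qed.

End Boxes.

(** * Stability of near-extremal weightings *)

Section TuranSequence.
Variable R : realType.
Variables (r s : nat).

(** The density of ordered m-cliques in a balanced complete r-partite graph. *)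
Definition turan_density (m : nat) : R := \prod_(i < m) (1 - i%:R / r%:R).

Lemma turan_densityS m : turan_density m.+1 = turan_density m * (1 - m%:R / r%:R).
Proof. by rewrite /turan_density big_ord_recr. Qed.

Lemma turan_density_gt0 m : (m <= r)%N -> 0 < turan_density m.
Proof.
move=> mr; apply: prodr_gt0 => i _; have ir := leq_trans (ltn_ord i) mr.
by rewrite subr_gt0 ltr_pdivrMr ?mul1r ?ltr_nat // ltr0n (leq_ltn_trans _ ir).
Qed.

Lemma turan_density_le1 m : (m <= r)%N -> turan_density m <= 1.
Proof.
move=> mr; apply: prodr_ile1 => i _; have ir := leq_trans (ltn_ord i) mr.
rewrite subr_ge0 gerBl divr_ge0 ?ler0n // andbT ler_pdivrMr ?mul1r ?ler_nat; first exact: ltnW.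
by rewrite ltr0n (leq_ltn_trans _ ir).
Qed.

Lemma expr1D_le (y : R) m : 0 <= y <= 1 -> (1 + y) ^+ m <= 1 + 2 ^+ m * y.
Proof.
move=> /andP[y0 y1].
suff : (1 + y) ^+ m <= 1 + (2 ^+ m - 1) * y by lra.
elim: m => [|m IH]; first by rewrite !expr0; lra.
have p1 : 1 <= 2 ^+ m :> R by rewrite exprn_ege1 //; lra.
rewrite !exprS; apply: le_trans (_ : (1 + y) * (1 + (2 ^+ m - 1) * y) <= _).
  by apply: ler_wpM2l => //; lra.
move: (2 ^+ m : R) p1 => p p1 {IH}; rewrite -subr_ge0.
rewrite (_ : _ - _ = (p - 1) * y * (1 - y)); last by ring.
by rewrite !mulr_ge0 // subr_ge0.
Qed.

(** The properties of the normalised clique sums of a weighted graph, indexed by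
    the size of the clique, that determine their extremal behaviour. *)
Definition clique_densities (kap : nat -> R) : Prop :=
  [/\ forall j, 0 <= kap j, kap 0%N = 1, forall j, kap j.+1 <= kap j &
      forall j, j.+1%:R * kap j.+1 ^+ 2 <= kap j * (kap j.+1 + j%:R * kap j.+2)].

(** If one ratio of consecutive densities is almost as small as it can be, so
    are all the earlier ones: this is the Moon--Moser inequality read
    downwards. *)
Lemma ratio_descent (kap : nat -> R) (e : R) j : clique_densities kap -> e <= 1 -> (0 < j <= r)%N -> 0 < kap j ->
  kap j.+1 <= e * kap j ->
  forall i, (i <= j)%N -> kap i.+1 <= kap i * (1 - i%:R * (1 - e) / r%:R).
Proof.
move=> [_ _ kap_noninc kap_mm] e1 /andP[j0 jr] kj small.
have r0 : 0 < r%:R :> R by rewrite ltr0n (leq_trans j0).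
have kpos i : (i <= j)%N -> 0 < kap i.
  move=> ij; apply: lt_le_trans kj _; rewrite -(subnK ij).
  by elim: (j - i)%N => [|d IH] //; apply: le_trans IH; rewrite addSn.
suff H d : (d <= j)%N -> kap (j - d).+1%N <= kap (j - d)%N * (1 - (j - d)%:R * (1 - e) / r%:R).
  by move=> i ij; have := H (j - i)%N (leq_subr _ _); rewrite subKn.
elim: d => [_|d IH dj].
  rewrite subn0; apply: le_trans small _; rewrite mulrC ler_wpM2l ?(ltW kj) //.
  have : j%:R / r%:R <= 1 :> R by rewrite ler_pdivrMr // mul1r ler_nat.
  by rewrite -mulrA [(1 - e) / _]mulrC mulrA; move: (_ / _) => q q1; nra.
have {}IH := IH (ltnW dj).
case E : (j - d.+1)%N => [|i].
  by rewrite !mul0r subr0 mulr1.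
have Ed : (j - d)%N = i.+2 by lia.
rewrite Ed in IH.
have ki := kpos i.+2 ltac:(lia); have ki1 := kpos i.+1 ltac:(lia).
have := kap_mm i.+1.
set a := kap i.+1 in ki1 IH *; set b := kap i.+2 in ki IH *.
move: IH; set c := kap i.+3; rewrite -!mulrA.
have -> : i.+2%:R = i.+1%:R + 1 :> R by rewrite -natr1.
have i10 : 0 < i.+1%:R :> R by rewrite ltr0n.
move: (i.+1%:R : R) i10 ((1 - e) / r%:R) => q q0 th c_le mm.
have q1 : 0 < q + 1 by lra.
rewrite -(ler_pM2l (mulr_gt0 q1 ki)).
rewrite [leLHS](_ : _ = (q + 1) * b ^+ 2); last by ring.
apply: le_trans mm _.
rewrite [leRHS](_ : _ = a * (b + q * (b * (1 - (q + 1) * th)))); last by ring.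
by rewrite ler_pM2l // lerD2l ler_pM2l.
Qed.

Hypotheses (s2 : (2 <= s)%N) (sr : (s <= r)%N).
Let r0 : 0 < r%:R :> R. Proof. by rewrite ltr0n; lia. Qed.

(** If the (r+1)-cliques are sparse but the s-cliques are as dense as they can
    be, then some ratio between s and r is small; by descent every ratio below s
    is at most about its value in the balanced complete r-partite graph, and the
    density of s-cliques leaves no room for any of them to be smaller. *)
Lemma turan_sequence_stability (eps : R) : 0 < eps ->
  exists2 del, 0 < del & forall kap, clique_densities kap ->
    turan_density s - del <= kap s -> kap r.+1 <= del ->
    [/\ 1 - eps <= kap 1%N, 1 - r%:R^-1 - eps <= kap 2%N &
        kap 3%N <= (1 - 2 / r%:R + eps) * kap 2%N].
Proof.
move=> eps0; have fs0 := turan_density_gt0 sr.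
have rr1 : 1 <= r%:R :> R by rewrite ler1n; lia.
have [e [e0 e1 e_eps eps_e]] : exists e, [/\ 0 < e, e < 1, r%:R * e <= 1 &
    2 ^+ s * (r%:R * e) + e <= eps].
  have p1 : 1 <= 2 ^+ s :> R by rewrite exprn_ege1 //; lra.
  pose A := 2 ^+ s * r%:R + 1 : R.
  have Ar : r%:R + 1 <= A by rewrite /A lerD2r ler_peMl // ltW.
  have m0 : 0 < Num.min 1 eps by rewrite lt_min ltr01.
  have m1 : Num.min 1 eps <= 1 by rewrite ge_min lexx.
  have me : Num.min 1 eps <= eps by rewrite ge_min lexx orbT.
  pose e := Num.min 1 eps / (A * 2).
  have e0 : 0 < e by rewrite divr_gt0 //; lra.
  have eA : e * A = Num.min 1 eps / 2 by rewrite /e; field; lra.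
  have le_eA : e * (r%:R + 1) <= e * A by rewrite ler_pM2l.
  have re0 : 0 < e * r%:R by rewrite mulr_gt0.
  exists e; split; rewrite ?[r%:R * e]mulrC //; [by lra|by lra|].
  have -> : 2 ^+ s * (e * r%:R) + e = e * A by rewrite /A; ring.
  by lra.
have re0 : 0 < r%:R * e by rewrite mulr_gt0.
set q := (1 + r%:R * e) ^+ s.
have q_le : q <= 1 + 2 ^+ s * (r%:R * e).
  by apply: expr1D_le; rewrite e_eps mulr_ge0 ?ler0n ?ltW.
exists (turan_density s * Num.min (e / 2) (e ^+ r.+1 / 4)).
  by rewrite mulr_gt0 // lt_min !divr_gt0 ?exprn_gt0.
set del := Num.min _ _.
have del_e : del <= e / 2 by rewrite ge_min lexx.
have del_er : del <= e ^+ r.+1 / 4 by rewrite ge_min lexx orbT.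
move=> kap kapP; have [kap_ge0 kap0 kap_noninc kap_mm] := kapP => ks kr.
have ks0 : turan_density s / 2 <= kap s.
  by apply: le_trans ks; nra.
have kle i j : (i <= j)%N -> kap j <= kap i.
  move=> ij; rewrite -(subnK ij); elim: (j - i)%N => [|d IH] //.
    exact: le_trans (kap_noninc _) IH.
(* some ratio between s and r is small, for otherwise kap r.+1 would be large *)
have [j [/andP[sj jr] kj small]] : exists j, [/\ (s <= j <= r)%N, 0 < kap j &
    kap j.+1 <= e * kap j].
  have [d dr|none] := pickP (fun d : 'I_r.+1 => (s <= d)%N && (kap d.+1 <= e * kap d)).
    case/andP: dr => sd dr; have dr' : (d <= r)%N by rewrite -ltnS.
    have ex : exists d, (s <= d)%N && (kap d.+1 <= e * kap d) by exists d; rewrite sd.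
    case: (ex_minnP ex) => j /andP[sj small] jmin; exists j.
    rewrite sj small (leq_trans _ dr') ?jmin ?sd //; split=> //.
    have : forall i, (s + i <= j)%N -> 0 < kap (s + i)%N.
      elim=> [_|i IH ij]; first by rewrite addn0; lra.
      rewrite addnS ltNge; apply/negP => ki.
      have := jmin (s + i)%N; rewrite leq_addr /= (le_trans ki).
        by rewrite leqNgt -addnS ij => /(_ isT).
      by rewrite mulr_ge0 // ltW.
    by move=> /(_ (j - s)%N); rewrite subnKC // => /(_ (leqnn _)).
  suff : forall i, (s + i <= r.+1)%N -> e ^+ i * kap s <= kap (s + i)%N.
    move=> /(_ (r.+1 - s)%N); rewrite subnKC ?(leq_trans sr) // => /(_ (leqnn _)) kr'.
    have ee : e ^+ r.+1 <= e ^+ (r.+1 - s) by rewrite ler_wiXn2l ?leq_subr // ltW.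
    have er0 : 0 < e ^+ r.+1 by rewrite exprn_gt0.
    exfalso.
    have h1 : e ^+ r.+1 * (turan_density s / 2) <= e ^+ (r.+1 - s) * kap s.
      by rewrite ler_pM // ?divr_ge0 // ltW.
    have h2 : turan_density s * del <= turan_density s * (e ^+ r.+1 / 4).
      by rewrite ler_pM2l.
    have h3 : 0 < e ^+ r.+1 * turan_density s by rewrite mulr_gt0.
    by lra.
  elim=> [_|i IH ij]; first by rewrite addn0 expr0 mul1r.
  have sir : (s + i < r.+1)%N by rewrite -addnS.
  have := none (Ordinal sir); rewrite /= leq_addr /= => /negbT; rewrite -ltNge => /ltW.
  rewrite addnS; apply: le_trans; rewrite exprS -mulrA ler_pM2l //.
  exact: IH (ltnW sir).
have j_range : (0 < j <= r)%N by rewrite jr (leq_trans _ sj) // ltnW.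
have desc := ratio_descent kapP (ltW e1) j_range kj small.
have u_le i : (i < s)%N -> kap i.+1 <= kap i * ((1 - i%:R / r%:R) * (1 + r%:R * e)).
  move=> lt_is; apply: le_trans (desc i (leq_trans (ltnW lt_is) sj)) _.
  rewrite ler_wpM2l //.
  have lt_ir : (i < r)%N := leq_trans lt_is sr.
  have ri : 1 <= r%:R - i%:R :> R by rewrite -natrB ?ler1n ?subn_gt0 // ltnW.
  have -> : (1 - i%:R / r%:R) * (1 + r%:R * e) = 1 - i%:R / r%:R + (r%:R - i%:R) * e :> R.
    by field; lra.
  have : i%:R / r%:R <= 1 :> R by rewrite ler_pdivrMr // mul1r; lra.
  rewrite mulrAC; move: (i%:R / r%:R : R) => p p1; rewrite -subr_ge0.
  rewrite (_ : _ - _ = (r%:R - i%:R - p) * e); last by ring.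
  by apply: mulr_ge0; lra.
have ladder m i : (m + i <= s)%N ->
    kap (m + i)%N * turan_density m <= kap m * turan_density (m + i) * (1 + r%:R * e) ^+ i.
  elim: i => [_|i IH mi]; first by rewrite addn0 expr0 mulr1.
  rewrite addnS turan_densityS exprS in mi *; have {}IH := IH (ltnW mi).
  apply: le_trans (_ : kap (m + i)%N * ((1 - (m + i)%:R / r%:R) * (1 + r%:R * e)) * turan_density m <= _).
    by rewrite ler_wpM2r ?u_le // ltW // turan_density_gt0 // (leq_trans _ sr) // (leq_trans _ mi) // leqW // leq_addr.
  rewrite [leLHS](_ : _ = ((1 - (m + i)%:R / r%:R) * (1 + r%:R * e)) * (kap (m + i)%N * turan_density m)); last by ring.
  rewrite [leRHS](_ : _ = ((1 - (m + i)%:R / r%:R) * (1 + r%:R * e)) * (kap m * turan_density (m + i) * (1 + r%:R * e) ^+ i)); last by ring.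
  apply: ler_wpM2l; last exact: IH.
  apply: mulr_ge0; last by lra.
  by rewrite subr_ge0 ler_pdivrMr // mul1r ler_nat (leq_trans _ sr) // ltnW.
have low m : (m <= s)%N -> turan_density m - e <= kap m * q.
  move=> ms; have := ladder m (s - m)%N; rewrite subnKC // => /(_ (leqnn _)) h.
  have fm0 : 0 < turan_density m by apply: turan_density_gt0; exact: leq_trans ms sr.
  have fm1 : turan_density m <= 1 by apply: turan_density_le1; exact: leq_trans ms sr.
  have qm : (1 + r%:R * e) ^+ (s - m) <= q.
    by rewrite ler_weXn2l ?leq_subr //; lra.
  rewrite -(ler_pM2l fs0).
  apply: le_trans (_ : kap s * turan_density m <= _).
    apply: le_trans (_ : (turan_density s - turan_density s * del) * turan_density m <= _).
      rewrite -subr_ge0 (_ : _ - _ = turan_density s * (e - del * turan_density m)); last by ring.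
      by rewrite mulr_ge0 ?subr_ge0 //; nra.
    by rewrite ler_wpM2r // ltW.
  apply: le_trans h _; rewrite [kap m * _]mulrC -mulrA ler_pM2l //.
  by rewrite ler_wpM2l.
have fin m : (m <= s)%N -> turan_density m - eps <= kap m.
  move=> ms; have := low m ms.
  have km1 : kap m <= 1 by rewrite -kap0 kle.
  have km0 := kap_ge0 m.
  have p0 : 0 <= 2 ^+ s * (r%:R * e) by rewrite mulr_ge0 ?exprn_ge0 ?mulr_ge0 ?ler0n // ltW.
  by nra.
split.
- by have := fin 1%N (ltnW s2); rewrite turan_densityS /turan_density big_ord0; lra.
- by have := fin 2%N s2; rewrite !turan_densityS /turan_density big_ord0; lra.
- apply: le_trans (desc 2%N (leq_trans s2 sj)) _.
  rewrite mulrC ler_wpM2r //.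
  have rp : 0 < r%:R^-1 :> R by rewrite invr_gt0.
  have rp2 : r%:R^-1 <= 2^-1 :> R.
    by rewrite lef_pV2 ?posrE // ler_nat; exact: leq_trans s2 sr.
  have ps : 0 <= 2 ^+ s * (r%:R * e) by rewrite mulr_ge0 ?exprn_ge0 // ltW.
  by move: (r%:R^-1 : R) rp rp2 => p p0 p2; nra.
Qed.

End TuranSequence.

Section PowerMean.
Variable R : realDomainType.

(** The tangent-line inequality for z ^ s at 1, with a quadratic defect: it makes
    an average close to the power mean force all values close to 1. *)
Lemma sqr_le_power (s : nat) (z : R) : (2 <= s)%N -> 0 <= z ->
  (z - 1) ^+ 2 <= z ^+ s - s%:R * z + (s%:R - 1).
Proof.
move=> s2 z0; rewrite -(subnK s2); elim: (s - 2)%N => [|m IH].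
  by rewrite add0n; lra.
rewrite addSn [z ^+ _.+1]exprS -natr1; set k := (m + 2)%N in IH *.
have h : 0 <= z * (z ^+ k - k%:R * z + (k%:R - 1)).
  by rewrite mulr_ge0 // (le_trans _ IH) // sqr_ge0.
have k1 : 1 <= k%:R :> R by rewrite ler1n /k; lia.
have h2 : 0 <= (k%:R - 1) * (z - 1) ^+ 2 by rewrite mulr_ge0 ?sqr_ge0 ?subr_ge0.
rewrite -subr_ge0.
rewrite (_ : _ - _ = z * (z ^+ k - k%:R * z + (k%:R - 1)) + (k%:R - 1) * (z - 1) ^+ 2).
  exact: addr_ge0.
by ring.
Qed.

Lemma sum_sqr_dev (I : finType) (s : nat) (x : I -> R) : (2 <= s)%N ->
  (forall v, 0 <= x v) -> \sum_v x v ^+ s = #|I|%:R ->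
  \sum_v (x v - 1) ^+ 2 <= s%:R * (#|I|%:R - \sum_v x v).
Proof.
move=> s2 x0 xs.
apply: le_trans (ler_sum _ (fun v _ => sqr_le_power s2 (x0 v))) _.
rewrite big_split sumrB /= xs -big_distrr sumr_const /= -[X in _ + X]mulr_natr.
by rewrite (_ : #|[eta predT]| = #|I|) //; lra.
Qed.

Lemma sum_le_card (I : finType) (s : nat) (x : I -> R) : (2 <= s)%N ->
  (forall v, 0 <= x v) -> \sum_v x v ^+ s = #|I|%:R -> \sum_v x v <= #|I|%:R.
Proof.
move=> s2 x0 xs; rewrite -subr_ge0 -(pmulr_rge0 _ (_ : 0 < s%:R)) ?ltr0n; last by lia.
by apply: le_trans (sum_sqr_dev s2 x0 xs); apply: sumr_ge0 => v _; apply: sqr_ge0.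
Qed.

End PowerMean.

Section Densities.
Variable R : realType.

Lemma clique_sum_densities (G : sgraph) (x : G -> R) : (0 < #|G|)%N ->
  (forall v, 0 <= x v) -> \sum_v x v <= #|G|%:R ->
  clique_densities (fun j => clique_sum j x / #|G|%:R ^+ j).
Proof.
move=> n0 x0 xn; set n : R := #|G|%:R in xn *.
have npos : 0 < n by rewrite ltr0n.
have T0 j := clique_sum_ge0 x0 j.
split=> [j||j|j].
- by rewrite divr_ge0 ?exprn_ge0 // ltW.
- by rewrite clique_sum0 expr0 divr1.
- rewrite ler_pdivrMr ?exprn_gt0 // exprS mulrCA divfK ?gt_eqF ?exprn_gt0 //.
  rewrite clique_sum_degree big_distrr; apply: ler_sum => f _ /=.
  rewrite mulrC ler_wpM2r ?prodr_ge0 //; apply: le_trans xn.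
  by rewrite /degree_sum big_mkcond; apply: ler_sum => v _; case: ifP.
- have := moon_moser x0 j.
  set A := clique_sum j x; set B := clique_sum j.+1 x; set C := clique_sum j.+2 x => h.
  have {}h : j.+1%:R * B ^+ 2 <= A * (n * B + j%:R * C).
    rewrite [j.+1%:R * _]mulr_natl; apply: le_trans h _; apply: ler_wpM2l; first exact: T0.
    by rewrite [j%:R * _]mulr_natl lerD2r ler_wpM2r ?T0.
  have -> : n ^+ j.+2 = n * (n * n ^+ j) by rewrite !exprS.
  have -> : n ^+ j.+1 = n * n ^+ j by rewrite exprS.
  have : 0 < n ^+ j by rewrite exprn_gt0.
  move: (n ^+ j) => p p0.
  have nn : n != 0 by rewrite gt_eqF.
  have pn : p != 0 by rewrite gt_eqF.
  rewrite -(ler_pM2r (_ : 0 < p * p * n * n)) ?mulr_gt0 //.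
  rewrite [leLHS](_ : _ = j.+1%:R * B ^+ 2); last by field; rewrite nn pn.
  by rewrite [leRHS](_ : _ = A * (n * B + j%:R * C)) //; field; rewrite nn pn.
Qed.

(** The Moon--Moser inequality read upwards: a lower bound for the
    first ratio of consecutive densities gives bounds for the next ones that
    decrease by eta each time. *)
Lemma densities_lower (kap : nat -> R) (eta : R) : clique_densities kap ->
  0 < kap 2%N -> (1 - eta) * kap 1%N <= kap 2%N ->
  0 <= eta -> forall j, j%:R * eta < 1 -> (1 - j.+1%:R * eta) * kap j.+1 <= kap j.+2.
Proof.
move=> [kap_ge0 kap0 kap_noninc kap_mm] k2 k12 eta0.
suff H j : j%:R * eta < 1 -> 0 < kap j.+1 /\ (1 - j.+1%:R * eta) * kap j.+1 <= kap j.+2.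
  by move=> j /H[].
elim: j => [_|j IH jeta].
  by rewrite mul1r; split=> //; apply: lt_le_trans k2 _.
have [] := IH _.
  by apply: le_lt_trans jeta; rewrite ler_wpM2r // ler_nat.
set a := kap j.+1; set b := kap j.+2 => a0 ab.
have b0 : 0 < b by apply: lt_le_trans ab; rewrite mulr_gt0 // subr_gt0.
split=> //; have := kap_mm j.+1; rewrite -/a -/b; set c := kap _.
have -> : j.+2%:R = j.+1%:R + 1 :> R by rewrite -natr1.
have q0 : 0 < j.+1%:R :> R by rewrite ltr0n.
move: (j.+1%:R : R) q0 ab jeta => q q0 ab jeta mm.
rewrite -(ler_pM2l (mulr_gt0 q0 a0)).
have : 0 <= (q + 1) * b * (b - (1 - q * eta) * a).
  by rewrite mulr_ge0 ?subr_ge0 // mulr_ge0 ?(ltW b0) //; lra.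
by lra.
Qed.

End Densities.

Section Profile.
Variable R : realType.
Variables (r s : nat).
Hypotheses (s2 : (2 <= s)%N) (sr : (s <= r)%N).

Definition degree (G : sgraph) (v : G) : nat := #|[set u | adj v u]|.

Lemma sum_link1_sqr (G : sgraph) (x : G -> R) : (forall v, 0 <= x v) ->
  (\sum_v x v * link_sum 1 x v ^+ 2) *+ 2 <=
  (\sum_v x v) * clique_sum 2 x + clique_sum 3 x.
Proof.
move=> x0; have := sum_degree_sqr x0 1; rewrite mulr1n; apply: le_trans.
rewrite lerMn2r /= [leRHS]big_mkcond (sum_finsert ord0); apply: ler_sum => v _.
rewrite (sum_ffun0 _ [ffun i => v]) clique_finsert prod_finsert big_ord0 mulr1.
rewrite clique_map0 nbr_of0 link_sum1E /degree_sum /=.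
by under [X in _ <= _ * X ^+ 2]eq_bigl do rewrite nbr_of1 adj_sym.
Qed.

(** Stability gives the densities of vertices, edges and triangles.  The first
    says that the mean weight is close to the power mean, whence the first claim;
    the edges give the mean of the weighted degree and the triangles, through
    sum_link1_sqr, its second moment, whence the second. *)
Lemma weighted_profile (eps : R) : 0 < eps ->
  exists2 del, 0 < del & forall (G : sgraph) (x : G -> R), (0 < #|G|)%N ->
    (forall v, 0 <= x v) -> \sum_v x v ^+ s = #|G|%:R ->
    (turan_density R r s - del) * #|G|%:R ^+ s <= clique_sum s x ->
    clique_sum r.+1 x <= del * #|G|%:R ^+ r.+1 ->
    \sum_v (x v - 1) ^+ 2 <= s%:R * eps * #|G|%:R /\
    \sum_v x v * (link_sum 1 x v - (1 - r%:R^-1) * #|G|%:R) ^+ 2 <=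
      2 * eps * #|G|%:R ^+ 3.
Proof.
move=> eps0; pose e := Num.min eps 2^-1.
have e0 : 0 < e by rewrite lt_min eps0 invr_gt0 ltr0n.
have e_eps : e <= eps by rewrite ge_min lexx.
have e_half : e <= 2^-1 by rewrite ge_min lexx orbT.
have [del del0 Hdel] := @turan_sequence_stability R r s s2 sr e e0.
exists del => // G x n0 x0 xs; set n : R := #|G|%:R in xs * => hs hr.
have npos : 0 < n by rewrite ltr0n.
have xn : \sum_v x v <= n by exact: sum_le_card xs.
have [] := Hdel _ (clique_sum_densities n0 x0 xn).
- by rewrite ler_pdivlMr // exprn_gt0.
- by rewrite ler_pdivrMr // exprn_gt0.
rewrite -/n expr1 clique_sum1 ler_pdivlMr // => k1.
rewrite ler_pdivlMr ?exprn_gt0 // ler_pdivrMr ?exprn_gt0 // => k2 k3.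
split.
  apply: le_trans (sum_sqr_dev s2 x0 xs) _; rewrite -/n -mulrA ler_wpM2l //.
  have : e * n <= eps * n by rewrite ler_wpM2r // ltW.
  by lra.
have T2E := clique_sumS 1 x; set d := link_sum 1 x in T2E *.
set S1 := \sum_v x v in xn k1 *; set T2 := clique_sum 2 x in k2 k3 T2E.
set T3 := clique_sum 3 x in k3.
have r2 : 2 <= r%:R :> R by rewrite ler_nat; exact: leq_trans s2 sr.
have ri : 0 < (r%:R^-1 : R) <= 2^-1.
  by apply/andP; split; [rewrite invr_gt0|rewrite lef_pV2 ?posrE]; lra.
have {}k3 : T3 <= (1 - 2 / r%:R + e) * T2 * n.
  apply: le_trans k3 _; rewrite le_eqVlt; apply/orP; left; apply/eqP; field.
  by rewrite (gt_eqF npos) gt_eqF //; lra.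
have := sum_link1_sqr x0; rewrite -/d -/S1 -/T2 -/T3; set Q := \sum_v _ => hQ.
have T20 : 0 <= T2 by apply: clique_sum_ge0.
have -> : \sum_v x v * (d v - (1 - r%:R^-1) * n) ^+ 2 =
    Q - 2 * ((1 - r%:R^-1) * n) * T2 + ((1 - r%:R^-1) * n) ^+ 2 * S1.
  rewrite T2E !big_distrr -sumrB -big_split /=; apply: eq_bigr => v _; ring.
move: (r%:R^-1 : R) ri k2 k3 => p /andP[p0 p2] k2 k3.
have h1 : S1 * T2 <= n * T2 by rewrite ler_wpM2r.
have h2 : ((1 - p) * n) ^+ 2 * S1 <= ((1 - p) * n) ^+ 2 * n by rewrite ler_wpM2l ?sqr_ge0.
have hQ2 : 2 * Q <= n * T2 * (2 - 2 * p + e) by move: hQ; rewrite -mulr_natl; lra.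
have h3 : n * (1 - p - e / 2) * ((1 - p - e) * n ^+ 2) <= n * (1 - p - e / 2) * T2.
  by rewrite ler_wpM2l // mulr_ge0 ?(ltW npos) //; lra.
have h4 : (1 - p) ^+ 2 - (1 - p - e / 2) * (1 - p - e) <= 2 * eps.
  have -> : (1 - p) ^+ 2 - (1 - p - e / 2) * (1 - p - e) = 3 / 2 * e * (1 - p) - e ^+ 2 / 2.
    by field.
  have := mulr_ge0 (ltW e0) (ltW p0); have := sqr_ge0 e; lra.
have n30 : 0 <= n ^+ 3 by rewrite exprn_ge0 // ltW.
have h5 := ler_wpM2r n30 h4.
have E3 : n ^+ 3 = n * n ^+ 2 by rewrite exprS.
by nra.
Qed.

End Profile.

Section GoodVertices.
Variable R : realType.
Variables (r s : nat).
Hypotheses (s2 : (2 <= s)%N) (sr : (s <= r)%N).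

Lemma sum_abs_le (I : finType) (c : R) (y : I -> R) : 0 < c ->
  \sum_v y v ^+ 2 <= c ^+ 2 * #|I|%:R -> \sum_v `|y v| <= c * #|I|%:R.
Proof.
move=> c0 hy.
apply: le_trans (_ : \sum_v (c / 2 + y v ^+ 2 / (2 * c)) <= _).
  apply: ler_sum => v _; rewrite -(ler_pM2r (_ : 0 < 2 * c)) ?mulr_gt0 //.
  rewrite [leRHS](_ : _ = c ^+ 2 + y v ^+ 2); last by field; rewrite gt_eqF.
  have := sqr_ge0 (c - `|y v|); rewrite -[y v ^+ 2]real_normK ?num_real //; lra.
rewrite big_split sumr_const -big_distrl /= -[X in X + _]mulr_natr.
rewrite (_ : #|[eta predT]| = #|I|) //.
have : (\sum_v y v ^+ 2) / (2 * c) <= c ^+ 2 * #|I|%:R / (2 * c).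
  by rewrite ler_pM2r // invr_gt0 mulr_gt0.
rewrite [leRHS](_ : _ = c * #|I|%:R / 2); last by field; rewrite gt_eqF.
lra.
Qed.

(** Passing from weighted degrees to degrees costs the total deviation of the
    weights from 1. *)
Lemma degree_ge_link1 (G : sgraph) (x : G -> R) v :
  link_sum 1 x v - \sum_u `|x u - 1| <= (degree v)%:R.
Proof.
rewrite link_sum1E.
rewrite lerBlDr /degree -sum1dep_card natr_sum big_mkcond [X in _ <= X + _]big_mkcond.
rewrite -big_split; apply: ler_sum => u _ /=; case: ifP => _; last by rewrite add0r.
by rewrite -lerBlDl ler_norm.
Qed.

(** Two Chebyshev bounds turn the two averages into statements about all but a
    small fraction of the vertices. *)
Lemma good_vertices (eps : R) : 0 < eps ->
  exists2 del, 0 < del & forall (G : sgraph) (x : G -> R), (0 < #|G|)%N ->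
    (forall v, 0 <= x v) -> \sum_v x v ^+ s = #|G|%:R ->
    (turan_density R r s - del) * #|G|%:R ^+ s <= clique_sum s x ->
    clique_sum r.+1 x <= del * #|G|%:R ^+ r.+1 ->
    exists U : {set G}, #|~: U|%:R <= eps * #|G|%:R /\
      forall v, v \in U -> 2^-1 <= x v /\
        (1 - r%:R^-1 - eps) * #|G|%:R <= (degree v)%:R.
Proof.
move=> eps0; pose c := Num.min eps 1.
have c0 : 0 < c by rewrite lt_min eps0 ltr01.
have c_eps : c <= eps by rewrite ge_min lexx.
have c1 : c <= 1 by rewrite ge_min lexx orbT.
have s0 : 0 < s%:R :> R by rewrite ltr0n; lia.
pose e := c ^+ 3 / (4 * s%:R + 64).
have D0 : 0 < 4 * s%:R + 64 :> R by lra.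
have e0 : 0 < e by rewrite divr_gt0 ?exprn_gt0.
have eD : e * (4 * s%:R + 64) = c ^+ 3 by rewrite /e divfK // gt_eqF.
have se0 : 0 < s%:R * e by rewrite mulr_gt0.
have c2 : c ^+ 2 <= 1 by rewrite exprn_ile1 // ltW.
have c3 : c ^+ 3 = c ^+ 2 * c by rewrite exprSr.
have c2p : 0 < c ^+ 2 by rewrite exprn_gt0.
have [del del0 Hdel] := weighted_profile s2 sr e0.
exists del => // G x n0 x0 xs hs hr.
have [dev var] := Hdel G x n0 x0 xs hs hr.
set n : R := #|G|%:R in dev var *; have npos : 0 < n by rewrite ltr0n.
have abs_dev : \sum_u `|x u - 1| <= c / 2 * n.
  apply: sum_abs_le; first by rewrite divr_gt0.
  apply: le_trans dev _; rewrite ler_wpM2r ?(ltW npos) //.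
  by nra.
set a := 1 - r%:R^-1 in var *.
pose bad v := (x v < 2^-1) || ((degree v)%:R < (a - c) * n).
exists [set v | ~~ bad v]; split; last first.
  move=> v; rewrite inE negb_or -!leNgt => /andP[-> dv]; split=> //.
  by apply: le_trans dv; rewrite ler_pM2r // lerD2l lerN2.
have -> : ~: [set v | ~~ bad v] = [set v | bad v].
  by apply/setP => v; rewrite !inE negbK.
pose K := 8 / (c ^+ 2 * n ^+ 2).
have K0 : 0 < K by rewrite divr_gt0 ?mulr_gt0 ?exprn_gt0.
apply: le_trans (_ : 4 * (\sum_v (x v - 1) ^+ 2) +
    K * (\sum_v x v * (link_sum 1 x v - a * n) ^+ 2) <= _).
  rewrite !big_distrr -big_split -sum1dep_card natr_sum big_mkcond.
  apply: ler_sum => v _ /=.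
  have t1 : 0 <= 4 * (x v - 1) ^+ 2 by rewrite mulr_ge0 ?sqr_ge0.
  have t2 : 0 <= K * (x v * (link_sum 1 x v - a * n) ^+ 2).
    by apply: mulr_ge0; [exact: ltW|apply: mulr_ge0 => //; exact: sqr_ge0].
  case: ifP => [|_]; last exact: addr_ge0.
  rewrite /bad; have [small _|big /= dv] := ltP (x v) 2^-1.
    have : 1 <= 4 * (x v - 1) ^+ 2 by have := x0 v; nra.
    by lra.
  suff : 1 <= K * (x v * (link_sum 1 x v - a * n) ^+ 2) by lra.
  have := degree_ge_link1 x v; set d := link_sum 1 x v => hd.
  have dn : c / 2 * n <= a * n - d by lra.
  have cn0 : 0 <= c / 2 * n by rewrite mulr_ge0 ?divr_ge0 ?ltW.
  have sq : (c / 2 * n) ^+ 2 <= (d - a * n) ^+ 2.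
    by rewrite -[leRHS]sqrrN opprB lerXn2r ?nnegrE // (le_trans cn0).
  have : K * (2^-1 * (c / 2 * n) ^+ 2) <= K * (x v * (d - a * n) ^+ 2).
    by rewrite ler_pM2l // ler_pM ?invr_ge0 ?sqr_ge0 ?ler0n.
  apply: le_trans; rewrite le_eqVlt; apply/orP; left; apply/eqP; rewrite /K; field.
  by rewrite !gt_eqF.
have h1 : 4 * (\sum_v (x v - 1) ^+ 2) <= 4 * (s%:R * e * n) by rewrite ler_pM2l.
have h2 : K * (\sum_v x v * (link_sum 1 x v - a * n) ^+ 2) <= K * (2 * e * n ^+ 3).
  by rewrite ler_pM2l.
have h3 : K * (2 * e * n ^+ 3) = 16 * (e / c ^+ 2) * n.
  by rewrite /K; field; rewrite !gt_eqF.
have ec : e / c ^+ 2 = c / (4 * s%:R + 64) by rewrite /e; field; rewrite !gt_eqF.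
have h4 : 4 * (s%:R * e) + 16 * (e / c ^+ 2) <= eps.
  apply: le_trans c_eps; rewrite -(ler_pM2r D0) ec.
  rewrite [leLHS](_ : _ = 4 * s%:R * c ^+ 3 + 16 * c); last first.
    by rewrite -eD; field; rewrite gt_eqF.
  have : c ^+ 3 <= c by rewrite c3 ler_piMl // ltW.
  by nra.
have := ler_wpM2r (ltW npos) h4; lra.
Qed.

End GoodVertices.

(** * Finding vertex-disjoint copies *)

Section Copies.
Variables (F G : sgraph).

Definition copy_avoiding (Y : {set G}) : Prop :=
  exists f : F -> G, [/\ injective f, forall u v, adj u v -> adj (f u) (f v) &
    forall u, f u \notin Y].

(** The sets in Os are reserved for the copies still to be found, so each copy
    is chosen outside the reserved sets of the later ones. *)
Lemma disjoint_copies (B k : nat) (Y : {set G}) (Os : seq {set G}) :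
  size Os = k -> (#|Y| + k * #|F| + #|\bigcup_(O <- Os) O| <= B)%N ->
  {in Os, forall O : {set G}, [disjoint O & Y]} ->
  pairwise (fun O O' : {set G} => [disjoint O & O']) Os ->
  {in Os, forall O : {set G}, forall Y' : {set G}, (#|Y'| <= B)%N ->
     [disjoint O & Y'] -> copy_avoiding Y'} ->
  exists g : copies k F -> G, [/\ injective g,
    forall p q, adj p q -> adj (g p) (g q) & forall p, g p \notin Y].
Proof.
elim: k Y Os => [|k IH] Y [|O Os] //.
  by move=> _ _ _ _ _; exists (fun p : 'I_0 * F => match p.1 with Ordinal _ h => False_rect G (notF h) end);
    split=> [[[]]|[[]]|[[]]].
move=> [sizeOs] le_B disY; rewrite pairwise_cons => /andP[disO disOs] find.
set Z := \bigcup_(O' <- Os) O'.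
have disOZ : [disjoint O & Z].
  rewrite /Z; elim: (Os) disO => [|O' L IHL] /=; first by rewrite big_nil disjoints_subset setC0 subsetT.
  move=> /andP[OO' OL]; rewrite big_cons disjoint_sym disjoints_subset subUset -!disjoints_subset.
  by rewrite ![[disjoint _ & O]]disjoint_sym OO' IHL.
have [|| f [finj fhom fav]] := find O (mem_head _ _) (Y :|: Z).
- apply: leq_trans (leq_trans _ le_B); first exact: leq_card_setU.
  rewrite big_cons -/Z; have := subset_leq_card (subsetUr O Z); rewrite /=; lia.
- rewrite disjoint_sym disjoints_subset subUset -!disjoints_subset.
  by rewrite ![[disjoint _ & O]]disjoint_sym disOZ disY ?mem_head.
have fY u : f u \notin Y by have := fav u; rewrite inE negb_or => /andP[].
have fZ u : f u \notin Z by have := fav u; rewrite inE negb_or => /andP[].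
have [||||g [ginj ghom gav]] := IH (Y :|: f @: F) Os sizeOs.
- apply: leq_trans le_B; rewrite big_cons -/Z.
  have : (#|Y :|: f @: F| <= #|Y| + #|f @: F|)%N by exact: leq_card_setU.
  have := leq_imset_card f F.
  have := subset_leq_card (subsetUr O Z); rewrite mulSn /=.
  rewrite (_ : #|[eta predT]| = #|F|) //; lia.
- move=> O' O'Os; rewrite disjoint_sym disjoints_subset subUset -!disjoints_subset.
  rewrite ![[disjoint _ & O']]disjoint_sym disY ?inE ?O'Os ?orbT //=.
  rewrite disjoint_sym disjoints_subset; apply/subsetP => _ /imsetP[u _ ->].
  rewrite inE; apply: contra (fZ u) => fuO'.
  rewrite /Z; elim: (Os) O'Os => //= O1 L IHL; rewrite inE big_cons inE.
  by case/predU1P => [<-|/IHL ->]; rewrite ?fuO' ?orbT.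
- exact: disOs.
- by move=> O' O'Os; apply: find; rewrite inE O'Os orbT.
exists (fun p : 'I_k.+1 * F => oapp (fun i => g (i, p.2)) (f p.2) (unlift ord0 p.1)).
have gf i u w : g (i, u) != f w.
  apply: contraNneq (gav (i, u)) => ->; by rewrite inE imset_f ?orbT.
split.
- move=> [i u] [j v] /=; case: unliftP => [i' ->|->]; case: unliftP => [j' ->|->] /=.
  + by move/ginj => [-> ->].
  + by move/eqP; rewrite (negbTE (gf _ _ _)).
  + by move/eqP; rewrite eq_sym (negbTE (gf _ _ _)).
  + by move/finj ->.
- move=> [i u] [j v] /andP[/= /eqP <-]; case: unliftP => [i' _|_] /= uv.
    by apply: ghom; rewrite /= /copies_adj eqxx.
  exact: fhom.
- move=> [i u] /=; case: unliftP => [i' _|_] /=; last exact: fY.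
  by have := gav (i', u); rewrite inE negb_or => /andP[].
Qed.

(** Without such a set, t disjoint copies could be found one after another. *)
Lemma hitting_set t : free_of (copies t F) G ->
  exists W : {set G}, (#|W| <= t * #|F|)%N /\ ~ copy_avoiding W.
Proof.
move=> Ffree; have [//|none] := pselect (exists W : {set G}, (#|W| <= t * #|F|)%N /\ ~ copy_avoiding W).
case: Ffree.
have [||||g [ginj ghom _]] := @disjoint_copies (t * #|F|) t set0 (nseq t set0) (size_nseq _ _).
- by rewrite cards0 add0n (_ : \bigcup_(O <- _) O = set0) ?cards0 ?addn0 // big_nseq; elim: (t) => //= k ->; rewrite setU0.
- by move=> O /nseqP[-> _]; rewrite disjoints_subset sub0set.
- by elim: (t) => //= k ->; rewrite andbT; apply/allP => O /nseqP[-> _]; rewrite disjoints_subset sub0set.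
- move=> O _ Y' hY' _; have [//|nc] := pselect (copy_avoiding Y').
  by case: none; exists Y'.
by exists g.
Qed.

End Copies.

Section KPlusCopies.
Variables (r : nat) (ns : r.-tuple nat) (m : nat).
Hypothesis nsm : forall i, (tnth ns i <= m)%N.
Variable G : sgraph.

(** An edge uv both of whose ends are joined to r - 1 blocks of a complete
    r-partite graph completes, with vertices of the remaining block, the first
    part of a copy. *)
Lemma kplus_copy (Y : {set G}) (S : 'I_r -> {set G}) (i0 : 'I_r) (u v : G) :
  (forall i, (m + 2 <= #|S i|)%N) ->
  (forall i j a b, i != j -> a \in S i -> b \in S j -> adj a b) ->
  adj u v -> (forall i a, i != i0 -> a \in S i -> adj u a /\ adj v a) ->
  u \notin Y -> v \notin Y -> (forall i, [disjoint S i & Y]) ->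
  copy_avoiding (kplus ns) Y.
Proof.
move=> Sm Sadj uv uvS uY vY SY.
have r0 : (0 < r)%N by case: (i0) => i; lia.
pose z := Ordinal r0; pose sg i := tperm z i0 i.
have sg_inj : injective sg by exact: perm_inj.
have sgz : sg z = i0 by rewrite /sg tpermL.
pose S' i := S i :\ u :\ v.
have S'm i : (m <= #|S' i|)%N.
  have := Sm i; rewrite (cardsD1 u) (cardsD1 v (S i :\ u)) -/(S' i).
  by case: (u \in S i); case: (v \in S i :\ u); lia.
pose f (p : kplus ns) : G :=
  if (tag p == z) && (nat_of_ord (tagged p) == 0%N) then u else
  if (tag p == z) && (nat_of_ord (tagged p) == 1%N) then v else
  nth u (enum (S' (sg (tag p)))) (tagged p).
have idx (p : kplus ns) : (tagged p < size (enum (S' (sg (tag p)))))%N.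
  by rewrite -cardE; apply: leq_trans (S'm _); apply: leq_trans (nsm (tag p)).
have inS' (p : kplus ns) : nth u (enum (S' (sg (tag p)))) (tagged p) \in S' (sg (tag p)).
  by rewrite -mem_enum mem_nth.
have fP p : [\/ [/\ tag p = z, nat_of_ord (tagged p) = 0%N & f p = u],
                [/\ tag p = z, nat_of_ord (tagged p) = 1%N & f p = v] |
                f p = nth u (enum (S' (sg (tag p)))) (tagged p) /\
                f p \in S' (sg (tag p))].
  rewrite /f; case: eqP => tz /=; last by constructor 3; split=> //; exact: inS'.
  case: eqP => t0; first by constructor 1.
  case: eqP => t1; first by constructor 2.
  by constructor 3; split=> //; exact: inS'.
have S'S i a : a \in S' i -> [/\ a \in S i, a != u & a != v].
  by rewrite !inE => /and3P[].
have neq_uv : u != v by apply: contraTneq uv => ->; rewrite adj_irr.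
exists f; split.
- move=> p q fpq; have eqS i j : f p \in S' i -> f q \in S' j -> i = j.
    move=> /S'S[pi _ _] /S'S[qj _ _]; apply/eqP; apply: contraT => ij.
    by have := Sadj i j _ _ ij pi qj; rewrite fpq adj_irr.
  have sig_eq : tag p = tag q -> tagged p = tagged q :> nat -> p = q.
    case: p q {fpq eqS} => [i a] [j b] /= ij; case: j / ij b => b ab.
    by congr Tagged; apply: val_inj.
  case: (fP p) => [[pz p0 pu]|[pz p1 pv]|[pE pS]];
    case: (fP q) => [[qz q0 qu]|[qz q1 qv]|[qE qS]].
  + by apply: sig_eq; rewrite ?pz ?p0.
  + by move: neq_uv; rewrite -pu -qv fpq eqxx.
  + by have /S'S[_] := qS; rewrite -fpq pu eqxx.
  + by move: neq_uv; rewrite -pv -qu fpq eqxx.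
  + by apply: sig_eq; rewrite ?pz ?p1.
  + by have /S'S[_ _] := qS; rewrite -fpq pv eqxx.
  + by have /S'S[_] := pS; rewrite fpq qu eqxx.
  + by have /S'S[_ _] := pS; rewrite fpq qv eqxx.
  + have tpq := sg_inj _ _ (eqS _ _ pS qS); apply: sig_eq => //.
    have := idx p; have := idx q; move: pE qE; rewrite -fpq => -> /esym/eqP.
    have -> : S' (sg (tag q)) = S' (sg (tag p)) by rewrite tpq.
    by move=> + iq ip; rewrite nth_uniq ?enum_uniq // => /eqP.
- have hom p q : tag p != tag q -> tag p = z -> (f p = u \/ f p = v) -> adj (f p) (f q).
    move=> pq pz fp; case: (fP q) => [[qz _ _]|[qz _ _]|[_ /S'S[qS _ _]]].
    + by rewrite pz qz eqxx in pq.
    + by rewrite pz qz eqxx in pq.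
    + have qi : sg (tag q) != i0 by rewrite -sgz (inj_eq sg_inj) -pz eq_sym.
      by have [uq vq] := uvS _ _ qi qS; case: fp => ->.
  move=> p q; rewrite /= /kplus_adj => /orP[pq|/and5P[pz qz pq p2 q2]].
    case: (fP p) => [[pz _ pu]|[pz _ pv]|[_ /S'S[pS _ _]]].
    + by apply: hom => //; left.
    + by apply: hom => //; right.
    case: (fP q) => [[qz _ qu]|[qz _ qv]|[_ /S'S[qS _ _]]].
    + by rewrite adj_sym; apply: hom => //; [rewrite eq_sym|left].
    + by rewrite adj_sym; apply: hom => //; [rewrite eq_sym|right].
    by apply: Sadj pS qS; rewrite (inj_eq sg_inj).
  have {}pz : tag p = z by apply: val_inj; apply/eqP.
  have {}qz : tag q = z by apply: val_inj; apply/eqP.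
  rewrite /f (introT eqP pz) (introT eqP qz) /=; move: pq p2 q2.
  case: (nat_of_ord (tagged p)) => [|[|]] //; case: (nat_of_ord (tagged q)) => [|[|]] //= _ _ _.
  by rewrite adj_sym.
- move=> p; case: (fP p) => [[_ _ ->]|[_ _ ->]|[_ /S'S[pS _ _]]] //.
  by rewrite (disjointFr (SY _) pS).
Qed.

End KPlusCopies.

(** * Near-complete r-partite structure *)

Section CliqueCount.
Variable R : realType.
Variable r : nat.
Hypothesis r2 : (2 <= r)%N.

Lemma clique_sum2_indicator (G : sgraph) (U : {set G}) :
  clique_sum 2 (fun v => (v \in U)%:R : R) =
  \sum_(v in U) #|[set u in U | adj v u]|%:R.
Proof.
rewrite clique_sumS [RHS]big_mkcond; apply: eq_bigr => v _.
case: (v \in U); rewrite ?mul0r // mul1r link_sum1E.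
rewrite -sum1dep_card natr_sum big_mkcond [RHS]big_mkcond; apply: eq_bigr => u _.
by case: (u \in U); case: (adj v u).
Qed.

Lemma clique_sum_indicator (G : sgraph) (U : {set G}) k :
  clique_sum k (fun v => (v \in U)%:R : R) =
  #|[set f : {ffun 'I_k -> G} | clique_map f && [forall i, f i \in U]]|%:R.
Proof.
rewrite -sum1dep_card natr_sum /clique_sum big_mkcondr; apply: eq_bigr => f _.
case: ifP => [/forallP fU|/negbT]; first by rewrite big1 // => i _; rewrite fU.
by rewrite negb_forall => /existsP[i fi]; rewrite (bigD1 i) //= (negbTE fi) mul0r.
Qed.

(** Weight the vertices by the indicator of U.  The degree condition makes the
    ratio of edge to vertex density at least about 1 - 1/r, and by densities_lower
    the ratios up to that of the r-cliques stay above 1/(2r). *)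
Lemma many_cliques (e : R) (G : sgraph) (U : {set G}) : (0 < #|G|)%N -> 0 < e ->
  6 * r%:R ^+ 2 * e <= 1 ->
  #|~: U|%:R <= 2 * e * #|G|%:R ->
  (forall v, v \in U -> (1 - r%:R^-1 - e) * #|G|%:R <= (degree v)%:R) ->
  ((2 * r%:R)^-1) ^+ r * #|G|%:R ^+ r <=
  #|[set f : {ffun 'I_r -> G} | clique_map f && [forall i, f i \in U]]|%:R :> R.
Proof.
move=> n0 e0 re cU degU; rewrite -clique_sum_indicator.
set n : R := #|G|%:R in cU degU *; have npos : 0 < n by rewrite ltr0n.
set x := fun v => _ : R.
have x0 v : 0 <= x v by exact: ler0n.
have sumx : \sum_v x v = #|U|%:R 
  by rewrite -sum1_card natr_sum [RHS]big_mkcond; apply: eq_bigr => v _; rewrite /x; case: ifP.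
have UC : #|U|%:R + #|~: U|%:R = n by rewrite -natrD cardsC.
have xn : \sum_v x v <= n by rewrite sumx ler_nat max_card.
have kapP := clique_sum_densities n0 x0 xn.
set kap := fun j => _ in kapP; have [kap_ge0 kap0 kap_noninc kap_mm] := kapP.
have r0 : 2 <= r%:R :> R by rewrite ler_nat.
have [p [p0 pr ep]] : exists p : R, [/\ 0 < p, p * r%:R = 1 & 6 * e <= p ^+ 2].
  exists r%:R^-1; split; rewrite ?invr_gt0 ?mulVf ?gt_eqF //; try lra.
  by rewrite exprVn -(ler_pM2r (_ : 0 < r%:R ^+ 2)) ?exprn_gt0 ?mulVf ?gt_eqF ?exprn_gt0; lra.
have rV : r%:R^-1 = p.
  have rn : r%:R != 0 :> R by rewrite gt_eqF //; lra.
  by apply: (mulIf rn); rewrite pr mulVf.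
rewrite rV in degU.
have p2 : p <= 2^-1 by nra.
have kap1 : kap 1%N = #|U|%:R / n by rewrite /kap clique_sum1 sumx expr1.
have k1 : 1 - 2 * e <= kap 1%N by rewrite kap1 ler_pdivlMr //; lra.
have k2 : (1 - (p + 3 * e)) * kap 1%N <= kap 2%N.
  rewrite kap1 /kap ler_pdivlMr ?exprn_gt0 // clique_sum2_indicator.
  rewrite [leLHS](_ : _ = #|U|%:R * ((1 - (p + 3 * e)) * n)); last by field; rewrite gt_eqF.
  rewrite mulr_natl -sumr_const; apply: ler_sum => v vU.
  have := degU v vU; have : (degree v <= #|[set u in U | adj v u]| + #|~: U|)%N.
    rewrite /degree -(cardsID U); apply: leq_add.
      by apply/subset_leq_card/subsetP => u; rewrite !inE andbC.
    by apply/subset_leq_card/subsetP => u; rewrite !inE => /andP[].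
  by rewrite -(ler_nat R) natrD; lra.
have k20 : 0 < kap 2%N by apply: lt_le_trans k2; rewrite mulr_gt0 //; nra.
have eta0 : 0 <= p + 3 * e by lra.
have low := densities_lower kapP k20 k2 eta0.
have rV2 : (2 * r%:R)^-1 = p / 2 by rewrite invfM rV mulrC.
suff H j : (j < r)%N -> (p / 2) ^+ j.+1 <= kap j.+1.
  have := H r.-1; rewrite prednK ?(ltnW r2) // => /(_ (leqnn _)).
  by rewrite rV2 /kap ler_pdivlMr // exprn_gt0.
elim: j => [_|j IH jr]; first by rewrite expr1; apply: le_trans k1; nra.
have jr' : j.+2%:R <= r%:R :> R by rewrite ler_nat.
have jE : j.+2%:R = j%:R + 2 :> R by rewrite -addn2 natrD.
have jE1 : j.+1%:R = j%:R + 1 :> R by rewrite -natr1.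
have j0 : 0 <= j%:R :> R by [].
have bound : p / 2 <= 1 - j.+1%:R * (p + 3 * e).
  rewrite jE1; rewrite jE in jr'; move: (j%:R : R) j0 jr' => q q0 qr.
  have : (q + 1) * p <= 1 - p by nra.
  have : (q + 1) * (3 * e) <= p / 2 by nra.
  by lra.
apply: le_trans (low j _); last by nra.
rewrite exprS ler_pM ?exprn_ge0 ?divr_ge0 ?(ltW p0) //.
exact: IH (ltnW jr).
Qed.

End CliqueCount.

Lemma exists_subset (T : finType) (A : {set T}) k : (k <= #|A|)%N ->
  exists2 B : {set T}, B \subset A & #|B| = k.
Proof.
move=> kA; exists [set x in take k (enum A)].
  by apply/subsetP => x; rewrite inE => /mem_take; rewrite mem_enum.
rewrite cardsE (card_uniqP _) ?take_uniq ?enum_uniq // size_take -cardE.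
by case: ltngtP kA.
Qed.

Lemma exists_other r (i : 'I_r) : (2 <= r)%N -> exists j, i != j.
Proof.
move=> r2; have [->|] := eqVneq i (Ordinal (ltnW r2)); last by exists (Ordinal (ltnW r2)).
by exists (Ordinal r2).
Qed.

(** Representatives of the other blocks extend any two vertices of distinct
    blocks to a tuple of the family. *)
Lemma box_of_cliques (R : realType) k m (eps : R) : (2 <= k)%N -> (0 < m)%N -> 0 < eps ->
  exists N : nat, forall (G : sgraph) (U : {set G}), (N <= #|G|)%N ->
    eps * #|G|%:R ^+ k <=
      #|[set f : {ffun 'I_k -> G} | clique_map f && [forall i, f i \in U]]|%:R ->
    exists S : 'I_k -> {set G}, [/\ forall i, #|S i| = m, forall i, S i \subset U &
      forall i j a d, i != j -> a \in S i -> d \in S j -> adj a d].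
Proof.
move=> k2 m0 eps0; have [N box] := dense_box k m eps0.
exists N => G U nN /(box _ _ nN)[S0 [S0m S0H]].
pose S i := sval (cid2 (exists_subset (S0m i))).
have SS0 i : S i \subset S0 i by rewrite /S; case: cid2.
have S_size i : #|S i| = m by rewrite /S; case: cid2.
have Sne i : exists a, a \in S i by apply/card_gt0P; rewrite S_size.
pose s0 i := sval (cid (Sne i)).
have s0P i : s0 i \in S i by rewrite /s0; case: cid.
have pair i j a d : i != j -> a \in S i -> d \in S j -> adj a d /\ a \in U.
  move=> ij aS dS; pose f := [ffun l => if l == i then a else if l == j then d else s0 l].
  have fS l : f l \in S0 l.
    rewrite ffunE; apply: (subsetP (SS0 l)).
    by case: eqP => [->//|_]; case: eqP => [->//|_].
  have := S0H f fS; rewrite inE => /andP[/clique_mapP/(_ i j ij) + /forallP/(_ i)].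
  by rewrite !ffunE !eqxx eq_sym (negbTE ij).
exists S; split=> // [i|i j a d ij aS dS]; last by have [] := pair i j a d.
apply/subsetP => a aS; have [j ij] := exists_other i k2.
by have [] := pair i j a (s0 j) ij aS (s0P j).
Qed.

Lemma card_bigcup_le (T I : finType) (P : pred I) (F : I -> {set T}) :
  (#|\bigcup_(i | P i) F i| <= \sum_(i | P i) #|F i|)%N.
Proof.
elim/big_ind2: _ => [|X x Y y Xx Yy|//]; first by rewrite cards0.
by apply: leq_trans (leq_card_setU _ _) (leq_add Xx Yy).
Qed.

Lemma double_count (T : finType) (A B : {set T}) (P : rel T) :
  (\sum_(v in A) #|[set u in B | P v u]| = \sum_(u in B) #|[set v in A | P v u]|)%N.
Proof.
transitivity (\sum_(v in A) \sum_(u in B) (P v u : nat))%N.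
  apply: eq_bigr => v _; rewrite -sum1dep_card big_mkcondr.
  by apply: eq_bigr => u _; case: (P v u).
rewrite exchange_big; apply: eq_bigr => u _; rewrite -sum1dep_card [RHS]big_mkcondr.
by apply: eq_bigr => v _; case: (P v u).
Qed.

Section Structure.
Variable R : realType.
Variables (r : nat) (ns : r.-tuple nat) (m : nat).
Hypotheses (r2 : (2 <= r)%N) (nsm : forall i, (tnth ns i <= m)%N).

Section Blocks.
Variables (G : sgraph) (W : {set G}) (S : 'I_r -> {set G}).
Hypothesis noW : ~ copy_avoiding (kplus ns) W.
Let b := (m + 2)%N.
Let M := (b + b)%N.
Hypotheses (S_size : forall i, #|S i| = M) (S_W : forall i, [disjoint S i & W]).
Hypothesis S_adj : forall i j a c, i != j -> a \in S i -> c \in S j -> adj a c.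

Definition full (i : 'I_r) (v : G) : bool :=
  [forall (j | j != i), S j \subset [set u | adj v u]] && [disjoint S i & [set u | adj v u]].

Definition misses (v : G) : nat := (\sum_i #|[set u in S i | ~~ adj v u]|)%N.

Lemma full_adj i v j a : full i v -> j != i -> a \in S j -> adj v a.
Proof.
by move=> /andP[/forall_inP H _] ji aS; have /subsetP/(_ a aS) := H j ji; rewrite inE.
Qed.

Lemma full_nadj i v a : full i v -> a \in S i -> ~~ adj v a.
Proof. by move=> /andP[_ d] aS; have := disjointFr d aS; rewrite inE => ->. Qed.

Lemma block_split i v : (#|[set u in S i | adj v u]| + #|[set u in S i | ~~ adj v u]| = M)%N.
Proof.
rewrite -(S_size i) -(cardsID [set u | adj v u] (S i)); congr (_ + _)%N.
  by apply: eq_card => u; rewrite !inE.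
by apply: eq_card => u; rewrite !inE andbC.
Qed.

(** A vertex joined to many vertices of all blocks but one cannot have a
    neighbour in the remaining block. *)
Lemma full_or_misses v : v \notin W -> (exists i, full i v) \/ (M < misses v)%N.
Proof.
move=> vW; pose few i := (#|[set u in S i | adj v u]| < b)%N.
have r0 : (0 < r)%N := ltnW r2.
have miss_ge (P : pred 'I_r) : (\sum_(i | P i) #|[set u in S i | ~~ adj v u]| <= misses v)%N.
  by rewrite /misses [leqRHS](bigID P) /= leq_addr.
have [[i [j [ij fi fj]]]|two] := pselect (exists i j, [/\ i != j, few i & few j]).
  right; have := miss_ge (pred2 i j); rewrite (bigD1 i) ?inE ?eqxx //= (bigD1 j) /=; last first.
    by rewrite eqxx orbT eq_sym.
  have := block_split i v; have := block_split j v; move: fi fj; rewrite /few /M; lia.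
have [i many] : exists i, forall j, j != i -> ~~ few j.
  have [i fi|none] := pickP few.
    exists i => j ji; apply/negP => fj; apply: two; exists i, j.
    by rewrite eq_sym.
  by exists (Ordinal r0) => j _; rewrite none.
have no_nbr u : u \in S i -> ~~ adj v u.
  move=> uS; apply/negP => vu; apply: noW.
  pose T j := if j == i then S i else [set a in S j | adj v a].
  have TS j : T j \subset S j.
    by rewrite /T; case: eqP => [->//|_]; apply/subsetP => a; rewrite inE => /andP[].
  apply: (@kplus_copy _ _ _ nsm _ _ T i u v) => //.
  - move=> j; rewrite /T; case: eqP => [_|/eqP/many]; first by rewrite S_size /M /b; lia.
    by rewrite /few -leqNgt.
  - move=> j k a c jk /(subsetP (TS _)) aS /(subsetP (TS _)) cS; exact: S_adj jk aS cS.
  - by rewrite adj_sym.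
  - move=> j a ji aT; split; first by apply: S_adj uS (subsetP (TS _) _ aT); rewrite eq_sym.
    by move: aT; rewrite /T (negbTE ji) inE => /andP[].
  - by rewrite (disjointFr (S_W i) uS).
  - by move=> j; apply: disjointWl (TS j) (S_W j).
have missi : #|[set u in S i | ~~ adj v u]| = M.
  rewrite -(S_size i); apply: eq_card => u; rewrite !inE.
  by case uS: (u \in S i) => //=; rewrite no_nbr.
have [allj|/forall_inPn[j ji nj]] := boolP [forall (j | j != i), S j \subset [set u | adj v u]].
  left; exists i; rewrite /full allj disjoint_sym disjoints_subset.
  by apply/subsetP => u; rewrite !inE => vu; apply: contraL vu; exact: no_nbr.
have {}ji : j != i := ji.
right; have := miss_ge (pred2 i j); rewrite (bigD1 i) ?inE ?eqxx //= (bigD1 j) /=; last first.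
  by rewrite eqxx orbT ji.
have /subsetPn[u uS] := nj; rewrite inE => nvu.
have : (0 < #|[set u in S j | ~~ adj v u]|)%N by apply/card_gt0P; exists u; rewrite inE uS.
by rewrite missi; lia.
Qed.

End Blocks.

Lemma non_degree (G : sgraph) (v : G) : (degree v + #|[set u | ~~ adj v u]| = #|G|)%N.
Proof.
rewrite -cardsT -(cardsID [set u | adj v u] [set: G]); congr (_ + _)%N.
  by apply: eq_card => u; rewrite !inE.
by apply: eq_card => u; rewrite !inE andbT.
Qed.

Section MissCount.
Variables (G : sgraph) (W U : {set G}) (S : 'I_r -> {set G}) (e : R).
Hypothesis noW : ~ copy_avoiding (kplus ns) W.
Let b := (m + 2)%N.
Let M := (b + b)%N.
Hypotheses (S_size : forall i, #|S i| = M) (S_U : forall i, S i \subset U :\: W).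
Hypothesis S_adj : forall i j a c, i != j -> a \in S i -> c \in S j -> adj a c.
Hypothesis degU : forall v, v \in U -> (1 - r%:R^-1 - e) * #|G|%:R <= (degree v)%:R.

Let n : R := #|G|%:R.
Let p : R := r%:R^-1.

(** On average a vertex misses about as many block vertices as a vertex that is
    joined to all blocks but one, which is the minimum possible. *)
Lemma few_not_full :
  #|[set v in ~: W | [forall i, ~~ full S i v]]|%:R <= M%:R * (r%:R * e * n + #|W|%:R).
Proof.
have S_W i : [disjoint S i & W].
  by have /subsetDP[_] := S_U i.
set E := [set v in ~: W | _].
have lower : (M * #|~: W| + #|E| <= \sum_v misses S v)%N.
  apply: leq_trans (_ : \sum_(v in ~: W) (M + (v \in E)) <= _)%N.
    rewrite big_split /= sum_nat_const mulnC leq_add2l -sum1_card big_mkcond.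
    rewrite [leqRHS]big_mkcond; apply: leq_sum => v _.
    by case vE : (v \in E) => //; move: vE; rewrite inE => /andP[->].
  rewrite [leqRHS](bigID (mem (~: W))) /= -[leqLHS]addn0 leq_add //.
  apply: leq_sum => v vW; have vW' : v \notin W by move: vW; rewrite inE.
  have [[i fi]|ms] := full_or_misses noW S_size S_W S_adj vW'; last first.
    by case: (v \in E); rewrite ?addn1 ?addn0 // ltnW.
  have -> : (v \in E) = false.
    by rewrite inE vW; apply/negbTE; rewrite negb_forall; apply/existsP; exists i; rewrite negbK.
  rewrite addn0 /misses (bigD1 i) //= (_ : #|_| = M) ?leq_addr //.
  rewrite -(S_size i); apply: eq_card => u; rewrite !inE.
  by case uS : (u \in S i) => //=; rewrite (full_nadj fi uS).
have upper : (\sum_v misses S v)%:R <= r%:R * M%:R * (p + e) * n.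
  rewrite /misses exchange_big natr_sum.
  apply: le_trans (_ : \sum_(i < r) M%:R * ((p + e) * n) <= _); last first.
    by rewrite sumr_const card_ord -mulr_natl; lra.
  apply: ler_sum => i _.
  have -> : (\sum_v #|[set u in S i | ~~ adj v u]| =
      \sum_(v in [set: G]) #|[set u in S i | ~~ adj v u]|)%N.
    by apply: eq_bigl => v; rewrite inE.
  rewrite double_count natr_sum.
  apply: le_trans (_ : \sum_(u in S i) (p + e) * n <= _); last first.
    by rewrite sumr_const S_size mulr_natl.
  apply: ler_sum => u uS.
  have uU : u \in U by have /subsetP/(_ u uS) := S_U i; rewrite inE => /andP[].
  have := degU uU; have := non_degree u.
  rewrite (_ : [set v in [set: G] | ~~ adj v u] = [set v | ~~ adj u v]); last first.
    by apply/setP => v; rewrite !inE adj_sym.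
  move/(congr1 (fun k => k%:R : R)); rewrite natrD -/n -/p; lra.
have rp : r%:R * p = 1 by rewrite mulfV // pnatr_eq0; lia.
have := lower; rewrite -(ler_nat R) natrD natrM => low.
have : #|~: W|%:R = n - #|W|%:R by rewrite /n -(cardsC W) natrD; lra.
have : r%:R * M%:R * (p + e) * n = M%:R * n + M%:R * (r%:R * e * n).
  rewrite [LHS](_ : _ = M%:R * n * (r%:R * p) + M%:R * (r%:R * e * n)); last by ring.
  by rewrite rp mulr1.
move=> E1 E2; rewrite E2 in low; rewrite E1 in upper; lra.
Qed.

End MissCount.

Definition near_complete (G : sgraph) (eta : R) (A : 'I_r -> {set G}) : Prop :=
  [/\ forall i u v, u \in A i -> v \in A i -> ~~ adj u v,
      forall i j v, v \in A i -> v \in A j -> i = j,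
      #|~: \bigcup_i A i|%:R <= eta * #|G|%:R,
      forall i j v, i != j -> v \in A i ->
        #|[set u in A j | ~~ adj v u]|%:R <= eta * #|G|%:R &
      forall i, #|G|%:R / (2 * r%:R) <= #|A i|%:R :> R].

(** Large degrees force many r-cliques, hence a complete r-partite graph with
    large constant parts; the classes consist of the vertices joined to all of
    these parts but one. *)
Lemma near_complete_partition (w0 : nat) (eta : R) : 0 < eta ->
  exists e : R, 0 < e /\ exists N : nat, forall (G : sgraph) (W U : {set G}),
    (N <= #|G|)%N -> (#|W| <= w0)%N -> ~ copy_avoiding (kplus ns) W ->
    #|~: U|%:R <= e * #|G|%:R ->
    (forall v, v \in U -> (1 - r%:R^-1 - e) * #|G|%:R <= (degree v)%:R) ->
    exists2 A : 'I_r -> {set G}, near_complete eta A & forall i, A i \subset U :\: W.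
Proof.
move=> eta0; pose M := (m + 2 + (m + 2))%N.
have r0 : 2 <= r%:R :> R by rewrite ler_nat.
pose K := 2 + M%:R * r%:R + M%:R + r%:R : R.
have M0 : 0 <= M%:R :> R by [].
have K0 : 2 + r%:R <= K by rewrite /K; nra.
pose c := Num.min eta 1.
have c0 : 0 < c by rewrite lt_min eta0 ltr01.
have c_eta : c <= eta by rewrite ge_min lexx.
have c1 : c <= 1 by rewrite ge_min lexx orbT.
pose e := c / (8 * r%:R ^+ 2 * K).
have D0 : 0 < 8 * r%:R ^+ 2 * K by rewrite !mulr_gt0 ?exprn_gt0 //; lra.
have e0 : 0 < e by rewrite divr_gt0.
have eE : 8 * (e * K) * r%:R ^+ 2 = c by rewrite /e; field; rewrite !gt_eqF //; lra.
have eK0 : 0 < e * K by rewrite mulr_gt0 //; lra.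
have r22 : 2 * r%:R <= r%:R ^+ 2 :> R by rewrite expr2 ler_wpM2r //; lra.
have eKr : 8 * (e * K) * r%:R <= 2^-1 by nra.
have eKeta : e * K <= eta by nra.
have e_small : 6 * r%:R ^+ 2 * e <= 1 by nra.
have q0 : 0 < ((2 * r%:R)^-1) ^+ r :> R by rewrite exprn_gt0 // invr_gt0; lra.
have M1 : (0 < M)%N by rewrite /M addn2.
have [N1 box] := box_of_cliques r2 M1 q0.
have [N2 arch] := archimedean_le w0%:R e0.
exists e; split=> //; exists (maxn 1 (maxn N1 N2)) => G W U.
rewrite !geq_max => /and3P[n0 nN1 nw] Ww noW cU degU.
set n : R := #|G|%:R in cU degU *; have npos : 0 < n by rewrite ltr0n.
have Wn : #|W|%:R <= e * n by apply: le_trans (arch _ nw); rewrite ler_nat.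
have cUW : #|~: (U :\: W)|%:R <= 2 * e * n.
  apply: le_trans (_ : (#|~: U| + #|W|)%:R <= _); last by rewrite natrD; lra.
  by rewrite ler_nat setCD; exact: leq_card_setU.
have degUW v : v \in U :\: W -> (1 - r%:R^-1 - e) * n <= (degree v)%:R.
  by rewrite inE => /andP[_ /degU].
have := many_cliques r2 n0 e0 e_small cUW degUW.
move=> /(box _ _ nN1)[S [S_size S_U S_adj]].
have Sne i : exists a, a \in S i by apply/card_gt0P; rewrite S_size.
pose s0 i := sval (cid (Sne i)).
have s0P i : s0 i \in S i by rewrite /s0; case: cid.
have S_W i : [disjoint S i & W] by have /subsetDP[_] := S_U i.
have E_small := few_not_full noW S_size S_U S_adj degU.
pose A i := [set v in U :\: W | full S i v].
have AU i : A i \subset U :\: W by apply/subsetP => v; rewrite inE => /andP[].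
have Aful i v : v \in A i -> full S i v by rewrite inE => /andP[].
have A_compl : #|~: \bigcup_i A i|%:R <= (2 + M%:R * r%:R + M%:R) * e * n.
  apply: le_trans (_ : (#|~: (U :\: W)| + #|[set v in ~: W | [forall i, ~~ full S i v]]|)%:R <= _).
    rewrite ler_nat; apply: leq_trans (leq_card_setU _ _); apply/subset_leq_card.
    apply/subsetP => v; rewrite in_setC => vA; rewrite in_setU in_setC.
    have [vU /=|//] := boolP (v \in U :\: W); rewrite !inE; move: (vU); rewrite inE => /andP[-> _] /=.
    apply/forallP => i; apply: contra vA => fi; apply/bigcupP; exists i => //.
    by rewrite inE vU.
  rewrite natrD; apply: le_trans (lerD cUW E_small) _; rewrite -/n -/M.
  have : M%:R * #|W|%:R <= M%:R * (e * n) by rewrite ler_wpM2l.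
  by lra.
have nonnbr v : v \in U -> #|[set u | ~~ adj v u]|%:R <= (r%:R^-1 + e) * n.
  by move=> vU; have := degU v vU; have := congr1 (fun k => k%:R : R) (non_degree v);
     rewrite natrD -/n; lra.
have indep i u v : u \in A i -> v \in A i -> ~~ adj u v.
  move=> uA vA; apply/negP => uv; apply: noW.
  have uW : u \notin W by have := subsetP (AU i) _ uA; rewrite inE => /andP[].
  have vW : v \notin W by have := subsetP (AU i) _ vA; rewrite inE => /andP[].
  apply: (@kplus_copy _ _ _ nsm _ _ S i u v) => //.
    by move=> j; rewrite S_size /M leq_addr.
  by move=> j a ji aS; split; apply: full_adj ji aS; apply: Aful.
have A_upper i : #|A i|%:R <= (r%:R^-1 + e) * n.
  have sU : s0 i \in U by have := subsetP (S_U i) _ (s0P i); rewrite inE => /andP[].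
  apply: le_trans (nonnbr _ sU); rewrite ler_nat; apply/subset_leq_card/subsetP => v vA.
  by rewrite inE adj_sym; apply: full_nadj (Aful i v vA) (s0P i).
have A_lower i : (r%:R^-1 - e * K + e) * n <= #|A i|%:R.
  have card_cup := card_bigcup_le xpredT A.
  have sum_other : \sum_(j | j != i) #|A j|%:R <= (r%:R - 1) * ((r%:R^-1 + e) * n) :> R.
    apply: le_trans (ler_sum _ (fun j _ => A_upper j)) _.
    by rewrite sumr_const cardC1 card_ord -[leLHS]mulr_natl -subn1 natrB // ltnW.
  have := card_cup; rewrite -(ler_nat R) natr_sum [X in _ <= X](bigD1 i) //= => cup.
  have := cardsC (\bigcup_j A j); move/(congr1 (fun k => k%:R : R)); rewrite natrD -/n => tot.
  have -> : (r%:R^-1 - e * K + e) * n = n - (r%:R - 1) * ((r%:R^-1 + e) * n)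
      - (2 + M%:R * r%:R + M%:R) * e * n :> R.
    by rewrite /K; field; lra.
  by lra.
have A_disj i j v : v \in A i -> v \in A j -> i = j.
  move=> vi vj; apply/eqP; apply: contraT => ij.
  have := full_adj (Aful i v vi) _ (s0P j); rewrite eq_sym => /(_ ij).
  by rewrite (negbTE (full_nadj (Aful j v vj) (s0P j))).
exists A => //; split=> //.
- apply: le_trans A_compl _; rewrite ler_pM2r //; apply: le_trans eKeta; rewrite /K.
  by nra.
- move=> i j v ij vA.
  have vU : v \in U by have := subsetP (AU i) _ vA; rewrite inE => /andP[].
  have := nonnbr v vU; have := A_lower i.
  have : (#|[set u in A j | ~~ adj v u]| + #|A i| <= #|[set u | ~~ adj v u]|)%N.
    rewrite -cardsUI (_ : _ :&: _ = set0) ?cards0 ?addn0.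
      apply/subset_leq_card/subsetP => u /setUP[/setIdP[_ nvu]|uA]; rewrite inE //.
      exact: indep vA uA.
    apply/setP => u; rewrite in_set0; apply/negbTE/negP => /setIP[/setIdP[uj _] ui].
    by move: ij; rewrite (A_disj i j u ui uj) eqxx.
  rewrite -(ler_nat R) natrD.
  have := ler_wpM2r (ltW npos) eKeta; lra.
- move=> i; apply: le_trans (A_lower i).
  rewrite mulrC ler_pM2r // invfM.
  have p0 : 0 < r%:R^-1 :> R by rewrite invr_gt0; lra.
  have : 8 * (e * K) * r%:R * r%:R^-1 <= 2^-1 * r%:R^-1 by rewrite ler_pM2r.
  by rewrite mulfK ?gt_eqF //; lra.
Qed.

End Structure.

(** * Complete multipartite graphs joined to a clique *)

Section ColourGraph.
Variables (r : nat) (V : finType) (c : V -> option 'I_r).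

(** The complete r-partite graph on the coloured vertices, joined to the complete
    graph on the vertices without a colour. *)
Definition col_adj : rel V :=
  fun u v => (u != v) && ((c u == None) || (c u != c v)).

Lemma col_sym : symmetric col_adj.
Proof.
move=> u v; rewrite /col_adj eq_sym; congr (_ && _).
by case: (c u) => [i|]; case: (c v) => [j|]; rewrite //= eq_sym.
Qed.

Lemma col_irr : irreflexive col_adj.
Proof. by move=> u; rewrite /col_adj eqxx. Qed.

Definition colour_graph : sgraph := SGraph col_sym col_irr.

Definition class_size (i : 'I_r) : nat := #|[set v | c v == Some i]|.

Lemma clique_map_colours k (f : {ffun 'I_k -> colour_graph}) (h : 'I_k -> 'I_r) :
  injective h -> (forall l, c (f l) = Some (h l)) -> clique_map f.
Proof.
move=> hinj fh; apply/clique_mapP => l l' ll'; rewrite /= /col_adj !fh.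
rewrite (inj_eq Some_inj) (inj_eq hinj) ll' andbT; apply: contra_neq ll' => e.
by apply/hinj/Some_inj; rewrite -!fh e.
Qed.

Lemma class_representatives : (forall l, 0 < class_size l)%N ->
  exists v0 : 'I_r -> V, forall l, c (v0 l) = Some l.
Proof.
move=> ne; have rep l : exists v, c v = Some l.
  by have /card_gt0P[v] := ne l; rewrite inE => /eqP; exists v.
by exists (fun l => sval (cid (rep l))) => l; case: cid.
Qed.

Definition balanced : Prop := forall i j, (class_size i <= (class_size j).+1)%N.

Lemma card_classes : (#|[set v | c v == None]| + \sum_i class_size i = #|V|)%N.
Proof.
rewrite -[RHS]sum1_card (partition_big c xpredT) //= (bigD1 None) //= -sum1dep_card; congr (_ + _)%N.
rewrite (reindex_omap Some id) /=; last by case.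
apply: eq_big => [i|i _]; first by rewrite eqxx.
by rewrite /class_size -sum1dep_card.
Qed.

Lemma balanced_lower j : balanced ->
  (\sum_i class_size i <= r * class_size j + r)%N.
Proof.
move=> bal; apply: leq_trans (_ : \sum_(i < r) (class_size j).+1 <= _)%N.
  by apply: leq_sum => i _; apply: bal.
by rewrite sum_nat_const card_ord mulnS addnC.
Qed.

(** Larger classes come first, so that for a balanced colouring the numbers
    k r + rank of class, for k below the size of the class, fill an initial
    interval (place_lt). *)
Definition class_rank (i : 'I_r) : nat :=
  #|[set j | (class_size i < class_size j)%N || ((class_size i == class_size j) && (j < i)%N)]|.

Lemma class_rank_lt i : (class_rank i < r)%N.
Proof.
rewrite -[X in (_ < X)%N]card_ord -cardsT; apply: proper_card.
by apply/properP; split; [exact: subsetT|exists i; rewrite ?inE // ltnn eqxx ltnn].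
Qed.

Lemma class_rank_inj : injective class_rank.
Proof.
have lt_rank i j : (class_size i < class_size j)%N ||
    ((class_size i == class_size j) && (j < i)%N) -> (class_rank j < class_rank i)%N.
  move=> ij; apply: proper_card; apply/properP; split.
    by apply/subsetP => k; rewrite !inE; lia.
  by exists j; rewrite inE // ltnn eqxx ltnn.
move=> i j rij.
have [h|h|h] := ltngtP (class_size i) (class_size j).
- by have := lt_rank i j; rewrite h rij ltnn => /(_ isT).
- by have := lt_rank j i; rewrite h rij ltnn => /(_ isT).
have [h'|h'|/val_inj //] := ltngtP i j.
- by have := lt_rank j i; rewrite h eqxx h' orbT rij ltnn => /(_ isT).
- by have := lt_rank i j; rewrite h eqxx h' orbT rij ltnn => /(_ isT).
Qed.

Lemma place_lt i k : balanced -> (k < class_size i)%N ->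
  (k * r + class_rank i < \sum_j class_size j)%N.
Proof.
move=> bal ki; have rk := class_rank_lt i.
have [small|big] := boolP [forall j, k < class_size j]%N.
  apply: leq_trans (_ : k.+1 * r <= _)%N; first by rewrite mulSn; lia.
  rewrite mulnC -[X in (X * _)%N]card_ord -sum_nat_const; apply: leq_sum => j _.
  by move/forallP: small; apply.
have [j] : exists j, ~~ (k < class_size j)%N by move: big; rewrite negb_forall => /existsP.
rewrite -leqNgt => jk.
have kge l : (k <= class_size l)%N by have := bal i l; lia.
have kle l : (class_size l <= k.+1)%N by have := bal l j; lia.
have -> : (\sum_l class_size l = \sum_l (k + (k < class_size l)))%N.
  by apply: eq_bigr => l _; have := kge l; have := kle l; lia.
rewrite big_split /= sum_nat_const card_ord [(k * r)%N]mulnC ltn_add2l.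
rewrite /class_rank -sum1dep_card [X in (X < _)%N]big_mkcond [X in (_ < X)%N](bigD1 i) //= ki.
rewrite [X in (X < _)%N](bigD1 i) //= ltnn eqxx ltnn /= add0n add1n ltnS.
apply: leq_sum => l li; have := kle l; case: ifP => // + _; lia.
Qed.

End ColourGraph.

(** The k-th vertex of the class of rank i is sent to k r + i, whose residue modulo
    r recovers the class. *)
Lemma balanced_isomorphic (r t n : nat) (G : sgraph) (c : G -> option 'I_r) :
  (0 < r)%N -> (t <= n)%N -> #|G| = n ->
  (forall u v, adj u v = col_adj c u v) -> #|[set v | c v == None]| = (t - 1)%N ->
  (0 < t)%N ->
  balanced c ->
  isomorphic G (graph_join (complete_graph (t - 1)) (turan_graph r (n - t + 1))).
Proof.
move=> r0 tn cardG adjE card0 t0 bal.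
have total : (\sum_i class_size c i = n - t + 1)%N.
  by have := card_classes c; rewrite card0 cardG; lia.
pose idx (v : G) : nat := index v (enum [set u | c u == c v]).
have idx_lt v : (idx v < #|[set u | c u == c v]|)%N.
  by rewrite cardE index_mem mem_enum inE.
have idx_inj u v : c u = c v -> idx u = idx v -> u = v.
  move=> cuv; rewrite /idx cuv => e.
  have := @nth_index _ u u (enum [set w | c w == c v]); rewrite e.
  rewrite mem_enum inE cuv eqxx => /(_ isT) <-.
  by rewrite nth_index // mem_enum inE.
have none_lt v : c v = None -> (idx v < t - 1)%N.
  by move=> cv; have := idx_lt v; rewrite cv card0.
have some_lt v i : c v = Some i -> (idx v * r + class_rank c i < n - t + 1)%N.
  by move=> cv; rewrite -total; apply: place_lt => //; have := idx_lt v; rewrite cv.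
pose f (v : G) : 'I_(t - 1) + 'I_(n - t + 1) :=
  match c v as o return c v = o -> _ with
  | None => fun cv => inl (Ordinal (none_lt v cv))
  | Some i => fun cv => inr (Ordinal (some_lt v i cv))
  end (erefl _).
have fP v : match c v with
    | None => exists2 a : 'I_(t - 1), f v = inl a & val a = idx v
    | Some i => exists2 b : 'I_(n - t + 1), f v = inr b & val b = (idx v * r + class_rank c i)%N
    end.
  rewrite /f; move: (none_lt v) (some_lt v); case: (c v) => [i|] h1 h2.
    by exists (Ordinal (h2 i erefl)).
  by exists (Ordinal (h1 erefl)).
have mod_rank k i : ((k * r + class_rank c i) %% r = class_rank c i)%N.
  by rewrite modnMDl modn_small // class_rank_lt.
have finj : injective f.
  move=> u v fuv; have := fP u; have := fP v; rewrite fuv.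
  case Eu : (c u) => [i|]; case Ev : (c v) => [j|] [b -> bv] [a] // [ab]; rewrite -{}ab bv => e.
    have ij : i = j.
      by apply: (@class_rank_inj _ _ c); rewrite -(mod_rank (idx u) i) -(mod_rank (idx v) j) e.
    apply: idx_inj; first by rewrite Eu Ev ij.
    by move: e; rewrite ij => /addIn/eqP; rewrite eqn_pmul2r // => /eqP ->.
  by apply: idx_inj; rewrite ?Eu ?Ev.
exists f.
  by apply: inj_card_bij => //; rewrite cardG card_sum !card_ord; lia.
move=> u v; rewrite adjE /= /col_adj.
have := fP u; have := fP v.
case Eu : (c u) => [i|]; case Ev : (c v) => [j|] [b -> bv] [a -> av] /=.
- rewrite /turan_adj av bv !mod_rank (inj_eq (@class_rank_inj _ _ c)).
  have [->|ij] := eqVneq i j; first by rewrite eqxx andbF.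
  rewrite (_ : u != v); first by apply/esym; apply/eqP => -[] /eqP; rewrite (negbTE ij).
  by apply: contra_neqN ij => /eqP uv; move: Eu; rewrite uv Ev => -[->].
- by apply/esym; rewrite andbT; apply: contra_eqN Eu => /eqP ->; rewrite Ev.
- by apply/esym; rewrite andbT; apply: contra_eqN Eu => /eqP ->; rewrite Ev.
- rewrite andbT /complete_adj -val_eqE /= av bv; congr negb.
  by apply/eqP/eqP => [|->//]; apply: idx_inj; rewrite Eu Ev.
Qed.

Section FormMaxIso.
Variable R : realType.
Variable k : nat.
Hypothesis k2 : (2 <= k)%N.

Lemma clique_sum_iso (G H : sgraph) (f : G -> H) (x : H -> R) : bijective f ->
  (forall u v, adj (f u) (f v) = adj u v) ->
  clique_sum k (fun v => x (f v)) = clique_sum k x.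
Proof.
move=> [g fK gK] fadj.
rewrite /clique_sum [RHS](reindex (fun h : {ffun 'I_k -> G} => [ffun i => f (h i)])) /=.
  apply: eq_big => [h|h _]; last by apply: eq_bigr => i _; rewrite ffunE.
  by apply/clique_mapP/clique_mapP => fcl i j /fcl; rewrite !ffunE fadj.
exists (fun h : {ffun 'I_k -> H} => [ffun i => g (h i)]) => h _; apply/ffunP => i;
  by rewrite !ffunE ?fK ?gK.
Qed.

Lemma form_max_iso (G H : sgraph) : (0 < #|G|)%N -> isomorphic G H -> form_max R k G = form_max R k H.
Proof.
move=> G0 [f [g fK gK] fadj]; have fbij : bijective f by exists g.
have gbij : bijective g by exists f.
have gadj u v : adj (g u) (g v) = adj u v by rewrite -fadj !gK.
have sum_g (F : G -> R) : \sum_v F (g v) = \sum_u F u.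
  rewrite (reindex f) /=; last by exists g => ? _; rewrite ?fK ?gK.
  by apply: eq_bigr => u _; rewrite fK.
have [x [x0 xS xT]] := form_max_attained k2 G0 (@ltr01 R).
apply/esym; apply: (form_maxE k2 (x := fun v => x (g v))).
- by move=> v.
- by rewrite (sum_g (fun u => x u ^+ k)) xS ltr01.
- move=> y y0; rewrite -(clique_sum_iso y fbij fadj).
  rewrite (reindex f) /=; last by exists g => ? _; rewrite ?fK ?gK.
  by apply: form_max_bound => // v.
- by rewrite clique_sum_iso // xT (sum_g (fun u => x u ^+ k)) xS.
Qed.

End FormMaxIso.

Section ColourCliques.
Variables (r : nat) (V : finType).

Lemma col_nonadjP (c : V -> option 'I_r) u v :
  reflect (u = v \/ exists2 i, c u = Some i & c v = Some i) (~~ col_adj c u v).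
Proof.
rewrite /col_adj negb_and negbK negb_or negbK; apply: (iffP orP).
  case=> [/eqP ->|/andP[]]; first by left.
  by case: (c u) => // i _ /eqP <-; right; exists i.
case=> [->|[i -> ->]]; first by left.
by right; rewrite eqxx.
Qed.

(** Being equal or of the same colour is an equivalence relation, so a vertex
    fails to be adjacent to at most one vertex of a clique. *)
Lemma col_nonadj_trans (c : V -> option 'I_r) u v w :
  ~~ col_adj c u v -> ~~ col_adj c v w -> ~~ col_adj c u w.
Proof.
move=> /col_nonadjP[->//|[i ui vi]] /col_nonadjP[<-|[j vj wj]]; apply/col_nonadjP.
  by right; exists i.
by right; exists i => //; rewrite wj -vj vi.
Qed.

End ColourCliques.

Section Positivity.
Variables (R : realType) (r : nat) (G : sgraph) (c : G -> option 'I_r).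
Hypothesis adjE : forall u v : G, adj u v = col_adj c u v.
Variables (j : nat) (x : G -> R).
Hypotheses (j0 : (0 < j)%N) (x0 : forall v, 0 <= x v).
Let xB : form_bound G j.+1 (form_max R j.+1 G) := @form_max_bound R j.+1 j0 G.
Hypothesis xmax : clique_sum j.+1 x = form_max R j.+1 G * \sum_v x v ^+ j.+1.
Hypothesis xpos : 0 < clique_sum j.+1 x.

Lemma colour_eigen v : link_sum j x v = form_max R j.+1 G * x v ^+ j.
Proof. exact: maximiser_eigen xB x0 xmax v. Qed.

(** A clique of positive weight, with at most one vertex removed, lies in the
    neighbourhood of any given vertex. *)
Lemma maximiser_gt0 v : 0 < x v.
Proof.
have [f fcl fpos] : exists2 f : {ffun 'I_j.+1 -> G}, clique_map f & forall i, 0 < x (f i).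
  case: (pickP (fun f : {ffun 'I_j.+1 -> G} => clique_map f && [forall i, 0 < x (f i)])).
    by move=> f /andP[fc /forallP]; exists f.
  move=> none; move: xpos; rewrite /clique_sum big1 ?ltxx // => f fc.
  have := none f; rewrite fc /= => /negbT; rewrite negb_forall => /existsP[i xi].
  rewrite -leNgt in xi; rewrite (bigD1 i) //= (_ : x (f i) = 0) ?mul0r //.
  by apply/eqP; rewrite eq_le xi x0.
have [i0 i0P] : exists i0, forall i, i != i0 -> adj v (f i).
  have [i0 ni0|all] := pickP (fun i => ~~ adj v (f i)); last first.
    by exists ord0 => i _; have /negbFE := all i.
  exists i0 => i ii0; apply: contraT => ni; move/clique_mapP: fcl => /(_ i i0 ii0).
  rewrite !adjE in ni0 ni *; move=> fi; move: (fi).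
  by rewrite (negbTE (col_nonadj_trans _ ni0)) // col_sym.
have lpos : 0 < link_sum j x v.
  pose g := [ffun k => f (lift i0 k)].
  rewrite /link_sum (bigD1 g) /=; last first.
    apply/andP; split.
      apply/clique_mapP => a b ab; rewrite !ffunE; move/clique_mapP: fcl; apply.
      by rewrite (inj_eq lift_inj).
    by apply/forallP => a; rewrite ffunE i0P // eq_sym neq_lift.
  apply: ltr_pwDl; first by apply: prodr_gt0 => a _; rewrite ffunE.
  by apply: sumr_ge0 => h _; apply: prodr_ge0.
rewrite lt_def x0 andbT; apply: contraTneq lpos => xv.
by rewrite colour_eigen xv expr0n gtn_eqF // mulr0 ltxx.
Qed.

Lemma form_max_gt0 : 0 < form_max R j.+1 G.
Proof.
have S0 : 0 <= \sum_v x v ^+ j.+1 by apply: sumr_ge0 => v _; apply: exprn_ge0.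
have := xpos; rewrite xmax => h; rewrite ltNge; apply/negP => neg.
by move: h; rewrite ltNge mulr_le0_ge0.
Qed.

(** Vertices of one class have the same neighbours, so the eigen-equations give
    them the same power. *)
Lemma colour_constant u v : ~~ adj u v -> x u = x v.
Proof.
move=> nuv; have : link_sum j x u = link_sum j x v.
  apply: eq_bigl => f; congr (_ && _); apply: eq_forallb => i.
  rewrite !adjE in nuv *; apply/idP/idP; apply: contraTT => n.
    exact: col_nonadj_trans nuv n.
  by apply: col_nonadj_trans n; rewrite col_sym.
rewrite !colour_eigen => /(mulfI (lt0r_neq0 form_max_gt0)) /eqP.
by rewrite eqrXn2 // => /eqP.
Qed.

End Positivity.

Section SplitClass.
Variables (R : realType) (G : sgraph) (I : {set G}).
Hypothesis I_adj : forall u v, u \in I -> adj u v = (v \notin I).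

Definition mask (x : G -> R) (v : G) : R := if v \in I then 0 else x v.

Lemma prod_mask k (f : {ffun 'I_k -> G}) (x : G -> R) :
  \prod_l mask x (f l) = if [forall l, f l \notin I] then \prod_l x (f l) else 0.
Proof.
case: ifP => [/forallP fI|/negbT]; first by apply: eq_bigr => l _; rewrite /mask (negbTE (fI l)).
rewrite negb_forall => /existsP[l fl]; rewrite (bigD1 l) //= /mask.
by rewrite negbK in fl; rewrite fl mul0r.
Qed.

Lemma link_sum_mask k (x : G -> R) v : v \in I -> link_sum k x v = clique_sum k (mask x).
Proof.
move=> vI; rewrite /link_sum /clique_sum big_mkcondr; apply: eq_bigr => f _.
rewrite prod_mask; congr (if _ then _ else _); apply: eq_forallb => l.
by rewrite I_adj.
Qed.

(** I is independent and completely joined to the rest, so a clique either avoids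
    I or consists of one vertex of I and a clique avoiding I. *)
Lemma clique_sum_mask k (x : G -> R) :
  clique_sum k.+1 x =
  clique_sum k.+1 (mask x) + (\sum_(v in I) x v) * clique_sum k (mask x) *+ k.+1.
Proof.
have E (f : {ffun 'I_k.+1 -> G}) : clique_map f ->
    \prod_i x (f i) = \prod_i mask x (f i) +
    \sum_i (if f i \in I then x (f i) * \prod_j x (f (lift i j)) else 0).
  move=> fcl; rewrite prod_mask.
  case: (pickP (fun i => f i \in I)) => [i0 fi0|nov].
    have out i : i != i0 -> f i \notin I.
      by move/clique_mapP: fcl => H ii0; have := H i0 i; rewrite I_adj // eq_sym => ->.
    rewrite ifF; last by apply/negbTE; rewrite negb_forall; apply/existsP; exists i0; rewrite negbK.
    rewrite add0r [RHS](bigD1 i0) //= fi0 [X in _ = _ + X]big1 => [|i ii0]; last first.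
      by rewrite (negbTE (out i ii0)).
    by rewrite addr0 (bigD1_ord i0).
  rewrite ifT; last by apply/forallP => i; rewrite nov.
  by rewrite [X in _ = _ + X]big1 ?addr0 // => i _; rewrite nov.
rewrite {1}/clique_sum (eq_bigr _ E) big_split; congr (_ + _).
rewrite exchange_big /= -[X in _ *+ X]card_ord -sumr_const.
apply: eq_bigr => i _.
rewrite big_mkcond (sum_finsert i) big_distrl [RHS]big_mkcond /=; apply: eq_bigr => v _.
case: ifP => vI; last first.
  by rewrite big1 // => g _; rewrite finsert_at vI; case: ifP.
rewrite -(link_sum_mask k x vI) /link_sum big_distrr /= [RHS]big_mkcond.
apply: eq_bigr => g _; rewrite clique_finsert finsert_at vI; case: ifP => // _.
by congr (_ * _); apply: eq_bigr => l _; rewrite finsert_lift.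
Qed.

End SplitClass.

Lemma two_point_enum r (i j : 'I_r) : i != j ->
  exists g : nat -> 'I_r, [/\ {in [pred l | (l < r)%N] &, injective g}, g 0%N = i & g 1%N = j].
Proof.
move=> ij; have r1 : (1 < r)%N.
  by move: (ltn_ord i) (ltn_ord j) ij; rewrite -val_eqE /=; lia.
pose o0 := Ordinal (ltnW r1); pose o1 := Ordinal r1.
pose p := tperm o0 i; pose q := tperm (p o1) j.
have val_o l : (l < r)%N -> val (insubd o0 l) = l by move=> lr; rewrite val_insubd lr.
have e0 : insubd o0 0%N = o0 by apply: val_inj; rewrite val_o ?(ltnW r1).
have e1 : insubd o0 1%N = o1 by apply: val_inj; rewrite val_o.
exists (fun l => q (p (insubd o0 l))); split.
- move=> l l' /= lr l'r /perm_inj/perm_inj/(congr1 val).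
  by rewrite !val_o.
- rewrite e0 /p tpermL /q tpermD //; last by rewrite eq_sym.
  by rewrite -[X in _ != X](tpermL o0 i) (inj_eq perm_inj) -val_eqE.
- by rewrite e1 /q tpermL.
Qed.

Section TwoClasses.
Variables (R : realType) (r : nat) (V : finType).

Lemma eq_clique_sum_colour (c c' : V -> option 'I_r) k (z : V -> R) :
  (forall v, z v != 0 -> c v = c' v) ->
  clique_sum k (z : colour_graph c -> R) = clique_sum k (z : colour_graph c' -> R).
Proof.
move=> zc; rewrite /clique_sum big_mkcond [RHS]big_mkcond; apply: eq_bigr => f _ /=.
have [fz|] := boolP [forall l, z (f l) != 0]; last first.
  rewrite negb_forall => /existsP[l]; rewrite negbK => /eqP zl.
  have -> : \prod_i z (f i) = 0 by rewrite (bigD1 l) //= zl mul0r.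
  by case: ifP; case: ifP.
congr (if _ then _ else _); apply/clique_mapP/clique_mapP => H l l' ll';
  have := H l l' ll'; rewrite /= /col_adj.
  by rewrite !zc //; apply/(forallP fz).
by rewrite -!zc //; apply/(forallP fz).
Qed.

Definition off_classes (c : V -> option 'I_r) (i j : 'I_r) (x : V -> R) (v : V) : R :=
  if (c v == Some i) || (c v == Some j) then 0 else x v.

Definition class_sum (c : V -> option 'I_r) (i : 'I_r) (x : V -> R) : R :=
  \sum_(v | c v == Some i) x v.

Definition class_set (c : V -> option 'I_r) (l : 'I_r) : {set colour_graph c} :=
  [set v | c v == Some l].

Lemma class_set_adj (c : V -> option 'I_r) l (u v : colour_graph c) :
  u \in class_set c l -> adj u v = (v \notin class_set c l).
Proof.
rewrite !inE /= /col_adj => /eqP ul; rewrite ul /= eq_sym [Some l == _]eq_sym andbC.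
by case: (eqVneq v u) => [->|]; rewrite ?ul ?eqxx ?andbT.
Qed.

Lemma sum_class_set (c : V -> option 'I_r) l (y : V -> R) :
  \sum_(v in class_set c l) y v = class_sum c l y.
Proof. by apply: eq_bigl => v; rewrite inE. Qed.

Lemma sum_mask_class (c : V -> option 'I_r) i j (x : V -> R) : i != j ->
  \sum_(v in class_set c j) mask (class_set c i) x v = class_sum c j x.
Proof.
move=> ij; rewrite -sum_class_set; apply: eq_bigr => v; rewrite /mask !inE => /eqP ->.
by rewrite (inj_eq Some_inj) eq_sym (negbTE ij).
Qed.

Lemma off_classesE (c : V -> option 'I_r) i j (x : V -> R) :
  (off_classes c i j x : colour_graph c -> R) =1 mask (class_set c j) (mask (class_set c i) x).
Proof.
by move=> v; rewrite /off_classes /mask !inE; case: (c v == Some i); case: ifP.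
Qed.

Lemma clique_sum_two_classes (c : V -> option 'I_r) i j k (x : V -> R) : i != j ->
  let z := off_classes c i j x in
  clique_sum k.+2 (x : colour_graph c -> R) =
  clique_sum k.+2 (z : colour_graph c -> R) +
  k.+2%:R * (class_sum c i x + class_sum c j x) * clique_sum k.+1 (z : colour_graph c -> R) +
  k.+2%:R * k.+1%:R * (class_sum c i x * class_sum c j x) *
    clique_sum k (z : colour_graph c -> R).
Proof.
move=> ij z.
rewrite !(eq_clique_sum _ (@off_classesE c i j x)) (clique_sum_mask (@class_set_adj c i)).
rewrite !(clique_sum_mask (@class_set_adj c j) _ (mask (class_set c i) x)).
rewrite (sum_mask_class c x ij) (sum_class_set c i x).
move: (clique_sum _ _) (clique_sum _ _) (clique_sum _ _) => T2 T1 T0.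
ring.
Qed.

Lemma link_sum_two_classes (c : V -> option 'I_r) i j k (x : V -> R) (u : V) :
  i != j -> c u = Some i ->
  let z := off_classes c i j x in
  link_sum k.+1 (x : colour_graph c -> R) u =
  clique_sum k.+1 (z : colour_graph c -> R) +
  k.+1%:R * class_sum c j x * clique_sum k (z : colour_graph c -> R).
Proof.
move=> ij ui z.
have uI : (u : colour_graph c) \in class_set c i by rewrite inE ui.
rewrite !(eq_clique_sum _ (@off_classesE c i j x)) (link_sum_mask (@class_set_adj c i)) //.
rewrite (clique_sum_mask (@class_set_adj c j)) (sum_mask_class c x ij).
move: (clique_sum _ _) (clique_sum _ _) => T1 T0.
ring.
Qed.

End TwoClasses.

(** * Balancing the classes *)

Section Convexity.
Variable R : realFieldType.

Lemma power_above_tangent k (u mu : R) : 0 <= u -> 0 <= mu ->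
  mu ^+ k.+1 + k.+1%:R * mu ^+ k * (u - mu) <= u ^+ k.+1.
Proof.
move=> u0 m0; elim: k => [|k IH]; first by rewrite !expr1 expr0; lra.
have h := ler_wpM2l u0 IH.
rewrite [u ^+ k.+2]exprS; apply: le_trans h; rewrite -subr_ge0.
have -> : k.+2%:R = k.+1%:R + 1 :> R by rewrite -natr1.
have -> : mu ^+ k.+2 = mu * (mu * mu ^+ k) by rewrite !exprS.
have -> : mu ^+ k.+1 = mu * mu ^+ k by rewrite exprS.
rewrite (_ : _ - _ = k.+1%:R * mu ^+ k * (u - mu) ^+ 2); last by ring.
by rewrite mulr_ge0 ?sqr_ge0 // mulr_ge0 ?exprn_ge0.
Qed.

Lemma power_jensen k (p q u v : R) : 0 <= p -> 0 <= q -> 0 < p + q ->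
  0 <= u -> 0 <= v ->
  (p + q) * ((p * u + q * v) / (p + q)) ^+ k.+1 <= p * u ^+ k.+1 + q * v ^+ k.+1.
Proof.
move=> p0 q0 pq u0 v0; set mu := _ / _.
have m0 : 0 <= mu by rewrite divr_ge0 ?addr_ge0 ?mulr_ge0.
have muE : mu * (p + q) = p * u + q * v by rewrite /mu divfK // gt_eqF.
have hu := ler_wpM2l p0 (power_above_tangent k u0 m0).
have hv := ler_wpM2l q0 (power_above_tangent k v0 m0).
apply: le_trans (lerD hu hv); rewrite le_eqVlt; apply/orP; left; apply/eqP.
rewrite [RHS](_ : _ = (p + q) * mu ^+ k.+1 +
  k.+1%:R * mu ^+ k * (p * u + q * v - mu * (p + q))); last by ring.
by rewrite muE subrr mulr0 addr0.
Qed.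

End Convexity.

Section CountColourful.
Variables (r : nat) (V : finType) (c : V -> option 'I_r).

Lemma colour_cliques_lower (R : realDomainType) k q : (forall i, (q <= class_size c i)%N) ->
  (r ^_ k * q ^ k)%:R <= clique_sum k (fun _ : colour_graph c => 1 : R).
Proof.
move=> qc.
have -> : clique_sum k (fun _ : colour_graph c => 1 : R) =
    (\sum_(f : {ffun 'I_k -> colour_graph c} | clique_map f) 1)%N%:R.
  by rewrite natr_sum; apply: eq_bigr => f _; rewrite big1.
rewrite ler_nat.
apply: leq_trans (_ : \sum_(h : {ffun 'I_k -> 'I_r} | injectiveb h)
   \sum_(f : {ffun 'I_k -> V} | [forall l, c (f l) == Some (h l)]) 1 <= _)%N.
  apply: leq_trans (_ : \sum_(h : {ffun 'I_k -> 'I_r} | injectiveb h) q ^ k <= _)%N.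
    rewrite sum_nat_const leq_mul2r; apply/orP; right.
    by have := card_inj_ffuns 'I_k 'I_r; rewrite !card_ord cardsE => ->.
  apply: leq_sum => h _.
  rewrite (_ : (\sum_(f | _) 1)%N = \prod_l \sum_(v | c v == Some (h l)) 1)%N.
    rewrite -[k in (q ^ k)%N]card_ord -prod_nat_const; apply: leq_prod => l _.
    by rewrite sum1dep_card; apply: qc.
  rewrite bigA_distr_big_dep /=; apply: eq_big => [f|f _]; last by rewrite big1.
  by apply/forallP/familyP.
rewrite (exchange_big_dep xpredT) //= [leqRHS]big_mkcond; apply: leq_sum => f _.
have [h /andP[/injectiveP hinj /forallP hc]|none] :=
    pickP (fun h : {ffun 'I_k -> 'I_r} => injectiveb h && [forall l, c (f l) == Some (h l)]);
  last by rewrite big_pred0.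
have fcl : clique_map (f : {ffun 'I_k -> colour_graph c}).
  by apply: (clique_map_colours (h := h)) => // l; apply/eqP.
rewrite fcl (bigD1 h) /=; last by rewrite (introT (injectiveP _) hinj); apply/forallP.
rewrite big1 // => h' /andP[/andP[_ /forallP hc'] /eqP[]].
by apply/ffunP => l; apply: Some_inj; rewrite -(eqP (hc l)) -(eqP (hc' l)).
Qed.

End CountColourful.

Section Recolour.
Variables (R : realType) (r : nat) (V : finType).
Variables (k : nat).
Hypothesis kr : (k.+2 <= r)%N.
Let k2 : (2 <= k.+2)%N. Proof. by []. Qed.

Local Notation tau c := (form_max R k.+2 (colour_graph c)).

Lemma sum_two_classes (c : V -> option 'I_r) i j (F : V -> R) : i != j ->
  \sum_v F v = class_sum c i F + class_sum c j F +
    \sum_(v | ~~ ((c v == Some i) || (c v == Some j))) F v.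
Proof.
move=> ij; rewrite (bigID (fun v => c v == Some i)) /= -addrA; congr (_ + _).
rewrite (bigID (fun v => c v == Some j)) /=; congr (_ + _).
  apply: eq_bigl => v; case: (c v =P Some j) => [->|_]; rewrite ?andbF ?andbT //.
  by rewrite (inj_eq Some_inj) eq_sym.
by apply: eq_bigl => v; rewrite negb_or.
Qed.

Lemma class_sum_const (c : V -> option 'I_r) i (F : V -> R) (a : R) :
  (forall v, c v = Some i -> F v = a) -> class_sum c i F = (class_size c i)%:R * a.
Proof.
move=> Fa; rewrite /class_sum (eq_bigr (fun _ => a)) => [|v /eqP/Fa //].
by rewrite sumr_const mulr_natl /class_size cardsE.
Qed.

Lemma off_cliques_gt0 (c : V -> option 'I_r) i j (x : V -> R) : i != j ->
  (forall l, (0 < class_size c l)%N) -> (forall v, 0 < x v) ->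
  0 < clique_sum k (off_classes c i j x : colour_graph c -> R).
Proof.
move=> ij ne x0; have [g [ginj g0 g1]] := two_point_enum ij.
have [v0 v0c] := class_representatives ne.
pose f : {ffun 'I_k -> colour_graph c} := [ffun l : 'I_k => v0 (g l.+2)].
have lr (l : 'I_k) : (l.+2 < r)%N by apply: leq_trans kr; rewrite !ltnS.
have r1 : (1 < r)%N by apply: leq_trans kr.
have fcl : clique_map f.
  apply: (clique_map_colours (h := fun l : 'I_k => g l.+2)) => [l l'|l]; last by rewrite ffunE v0c.
  by move=> /ginj; rewrite !inE !lr => /(_ isT isT) [] /val_inj.
rewrite /clique_sum (bigD1 f) //=; apply: ltr_pwDl.
  apply: prodr_gt0 => l _; rewrite ffunE /off_classes v0c !(inj_eq Some_inj).
  rewrite -g0 -g1 ifF //; apply/negbTE; rewrite negb_or; apply/andP; split; apply/eqP => /ginj.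
    by rewrite !inE lr (ltnW r1) => /(_ isT isT).
  by rewrite !inE lr r1 => /(_ isT isT).
apply: sumr_ge0 => h _; apply: prodr_ge0 => l _; rewrite /off_classes.
by case: ifP => // _; apply: ltW.
Qed.

(** Move a vertex from a class of size A to one of size B <= A - 2, and replace
    the class sums by convex combinations: with om = 1 / (A - B), the new sizes
    and the new sums are both obtained from the old ones by the same averaging.
    Then the norm does not grow, because p u^s is convex in the pair of mass and
    size (it is the perspective of a power), while the product of the two class
    sums strictly increases. *)
Lemma recolour_increases (c : V -> option 'I_r) i j :
  (forall l, (0 < class_size c l)%N) ->
  (class_size c j + 2 <= class_size c i)%N ->
  exists c' : V -> option 'I_r,
    [/\ [set v | c' v == None] = [set v | c v == None],
        forall l, (0 < class_size c' l)%N & tau c < tau c'].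
Proof.
move=> ne big_i.
have ij : i != j by apply: contraTneq big_i => ->; lia.
have [w wi] : exists w, c w = Some i.
  by have /card_gt0P[v] := ne i; rewrite inE => /eqP; exists v.
pose c' v := if v == w then Some j else c v.
have c'_none : [set v | c' v == None] = [set v | c v == None].
  by apply/setP => v; rewrite !inE /c'; case: (v =P w) => [->|//]; rewrite wi.
have c'_pair v : (c' v == Some i) || (c' v == Some j) = ((c v == Some i) || (c v == Some j)).
  by rewrite /c'; case: (v =P w) => [->|//]; rewrite wi !eqxx orbT.
have size_i : class_size c i = (class_size c' i).+1.
  rewrite /class_size (cardsD1 w) inE wi eqxx add1n; congr _.+1; apply: eq_card => v.
  by rewrite !inE /c'; case: (v =P w) => //= _; rewrite (inj_eq Some_inj) eq_sym (negbTE ij).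
have size_j : class_size c' j = (class_size c j).+1.
  have c'w : c' w = Some j by rewrite /c' eqxx.
  rewrite /class_size (cardsD1 w) inE c'w eqxx add1n; congr _.+1; apply: eq_card => v.
  rewrite !inE /c'; case: (v =P w) => //= ->.
  by rewrite wi (inj_eq Some_inj) (negbTE ij).
have size_l l : l != i -> l != j -> class_size c' l = class_size c l.
  move=> li lj; apply: eq_card => v; rewrite !inE /c'; case: (v =P w) => // ->.
  by rewrite wi !(inj_eq Some_inj) [j == l]eq_sym [i == l]eq_sym (negbTE li) (negbTE lj).
have ne' l : (0 < class_size c' l)%N.
  have [->|li] := eqVneq l i; first by move: big_i; rewrite size_i; lia.
  have [->|lj] := eqVneq l j; first by rewrite size_j.
  by rewrite size_l.
exists c'; split=> //.
have V0 : (0 < #|colour_graph c|)%N by apply/card_gt0P; exists w.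
have [x [x0 xS xT]] := form_max_attained k2 V0 (@ltr01 R).
have tau0 : 0 < tau c.
  have := @form_max_bound R k.+2 k2 (colour_graph c) (fun _ => 1) (fun _ => ler01).
  have := @colour_cliques_lower r V c R k.+2 1 ne; rewrite exp1n muln1 => h1 h2.
  have : 0 < tau c * \sum_(v : V) (1 : R) ^+ k.+2.
    apply: lt_le_trans h2; apply: lt_le_trans h1; rewrite ltr0n ffact_gt0 //.
  rewrite pmulr_lgt0 //; under eq_bigr do rewrite expr1n.
  by rewrite sumr_const ltr0n; apply/card_gt0P; exists w.
have xT' : clique_sum k.+2 x = tau c * \sum_v x v ^+ k.+2 by rewrite xS.
have Tpos : 0 < clique_sum k.+2 x by rewrite xT mulr1.
have adjE (u v : colour_graph c) : adj u v = col_adj c u v by [].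
have xpos := maximiser_gt0 adjE (ltn0Sn k) x0 xT' Tpos.
have eig := colour_eigen (ltn0Sn k) x0 xT'.
have const := colour_constant adjE (ltn0Sn k) x0 xT' Tpos.
have [w' w'j] : exists w', c w' = Some j.
  by have /card_gt0P[v] := ne j; rewrite inE => /eqP; exists v.
have x_i v : c v = Some i -> x v = x w.
  by move=> vi; apply: const; rewrite adjE; apply/col_nonadjP; right; exists i.
have x_j v : c v = Some j -> x v = x w'.
  by move=> vj; apply: const; rewrite adjE; apply/col_nonadjP; right; exists j.
set A : R := (class_size c i)%:R; set B : R := (class_size c j)%:R.
have AB : B + 2 <= A by rewrite /A /B -natrD ler_nat.
have B0 : 0 <= B by [].
have Ai : (class_size c' i)%:R = A - 1 :> R by rewrite /A size_i -natr1 addrK.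
have Bj : (class_size c' j)%:R = B + 1 :> R by rewrite size_j -natr1.
pose bi := A * x w; pose bj := B * x w'.
have sum_i : class_sum c i x = bi by apply: class_sum_const.
have sum_j : class_sum c j x = bj by apply: class_sum_const.
pose om := (A - B)^-1.
have AB0 : A - B != 0 by rewrite gt_eqF //; lra.
have om0 : 0 < om by rewrite invr_gt0; lra.
have omAB : om * (A - B) = 1 by rewrite mulVf.
have om_half : om <= 2^-1 by rewrite lef_pV2 ?posrE; lra.
have A1 : A - 1 = (1 - om) * A + om * B by lra.
have B1 : B + 1 = om * A + (1 - om) * B by lra.
pose bi' := (1 - om) * bi + om * bj; pose bj' := om * bi + (1 - om) * bj.
pose y (v : V) : R := if c' v == Some i then bi' / (A - 1) else
  if c' v == Some j then bj' / (B + 1) else x v.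
have bi0 : 0 < bi by rewrite mulr_gt0 //; lra.
have bj0 : 0 <= bj by rewrite mulr_ge0.
have bi'0 : 0 <= bi' by rewrite /bi'; nra.
have bj'0 : 0 <= bj' by rewrite /bj'; nra.
have y0 v : 0 <= y v.
  by rewrite /y; case: ifP => _; [|case: ifP => _ //]; rewrite divr_ge0 //; lra.
have y_i v : c' v = Some i -> y v = bi' / (A - 1) by rewrite /y => ->; rewrite eqxx.
have y_j v : c' v = Some j -> y v = bj' / (B + 1).
  by rewrite /y => ->; rewrite (inj_eq Some_inj) eq_sym (negbTE ij) eqxx.
have y_off v : ~~ ((c v == Some i) || (c v == Some j)) -> y v = x v.
  by rewrite -c'_pair negb_or /y => /andP[/negbTE -> /negbTE ->].
have sum_i' : class_sum c' i y = bi'.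
  by rewrite (class_sum_const y_i) Ai mulrC divfK // gt_eqF //; lra.
have sum_j' : class_sum c' j y = bj'.
  by rewrite (class_sum_const y_j) Bj mulrC divfK // gt_eqF //; lra.
pose z := off_classes c i j x.
have zE v : off_classes c' i j y v = z v.
  by rewrite /off_classes /z /off_classes c'_pair; case: ifPn => // /y_off.
have norm : \sum_v y v ^+ k.+2 <= 1.
  rewrite -xS (sum_two_classes c' _ ij) (sum_two_classes c _ ij).
  have -> : \sum_(v | ~~ ((c' v == Some i) || (c' v == Some j))) y v ^+ k.+2 =
      \sum_(v | ~~ ((c v == Some i) || (c v == Some j))) x v ^+ k.+2.
    by apply: eq_big => v; [rewrite c'_pair|rewrite c'_pair => /y_off ->].
  rewrite lerD2r.
  rewrite (class_sum_const (a := (bi' / (A - 1)) ^+ k.+2)) => [|v /y_i -> //].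
  rewrite (class_sum_const (a := (bj' / (B + 1)) ^+ k.+2)) => [|v /y_j -> //].
  rewrite (class_sum_const (a := x w ^+ k.+2)) => [|v /x_i -> //].
  rewrite (class_sum_const (a := x w' ^+ k.+2)) => [|v /x_j -> //].
  rewrite Ai Bj -/A -/B A1 B1.
  have -> : bi' = (1 - om) * A * x w + om * B * x w' by rewrite /bi' /bi /bj; ring.
  have -> : bj' = om * A * x w + (1 - om) * B * x w' by rewrite /bj' /bi /bj; ring.
  have h1 : (1 - om) * A >= 0 by rewrite mulr_ge0 //; lra.
  have h2 : om * B >= 0 by rewrite mulr_ge0 // ltW.
  have h3 : om * A >= 0 by rewrite mulr_ge0 ?(ltW om0) //; lra.
  have h4 : (1 - om) * B >= 0 by rewrite mulr_ge0 //; lra.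
  have p1 : 0 < (1 - om) * A + om * B by rewrite -A1; lra.
  have p2 : 0 < om * A + (1 - om) * B by rewrite -B1; lra.
  have := power_jensen k.+1 h1 h2 p1 (x0 w) (x0 w').
  have := power_jensen k.+1 h3 h4 p2 (x0 w) (x0 w').
  by lra.
have z0 := off_cliques_gt0 ij ne xpos.
(* Equal class sums would make the eigen-equations of the two classes equal, hence
   their weights, hence the sizes A and B. *)
have bij : bi != bj.
  apply: contraTneq AB => bE.
  have := link_sum_two_classes k x ij wi; have ji : j != i by rewrite eq_sym.
  have := link_sum_two_classes k x ji w'j; cbv zeta; rewrite sum_i sum_j !eig bE.
  have off_sym : off_classes c j i x =1 off_classes c i j x.
    by move=> v; rewrite /off_classes orbC.
  rewrite !(@eq_clique_sum (colour_graph c) _ _ _ _ off_sym) => <- /(mulfI (lt0r_neq0 tau0)) /eqP.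
  rewrite eqrXn2 // => /eqP xw; move: bE; rewrite /bi /bj xw => /(mulIf (lt0r_neq0 (xpos w'))) ->.
  by rewrite -ltNge; lra.
have gain : clique_sum k.+2 (x : colour_graph c -> R) < clique_sum k.+2 (y : colour_graph c' -> R).
  rewrite (clique_sum_two_classes c k x ij) (clique_sum_two_classes c' k y ij).
  cbv zeta; rewrite sum_i sum_j sum_i' sum_j'.
  have E l : clique_sum l (off_classes c' i j y : colour_graph c' -> R) =
      clique_sum l (z : colour_graph c -> R).
    rewrite (@eq_clique_sum (colour_graph c') _ _ _ _ zE); apply: eq_clique_sum_colour => v.
    by rewrite /z /off_classes -c'_pair /c'; case: (v =P w) => [_|//]; rewrite !eqxx orbT /= eqxx.
  rewrite !E -/z (_ : bi' + bj' = bi + bj); last by rewrite /bi' /bj'; ring.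
  rewrite ltrD2l ltr_pM2r // ltr_pM2l ?mulr_gt0 // -subr_gt0.
  rewrite (_ : _ - _ = om * (1 - om) * (bi - bj) ^+ 2); last by rewrite /bi' /bj'; ring.
  apply: mulr_gt0; first by apply: mulr_gt0; lra.
  by rewrite exprn_even_gt0 //= subr_eq0.
have := @form_max_bound R k.+2 k2 (colour_graph c') y y0; rewrite xT mulr1 in gain.
move=> bound; have := lt_le_trans gain bound; set t' := tau c' => tt'.
have t'0 : 0 <= t'.
  rewrite leNgt; apply/negP => neg.
  have : t' * \sum_v y v ^+ k.+2 <= 0.
    by apply: mulr_le0_ge0; [exact: ltW|apply: sumr_ge0 => v _; exact: exprn_ge0].
  by lra.
by apply: lt_le_trans tt' _; rewrite ler_piMr.
Qed.

(** A colouring maximising the form over all colourings with no empty class is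
    balanced, since recolouring a vertex could otherwise improve it. *)
Lemma best_colouring (q : nat) (c0 : V -> option 'I_r) :
  #|[set v | c0 v == None]| = q -> (forall l, (0 < class_size c0 l)%N) ->
  exists cm : V -> option 'I_r,
    [/\ #|[set v | cm v == None]| = q, balanced cm &
        forall c : V -> option 'I_r, #|[set v | c v == None]| = q ->
          (forall l, (0 < class_size c l)%N) ->
          tau c <= tau cm /\ (tau c = tau cm -> balanced c)].
Proof.
move=> c0q c0ne.
pose valid (c : {ffun V -> option 'I_r}) :=
  (#|[set v | c v == None]| == q) && [forall l, 0 < class_size c l]%N.
have validP (c : V -> option 'I_r) : #|[set v | c v == None]| = q ->
    (forall l, (0 < class_size c l)%N) -> valid (finfun c) /\ tau (finfun c) = tau c.
  move=> cq cne; have ce : finfun c =1 c by move=> v; rewrite ffunE.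
  split.
    apply/andP; split; first by rewrite -cq; apply/eqP/eq_card => v; rewrite !inE ce.
    apply/forallP => l; apply: leq_trans (cne l) _; rewrite /class_size.
    by apply/eq_leq/eq_card => v; rewrite !inE ce.
  suff -> : (finfun c : V -> _) = c by [].
  exact/funext.
have [v0 _] := validP c0 c0q c0ne.
have unbal (c : V -> option 'I_r) : ~ balanced c -> exists i j, (class_size c j + 2 <= class_size c i)%N.
  move=> nb; have [//|none] := pselect (exists i j, (class_size c j + 2 <= class_size c i)%N).
  by case: nb => i j; rewrite leqNgt; apply/negP => ji; apply: none; exists i, j; lia.
have cmax (c : {ffun V -> option 'I_r}) : valid c ->
    (forall c' : {ffun V -> option 'I_r}, valid c' -> tau c' <= tau c) -> balanced c.
  move=> /andP[/eqP cq /forallP cne] cM; have [//|/unbal[i [j ij]]] := pselect (balanced c).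
  have [c' [c'n c'ne lt]] := recolour_increases cne ij.
  have c'q : #|[set v | c' v == None]| = q by rewrite c'n.
  have [c'v c'E] := validP c' c'q c'ne.
  by move: lt; rewrite -c'E ltNge cM.
case: (@Order.TotalTheory.arg_maxP _ _ _ (finfun c0) valid (fun c : {ffun V -> option 'I_r} => tau c) v0) => cm cmv cmM.
exists cm; have /andP[/eqP cmq /forallP cmne] := cmv; split=> //; first exact: cmax.
move=> c cq cne; have [cv cE] := validP c cq cne.
rewrite -cE; split; first exact: cmM.
move=> eq_tau; have bal : balanced (finfun c : {ffun V -> option 'I_r}).
  by apply: cmax => // c' c'v; rewrite eq_tau; apply: cmM.
have ce : (finfun c : V -> _) = c by apply/funext => v; rewrite ffunE.
by rewrite ce in bal.
Qed.

End Recolour.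

(** * The extremal graph *)

Section Host.
Variable R : realType.
Variables (r s t : nat).
Definition host (n : nat) : sgraph :=
  graph_join (complete_graph (t - 1)) (turan_graph r (n - t + 1)).

Lemma card_host n : (0 < t)%N -> (t <= n)%N -> #|host n| = n.
Proof. by move=> t0 tn; rewrite card_sum !card_ord; lia. Qed.

Hypotheses (s2 : (2 <= s)%N) (sr : (s <= r)%N) (t2 : (2 <= t)%N).
Let r0 : (0 < r)%N. Proof. by lia. Qed.

Definition host_colour n (v : host n) : option 'I_r :=
  if v is inr u then Some (Ordinal (ltn_pmod u r0)) else None.

Lemma host_adj n (u v : host n) : adj u v = col_adj (@host_colour n) u v.
Proof.
rewrite /col_adj; case: u v => [u|u] [v|v] //=; rewrite ?andbT.
- by rewrite /complete_adj.
- rewrite /turan_adj (inj_eq Some_inj) -val_eqE /=.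
  case: (u %% r =P v %% r)%N => [//|ne]; rewrite ?andbF //= andbT.
  by apply/esym; apply/eqP => -[] uv; apply: ne; rewrite uv.
Qed.

Lemma host_class_size n i :
  class_size (@host_colour n) i = #|turan_part r (n - t + 1) i|.
Proof.
rewrite /class_size -(card_imset _ (@inr_inj 'I_(t - 1) 'I_(n - t + 1))).
apply: eq_card => -[u|u]; rewrite !inE /=.
  by apply/esym/negbTE/imsetP => -[].
by rewrite (mem_imset _ _ (@inr_inj _ _)) inE (inj_eq Some_inj) -val_eqE.
Qed.

Lemma host_balanced n : balanced (@host_colour n).
Proof. by move=> i j; rewrite !host_class_size; apply: turan_balanced. Qed.

Lemma host_none n : #|[set v | @host_colour n v == None]| = (t - 1)%N.
Proof.
rewrite -[RHS]card_ord -cardsT -(card_imset _ (@inl_inj 'I_(t - 1) 'I_(n - t + 1))).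
apply: eq_card => -[u|u]; rewrite !inE /=.
  by rewrite (mem_imset _ _ (@inl_inj _ _)) inE.
by apply/esym/negbTE/imsetP => -[].
Qed.

Lemma colour_graph_id (G : sgraph) (c : G -> option 'I_r) :
  (forall u v, adj u v = col_adj c u v) -> isomorphic G (colour_graph c).
Proof. by move=> adjE; exists id => [|u v]; [exists id|rewrite adjE]. Qed.

(** Evaluate the form at the constant vector 1. *)
Lemma host_form_max_lower (del : R) : 0 < del ->
  exists N : nat, forall n : nat, (N <= n)%N ->
    (turan_density R r s - del) * n%:R ^+ s.-1 <= form_max R s (host n).
Proof.
move=> del0; pose C := (t + 2 * r)%N.
have [D arch] := archimedean_le (s%:R * C%:R) del0.
exists (maxn 1 (maxn C D)) => n.
rewrite !geq_max => /and3P[n1 nC nD].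
have tn : (t <= n)%N by rewrite (leq_trans _ nC) // leq_addr.
have npos : 0 < n%:R :> R by rewrite ltr0n.
pose q := ((n - t + 1 - r) %/ r)%N.
have qc i : (q <= class_size (@host_colour n) i)%N.
  have := balanced_lower i (@host_balanced n).
  have := card_classes (@host_colour n); rewrite host_none card_host ?(ltnW t2) // => tot low.
  rewrite /q -ltnS ltn_divLR // mulSn [(_ * r)%N]mulnC; lia.
have rq : (n - C <= r * q)%N.
  have := ltn_ceil (n - t + 1 - r) r0; rewrite -/q mulSn mulnC /C; lia.
have := colour_cliques_lower R s qc.
have h0 u v : adj u v = col_adj (@host_colour n) u v := host_adj u v.
have [f fbij fadj] := colour_graph_id h0.
rewrite -(clique_sum_iso s _ fbij fadj) => low.
have := @form_max_bound R s s2 (host n) (fun _ => 1) (fun _ => ler01).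
under eq_bigr do rewrite expr1n; rewrite sumr_const card_host ?(ltnW t2) // => up.
have dens : (r ^_ s * q ^ s)%:R = turan_density R r s * (r%:R * q%:R) ^+ s.
  rewrite natrM exprMn mulrA natrX; congr (_ * _).
  rewrite /turan_density -[X in _ ^+ X]card_ord -prodr_const -big_split /=.
  elim: (s) sr => [|k IH] kr; first by rewrite ffactn0 big_ord0.
  rewrite ffactnSr natrM big_ord_recr IH ?(ltnW kr) //=; congr (_ * _).
  by rewrite natrB ?(ltnW kr) // mulrBl mul1r divfK // pnatr_eq0 -lt0n.
have sE : s = s.-1.+1 by case: (s) s2.
have d1 := turan_density_le1 R sr.
have d0 := turan_density_gt0 R sr.
have nC' : n%:R - C%:R = (n - C)%:R :> R by rewrite natrB.
have bern : n%:R ^+ s - s%:R * n%:R ^+ s.-1 * C%:R <= (r%:R * q%:R) ^+ s :> R.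
  apply: le_trans (_ : (n%:R - C%:R) ^+ s <= _); last first.
    rewrite lerXn2r ?nnegrE ?mulr_ge0 ?nC' ?ler0n //.
    by rewrite -natrM ler_nat.
  have := @power_above_tangent R s.-1 (n%:R - C%:R) n%:R.
  rewrite nC' !ler0n -sE => /(_ isT isT); rewrite -nC'; lra.
have CD := arch _ nD.
have P0 : 0 < n%:R ^+ s.-1 :> R by rewrite exprn_gt0.
have nE : n%:R ^+ s = n%:R ^+ s.-1 * n%:R :> R by rewrite {1}sE exprSr.
rewrite -(ler_pM2r npos) -mulrA -nE.
have up' : (r ^_ s * q ^ s)%:R <= form_max R s (host n) * n%:R by apply: le_trans low up.
apply: le_trans up'; rewrite dens.
apply: le_trans (_ : turan_density R r s * (n%:R ^+ s - s%:R * n%:R ^+ s.-1 * C%:R) <= _); last first.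
  by rewrite ler_pM2l.
have h3 : turan_density R r s * (s%:R * n%:R ^+ s.-1 * C%:R) <= s%:R * n%:R ^+ s.-1 * C%:R.
  by rewrite ler_piMl // !mulr_ge0 ?ler0n // ltW.
have h4 : s%:R * C%:R * n%:R ^+ s.-1 <= del * n%:R * n%:R ^+ s.-1 by rewrite ler_pM2r.
by rewrite nE in h3 *; lra.
Qed.

(** The best colouring is balanced, and a balanced one gives the host. *)
Lemma colour_le_host (G : sgraph) (c : G -> option 'I_r) :
  (t <= #|G|)%N -> (forall u v, adj u v = col_adj c u v) ->
  #|[set v | c v == None]| = (t - 1)%N -> (forall l, (0 < class_size c l)%N) ->
  form_max R s G <= form_max R s (host #|G|) /\
  (form_max R s G = form_max R s (host #|G|) -> isomorphic G (host #|G|)).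
Proof.
move=> tn adjE c0 cne.
have G0 : (0 < #|G|)%N by apply: leq_trans tn; lia.
have sE : s = s.-2.+2 by case: (s) s2 => [|[]].
have kr : (s.-2.+2 <= r)%N by rewrite -sE.
have [cm [cm0 cmb cmM]] := best_colouring R kr c0 cne.
have t0 : (0 < t)%N by lia.
have iso_m : isomorphic (colour_graph cm) (host #|G|).
  exact: (@balanced_isomorphic r t #|G| (colour_graph cm) cm).
have [le eq] := cmM c c0 cne.
have Em : form_max R s (colour_graph cm) = form_max R s (host #|G|) by apply: form_max_iso.
have Ec : form_max R s G = form_max R s (colour_graph c).
  by apply: form_max_iso => //; apply: colour_graph_id.
rewrite -sE Em -Ec in le eq; split=> // /eq cb.
exact: (@balanced_isomorphic r t #|G| G c).
Qed.

(** Each copy of K^+ contains r+1 pairwise adjacent vertices, too many for an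
    r-partite graph; so each of the t disjoint copies uses one of the t - 1
    vertices of the complete part. *)
Lemma host_free (ns : r.-tuple nat) n :
  (forall i, (0 < tnth ns i)%N) -> (2 <= head 0%N ns)%N ->
  free_of (copies t (kplus ns)) (host n).
Proof.
move=> ns0 ns1 [f finj fhom].
pose z := Ordinal r0.
have nsz : (1 < tnth ns z)%N by rewrite (tnth_nth 0%N) /= nth0.
pose e (o : option 'I_r) : kplus ns :=
  if o is Some i then Tagged (fun i => 'I_(tnth ns i)) (Ordinal (ns0 i))
  else Tagged (fun i => 'I_(tnth ns i)) (Ordinal nsz).
have e_adj o o' : o != o' -> adj (e o) (e o').
  rewrite /= /kplus_adj; case: o o' => [i|] [j|] //= ij.
  - by rewrite (_ : i != j).
  - by case: (eqVneq i z) => [->|].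
  - by rewrite eq_sym; case: (eqVneq j z) => [->|].
have touch (l : 'I_t) : exists a : 'I_(t - 1), exists p, f (l, p) = inl a.
  have [//|none] := pselect (exists a : 'I_(t - 1), exists p, f (l, p) = inl a).
  have inr_f p : exists u, f (l, p) = inr u.
    by case E : (f (l, p)) => [a|u]; [case: none; exists a, p|exists u].
  pose u o := sval (cid (inr_f (e o))).
  have uP o : f (l, e o) = inr (u o) by rewrite /u; case: cid.
  pose res o : 'I_r := Ordinal (ltn_pmod (u o) r0).
  have res_inj : injective res.
    move=> o o' /(congr1 val) /= eq_res; apply/eqP; apply: contraT => oo'.
    have ee : adj ((l, e o) : copies t (kplus ns)) (l, e o').
      by apply/andP; split; [exact: eqxx|exact: e_adj].
    by have := fhom _ _ ee; rewrite !uP /= /turan_adj eq_res eqxx.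
  by have := leq_card _ res_inj; rewrite card_option card_ord ltnn.
pose a l := sval (cid (touch l)).
have aP l : exists p, f (l, p) = inl (a l) by rewrite /a; case: cid.
have a_inj : injective a.
  move=> l l' al; have [p fp] := aP l; have [p' fp'] := aP l'.
  by have [] : (l, p) = (l', p') by apply: finj; rewrite fp fp' al.
by have := leq_card _ a_inj; rewrite !card_ord; lia.
Qed.

End Host.

(** * Robust copies *)

Section Robust.
Variable R : realType.
Variables (r : nat) (ns : r.-tuple nat) (m : nat).
Hypotheses (r2 : (2 <= r)%N) (nsm : forall i, (tnth ns i <= m)%N).
Variables (G : sgraph) (eta : R) (A : 'I_r -> {set G}).
Hypothesis nc : near_complete eta A.
Let n : R := #|G|%:R.
Let b := (m + 2)%N.

(** Choose the blocks class by class: the at most r b vertices chosen before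
    exclude at most eta n vertices each from the next class. *)
Lemma greedy_blocks (X : 'I_r -> {set G}) : (forall i, X i \subset A i) ->
  (forall i, (r * b)%:R * (eta * n) + b%:R <= #|X i|%:R) ->
  exists S : 'I_r -> {set G}, [/\ forall i, S i \subset X i, forall i, (b <= #|S i|)%N &
    forall i j a d, i != j -> a \in S i -> d \in S j -> adj a d].
Proof.
have [_ _ _ miss _] := nc => XA Xbig.
suff : forall k, (k <= r)%N -> exists S : 'I_r -> {set G},
    [/\ forall i : 'I_r, (i < k)%N -> S i \subset X i,
        forall i : 'I_r, (i < k)%N -> #|S i| = b &
        forall (i j : 'I_r) a d, (i < j)%N -> (j < k)%N -> a \in S i -> d \in S j -> adj a d].
  move=> /(_ r (leqnn r))[S [SX Sb Sadj]]; exists S; split=> [i|i|i j a d ij aS dS].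
  - exact: SX.
  - by rewrite Sb.
  - have [lt|gt|/val_inj e] := ltngtP i j; last by rewrite e eqxx in ij.
      exact: Sadj lt _ aS dS.
    by rewrite adj_sym; apply: Sadj gt _ dS aS.
elim=> [_|k IH kr]; first by exists (fun _ => set0).
have [S [SX Sb Sadj]] := IH (ltnW kr); pose k' := Ordinal kr.
pose Bd := \bigcup_(i : 'I_r | (i < k)%N) \bigcup_(a in S i) [set u in A k' | ~~ adj a u].
have Bd_small : #|Bd|%:R <= (r * b)%:R * (eta * n).
  apply: le_trans (_ : \sum_(i : 'I_r | (i < k)%N) \sum_(a in S i) eta * n <= _).
    apply: le_trans (_ : (\sum_(i : 'I_r | (i < k)%N) \sum_(a in S i) #|[set u in A k' | ~~ adj a u]|)%:R <= _).
      rewrite ler_nat; apply: leq_trans (card_bigcup_le _ _) _.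
      by apply: leq_sum => i _; apply: card_bigcup_le.
    rewrite natr_sum; apply: ler_sum => i ik; rewrite natr_sum; apply: ler_sum => a aS.
    apply: (miss i k'); first by rewrite neq_ltn ik.
    by apply: (subsetP (XA i)); apply: (subsetP (SX i ik)).
  have en0 : 0 <= eta * n by have [_ _ compl _ _] := nc; exact: le_trans compl.
  apply: le_trans (_ : \sum_(i < r) b%:R * (eta * n) <= _).
    rewrite big_mkcond; apply: ler_sum => i _; case: ifP => ik; last by rewrite mulr_ge0.
    by rewrite sumr_const Sb // mulr_natl.
  by rewrite sumr_const card_ord natrM -mulrA -[leLHS]mulr_natl.
have [B BX Bb] : exists2 B : {set G}, B \subset X k' :\: Bd & #|B| = b.
  apply: exists_subset; rewrite -(ler_nat R).
  have : (#|X k'| <= #|X k' :\: Bd| + #|Bd|)%N.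
    by rewrite -(cardsID Bd (X k')) addnC leq_add2l subset_leq_card // subsetIr.
  rewrite -(ler_nat R) natrD; have := Xbig k'; lra.
have below (i : 'I_r) : (i < k.+1)%N -> i != k' -> (i < k)%N.
  by rewrite ltnS leq_eqVlt => /predU1P[ik|//]; rewrite -val_eqE /= ik eqxx.
exists (fun i => if i == k' then B else S i); split.
- move=> i ik; case: (eqVneq i k') => [->|ne]; first by apply: subset_trans BX _; apply: subsetDl.
  by apply: SX; apply: below ik ne.
- by move=> i ik; case: (eqVneq i k') => [//|ne]; apply: Sb; apply: below ik ne.
- move=> i j a d ij jk; have ik' : (i < k)%N by apply: leq_trans ij _.
  have -> : (i == k') = false by apply/negbTE; rewrite -val_eqE /= neq_ltn ik'.
  have [_|ne] := eqVneq j k'; last exact: Sadj (below j jk ne).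
  move=> aS /(subsetP BX); rewrite inE => /andP[nBd /(subsetP (XA _)) dA].
  apply: contraNT nBd => nad; apply/bigcupP; exists i => //.
  by apply/bigcupP; exists a => //; rewrite inE dA.
Qed.

Variables (B : nat) (th : R).
Hypotheses (Bn : B%:R <= eta * n) (bn : b%:R <= eta * n).
Hypotheses (th_eta : ((r * b)%:R + 2) * eta <= th) (th_r : th <= (4 * r%:R)^-1).

Let room (X : {set G}) (Y : {set G}) : (#|Y| <= B)%N -> th * n <= #|X|%:R ->
  (r * b)%:R * (eta * n) + b%:R <= #|X :\: Y|%:R.
Proof.
move=> YB Xth; have : (#|X| <= #|X :\: Y| + #|Y|)%N.
  by rewrite -(cardsID Y X) addnC leq_add2l subset_leq_card // subsetIr.
rewrite -(ler_nat R) natrD.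
have : #|Y|%:R <= B%:R :> R by rewrite ler_nat.
have := ler_wpM2r (ler0n R #|G|) th_eta; rewrite -/n.
by move: Bn bn Xth; move: n (b%:R : R) ((r * b)%:R : R) => ? ? ?; lra.
Qed.

(** Blocks in the neighbourhood of v; the edge of the first part joins v to a
    vertex of one block. *)
Lemma robust_vertex (v : G) (Y : {set G}) :
  (forall i, th * n <= #|[set u in A i | adj v u]|%:R) ->
  (#|Y| <= B)%N -> v \notin Y -> copy_avoiding (kplus ns) Y.
Proof.
move=> many YB vY; pose X i := [set u in A i | adj v u] :\: Y.
have XA i : X i \subset A i by apply/subsetP => u; rewrite !inE => /and3P[].
have [S [SX Sb Sadj]] := greedy_blocks XA (fun i => room YB (many i)).
have Sv i u : u \in S i -> adj v u by move=> /(subsetP (SX i)); rewrite !inE => /and3P[].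
have SY i u : u \in S i -> u \notin Y by move=> /(subsetP (SX i)); rewrite !inE => /and3P[].
have r1 : (0 < r)%N := ltnW r2; pose z := Ordinal r1.
have /card_gt0P[u uS] : (0 < #|S z|)%N by apply: leq_trans (Sb z); rewrite /b; lia.
apply: (@kplus_copy _ _ _ nsm _ _ S z u v) => //.
- by rewrite adj_sym; apply: Sv uS.
- move=> i a iz aS; split; last exact: Sv aS.
  by apply: (Sadj z i) => //; rewrite eq_sym.
- exact: SY uS.
- by move=> i; rewrite disjoints_subset; apply/subsetP => a /SY; rewrite inE.
Qed.

(** Outside class i the two ends still have many common neighbours, in which the
    blocks can be chosen. *)
Lemma robust_edge (i : 'I_r) (u v : G) (Y : {set G}) : adj u v ->
  (forall j, j != i -> #|[set w in A j | ~~ adj u w]|%:R <= (8 * r%:R)^-1 * n) ->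
  (forall j, j != i -> #|[set w in A j | ~~ adj v w]|%:R <= (8 * r%:R)^-1 * n) ->
  (#|Y| <= B)%N -> u \notin Y -> v \notin Y -> copy_avoiding (kplus ns) Y.
Proof.
move=> uv mu mv YB uY vY.
have [_ _ _ _ big] := nc.
have rp : 0 < r%:R :> R by rewrite ltr0n ltnW.
have e2 : (2 * r%:R)^-1 = 2 * (4 * r%:R)^-1 :> R by field; rewrite gt_eqF.
have e8 : (8 * r%:R)^-1 = 2^-1 * (4 * r%:R)^-1 :> R by field; rewrite gt_eqF.
have n0 : 0 <= n by exact: ler0n.
have thn := ler_wpM2r n0 th_r.
have q0 : 0 <= (4 * r%:R)^-1 * n by rewrite mulr_ge0 // invr_ge0 mulr_ge0 // ltW.
pose X0 j := if j == i then A i else [set w in A j | adj u w && adj v w].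
have X0A j : X0 j \subset A j.
  by rewrite /X0; case: eqP => [->//|_]; apply/subsetP => w; rewrite inE => /andP[].
have X0big j : th * n <= #|X0 j|%:R.
  have := big j; rewrite -/n [n / _]mulrC e2 => bj; rewrite /X0; case: (eqVneq j i) => [ji|ji].
    by rewrite -ji; lra.
  have : (#|A j| <= #|[set w in A j | adj u w && adj v w]| +
      (#|[set w in A j | ~~ adj u w]| + #|[set w in A j | ~~ adj v w]|))%N.
    rewrite -(cardsID [set w | adj u w && adj v w] (A j)); apply: leq_add.
      by apply/subset_leq_card/subsetP => w; rewrite !inE.
    apply: leq_trans (leq_card_setU _ _); apply/subset_leq_card/subsetP => w.
    by rewrite !inE negb_and => /andP[/orP[->|->] ->]; rewrite ?orbT.
  by rewrite -(ler_nat R) !natrD; have := mu j ji; have := mv j ji; rewrite e8; lra.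
pose X j := X0 j :\: Y.
have XA j : X j \subset A j by apply: subset_trans (X0A j); apply: subsetDl.
have [S [SX Sb Sadj]] := greedy_blocks XA (fun j => room YB (X0big j)).
have SY j w : w \in S j -> w \notin Y by move=> /(subsetP (SX j)); rewrite !inE => /andP[].
apply: (@kplus_copy _ _ _ nsm _ _ S i u v) => //.
- move=> j a ji /(subsetP (SX j)); rewrite !inE /X0 (negbTE ji) inE => /and3P[_ _ /andP[]].
  by [].
- by move=> j; rewrite disjoints_subset; apply/subsetP => a /SY; rewrite inE.
Qed.

End Robust.

(** The sets Os are vertices or edges, each lying in copies that avoid any other
    bounded set; t disjoint ones give t disjoint copies. *)
Lemma too_many_disjoint (F G : sgraph) (t : nat) (Os : seq {set G}) :
  free_of (copies t F) G -> size Os = t ->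
  pairwise (fun O O' : {set G} => [disjoint O & O']) Os ->
  {in Os, forall O : {set G}, (#|O| <= 2)%N /\
    forall Y : {set G}, (#|Y| <= t * #|F| + 2 * t)%N -> [disjoint O & Y] -> copy_avoiding F Y} ->
  False.
Proof.
move=> Ffree sizeO disO robust; apply: Ffree.
have cardU : (#|\bigcup_(O <- Os) O| <= 2 * t)%N.
  rewrite -sizeO; have : {in Os, forall O : {set G}, (#|O| <= 2)%N} by move=> O /robust[].
  elim: (Os) => [_|O L IH] /=; first by rewrite big_nil cards0.
  move=> H; rewrite big_cons mulnS; apply: leq_trans (leq_card_setU _ _) _.
  by rewrite leq_add ?H ?mem_head // IH // => O' O'L; apply: H; rewrite inE O'L orbT.
have [||||g [ginj ghom _]] := @disjoint_copies F G (t * #|F| + 2 * t) t set0 Os sizeO.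
- by rewrite cards0 add0n leq_add2l.
- by move=> O _; rewrite disjoint_sym disjoints_subset sub0set.
- exact: disO.
- by move=> O /robust[].
by exists g.
Qed.

(** * Exchanging cliques between two graphs on the same vertices *)

Section Exchange.
Variables (R : numDomainType) (V : finType) (x : V -> R).
Hypothesis x0 : forall v, 0 <= x v.

Lemma sum_two_coordinates k (Q : rel V) (l l' : 'I_k.+2) : l != l' ->
  \sum_(f : {ffun 'I_k.+2 -> V} | Q (f l) (f l')) \prod_i x (f i) =
  (\sum_a \sum_(b | Q a b) x a * x b) * (\sum_v x v) ^+ k.
Proof.
move=> ll'; have [i iE|e] := unliftP l l'; last by rewrite e eqxx in ll'.
rewrite big_mkcond (sum_finsert l) big_distrl; apply: eq_bigr => a _ /=.
rewrite (sum_finsert i) big_distrl [RHS]big_mkcond /=; apply: eq_bigr => b _.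
rewrite -sum_ffun_prod.
case: ifP => Qab; last first.
  by rewrite big1 // => g _; rewrite finsert_at iE finsert_lift finsert_at Qab.
rewrite big_distrr; apply: eq_bigr => g _.
by rewrite finsert_at iE finsert_lift finsert_at Qab !prod_finsert mulrA.
Qed.

(** Union bound over the pairs of coordinates where Q can occur. *)
Lemma sum_with_pair k (Q : rel V) :
  \sum_(f : {ffun 'I_k.+2 -> V} | [exists l, exists l', (l != l') && Q (f l) (f l')])
    \prod_i x (f i) <=
  (k.+2 * k.+2)%:R * ((\sum_a \sum_(b | Q a b) x a * x b) * (\sum_v x v) ^+ k).
Proof.
have w0 (f : {ffun 'I_k.+2 -> V}) : 0 <= \prod_i x (f i) by apply: prodr_ge0.
set S := _ * _ ^+ k.
have S0 : 0 <= S.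
  rewrite mulr_ge0 ?exprn_ge0 ?sumr_ge0 // => a _; apply: sumr_ge0 => c _.
  exact: mulr_ge0.
apply: le_trans (_ : \sum_(l < k.+2) \sum_(l' < k.+2 | l != l')
    \sum_(f : {ffun 'I_k.+2 -> V} | Q (f l) (f l')) \prod_i x (f i) <= _); last first.
  rewrite natrM -mulrA mulr_natl -[X in _ *+ X]card_ord -sumr_const.
  apply: ler_sum => l _; rewrite mulr_natl -[X in _ *+ X]card_ord -sumr_const.
  rewrite big_mkcond; apply: ler_sum => l' _; case: ifP => // ll'.
  by rewrite sum_two_coordinates.
under [leRHS]eq_bigr => l _ do under eq_bigr => l' _ do rewrite big_mkcond.
under [leRHS]eq_bigr => l _ do rewrite exchange_big.
rewrite exchange_big big_mkcond; apply: ler_sum => f _ /=.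
have t0 l : 0 <= \sum_(l' < k.+2 | l != l') (if Q (f l) (f l') then \prod_i x (f i) else 0).
  by apply: sumr_ge0 => l' _; case: ifP.
case: ifP => [/existsP[l /existsP[l' /andP[ll' Ql]]]|_]; last exact: sumr_ge0.
rewrite [leRHS](bigD1 l) //= [X in _ <= X + _](bigD1 l') //= Ql -addrA lerDl addr_ge0 //.
  by apply: sumr_ge0 => j _; case: ifP.
by apply: sumr_ge0.
Qed.

Lemma sum_transversals k (P : pred {ffun 'I_k.+1 -> V}) (L : {set V}) (q : R) :
  (forall v, v \in L -> exists2 X : 'I_k -> {set V},
     forall g : {ffun 'I_k -> V}, (forall l, g l \in X l) -> P (finsert ord0 v g) &
     q <= \prod_l \sum_(u in X l) x u) ->
  q * (\sum_(v in L) x v) <= \sum_(f : {ffun 'I_k.+1 -> V} | P f) \prod_i x (f i).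
Proof.
move=> H; rewrite big_distrr [leRHS]big_mkcond (sum_finsert ord0) big_mkcond.
apply: ler_sum => v _ /=; have w0 (f : {ffun 'I_k.+1 -> V}) : 0 <= \prod_i x (f i) by apply: prodr_ge0.
case: ifP => vL; last by apply: sumr_ge0 => g _; case: ifP.
have [X XP qX] := H v vL.
apply: le_trans (_ : (\prod_l \sum_(u in X l) x u) * x v <= _); first by rewrite ler_wpM2r.
rewrite bigA_distr_big_dep big_distrl /= big_mkcond; apply: ler_sum => g _.
case: ifP => [/familyP gX|_]; last by case: ifP.
by rewrite XP // prod_finsert mulrC.
Qed.

End Exchange.

(** The two graphs differ by the cliques lost and the cliques gained. *)
Lemma clique_sum_exchange (R : numDomainType) (G : sgraph) (H : rel G) (Hs : symmetric H)
    (Hi : irreflexive H) k (x : G -> R) :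
  clique_sum k (x : SGraph Hs Hi -> R) +
    \sum_(f : {ffun 'I_k -> G} | clique_map f && ~~ clique_map (f : {ffun 'I_k -> SGraph Hs Hi}))
      \prod_i x (f i) =
  clique_sum k x +
    \sum_(f : {ffun 'I_k -> G} | clique_map (f : {ffun 'I_k -> SGraph Hs Hi}) && ~~ clique_map f)
      \prod_i x (f i).
Proof.
pose w (f : {ffun 'I_k -> G}) := \prod_i x (f i).
pose cH (f : {ffun 'I_k -> G}) := clique_map (f : {ffun 'I_k -> SGraph Hs Hi}).
transitivity (\sum_(f : {ffun 'I_k -> G}) ((if cH f then w f else 0) +
    (if clique_map f && ~~ cH f then w f else 0))).
  by rewrite big_split /= -!big_mkcond.
transitivity (\sum_(f : {ffun 'I_k -> G}) ((if clique_map f then w f else 0) +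
    (if cH f && ~~ clique_map f then w f else 0))).
  by apply: eq_bigr => f _; case: (clique_map f); case: (cH f); rewrite ?addr0 ?add0r.
by rewrite big_split /= -!big_mkcond.
Qed.

(** * Comparison with a complete multipartite graph *)

(** The missing vertices of the clique are taken from classes that avoid those of
    the two given vertices. *)
Lemma extend_edge (r k : nat) (V : finType) (c : V -> option 'I_r) (a a' : V) :
  (k.+2 <= r)%N -> (forall l, (0 < class_size c l)%N) -> col_adj c a a' ->
  exists f : {ffun 'I_k.+2 -> colour_graph c},
    [/\ clique_map f, f ord0 = a & f (lift ord0 ord0) = a'].
Proof.
move=> kr ne aa'; have r1 : (1 < r)%N by apply: leq_trans kr.
have other (i : 'I_r) : exists j, i != j by apply: exists_other r1.
have [i [j [ij ai aj]]] : exists i j, [/\ i != j, c a = None \/ c a = Some i &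
    c a' = None \/ c a' = Some j].
  move: (aa'); rewrite /col_adj; case: (c a) => [i|]; case: (c a') => [j|] /= /andP[_ h].
  - by exists i, j; split; [apply: contraNneq h => ->|right|right].
  - by have [j ij] := other i; exists i, j; split=> //; [right|left].
  - by have [i ij] := other j; exists i, j; split; [rewrite eq_sym|left|right].
  - by have [j ij] := other (Ordinal r1); exists (Ordinal r1), j; split=> //; left.
have [g [ginj g0 g1]] := two_point_enum ij.
have [v0 v0c] := class_representatives ne.
pose F (l : nat) : V := if l == 0%N then a else if l == 1%N then a' else v0 (g l).
have Fc l : c (F l) = None /\ (l < 2)%N \/ c (F l) = Some (g l).
  case: l => [|[|l]] /=; last by right; exact: v0c.
    by rewrite g0; case: ai => ->; [left|right].
  by rewrite g1; case: aj => ->; [left|right].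
have Fadj l l' : (l < l')%N -> (l' < r)%N -> col_adj c (F l) (F l').
  move=> ll' l'r; have lr := ltn_trans ll' l'r.
  have gg : g l != g l' by apply: contraTneq ll' => /ginj; rewrite !inE lr l'r => /(_ isT isT) ->; rewrite ltnn.
  have [[cl l2]|cl] := Fc l; have [[cl' l'2]|cl'] := Fc l'.
  - have [-> ->] : l = 0%N /\ l' = 1%N by move: ll' l2 l'2; clear; lia.
    exact: aa'.
  - rewrite /col_adj cl eqxx andbT; apply: contra_eqN cl' => /eqP <-; by rewrite cl.
  - rewrite /col_adj cl cl' andbT; apply: contra_eqN cl => /eqP ->; by rewrite cl'.
  - rewrite /col_adj cl cl' (inj_eq Some_inj) gg andbT; apply: contraNneq gg => e.
    by apply/eqP/Some_inj; rewrite -cl -cl' e.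
exists [ffun l : 'I_k.+2 => F l]; rewrite !ffunE; split=> //.
apply/clique_mapP => l l' ll'; rewrite !ffunE /=.
have [lt|gt|/val_inj e] := ltngtP l l'; last by rewrite e eqxx in ll'.
  by apply: Fadj => //; apply: leq_trans kr.
by rewrite col_sym; apply: Fadj => //; apply: leq_trans kr.
Qed.

Section Compare.
Variable R : realType.
Variables (r t k : nat) (ns : r.-tuple nat) (m : nat).
Hypotheses (r2 : (2 <= r)%N) (kr : (k.+2 <= r)%N) (t2 : (2 <= t)%N).
Hypothesis nsm : forall i, (tnth ns i <= m)%N.
Variables (G : sgraph) (W : {set G}) (eta th C : R) (A : 'I_r -> {set G}).
Hypothesis Ffree : free_of (copies t (kplus ns)) G.
Hypothesis noW : ~ copy_avoiding (kplus ns) W.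
Hypothesis nc : near_complete eta A.

Definition copies_room : nat := (t * #|kplus ns| + 2 * t)%N.
Let B := copies_room.
Let n : R := #|G|%:R.
Let b := (m + 2)%N.
Hypotheses (WB : (#|W| <= B)%N) (n0 : (0 < #|G|)%N).
Hypotheses (Bn : B%:R <= eta * n) (bn : b%:R <= eta * n).
Hypotheses (th_eta : ((r * b)%:R + 2) * eta <= th) (th_r : th <= (8 * r%:R)^-1).
Hypothesis eta0 : 0 < eta.

Let npos : 0 < n. Proof. by rewrite ltr0n. Qed.
Let rp : 2 <= r%:R :> R. Proof. by rewrite ler_nat. Qed.
Let th2 : 2 * eta <= th.
Proof. by apply: le_trans th_eta; rewrite ler_pM2r // lerDr ler0n. Qed.
Let th0 : 0 < th. Proof. by apply: lt_le_trans th2; rewrite mulr_gt0. Qed.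
Let thr4 : th <= (4 * r%:R)^-1.
Proof.
have rp' := rp; have r0 : 0 < r%:R :> R by lra.
by apply: le_trans th_r _; rewrite lef_pV2 ?posrE ?mulr_gt0 //; lra.
Qed.

Definition nbrs_in (i : 'I_r) (v : G) : {set G} := [set u in A i | adj v u].
Definition non_nbrs_in (i : 'I_r) (v : G) : {set G} := [set u in A i | ~~ adj v u].

(** These vertices become part of the complete graph on t - 1 vertices. *)
Definition universal : {set G} := [set v | [forall i, th * n <= #|nbrs_in i v|%:R]].

Let Aindep i u v : u \in A i -> v \in A i -> ~~ adj u v.
Proof. by have [h _ _ _ _] := nc; apply: h. Qed.
Let Adisj i j v : v \in A i -> v \in A j -> i = j.
Proof. by have [_ h _ _ _] := nc; apply: h. Qed.
Let Acompl : #|~: \bigcup_i A i|%:R <= eta * n.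
Proof. by have [_ _ h _ _] := nc. Qed.
Let Abig i : n / (2 * r%:R) <= #|A i|%:R.
Proof. by have [_ _ _ _ h] := nc. Qed.

Lemma nbrs_in_own i v : v \in A i -> nbrs_in i v = set0.
Proof.
move=> vA; apply/setP => u; rewrite !inE; apply/negbTE/negP => /andP[uA].
by apply/negP; apply: Aindep vA uA.
Qed.

Lemma universal_notin i v : v \in A i -> v \notin universal.
Proof.
move=> vA; rewrite inE negb_forall; apply/existsP; exists i.
by rewrite nbrs_in_own // cards0 -ltNge mulr_gt0.
Qed.

Lemma universal_robust v (Y : {set G}) : v \in universal -> (#|Y| <= B)%N ->
  [disjoint [set v] & Y] -> copy_avoiding (kplus ns) Y.
Proof.
rewrite inE => /forallP many YB; rewrite disjoints1 => vY.
exact: (robust_vertex r2 nsm nc Bn bn th_eta thr4 many YB vY).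
Qed.

Lemma pairwise_singletons (s : seq G) : uniq s ->
  pairwise (fun O O' : {set G} => [disjoint O & O']) [seq [set v] | v <- s].
Proof.
elim: s => //= v s IH /andP[vs us]; rewrite IH // andbT.
apply/allP => _ /mapP[u us' ->]; rewrite disjoints1 inE.
by apply: contraNneq vs => ->.
Qed.

Lemma card_universal : (#|universal| <= t - 1)%N.
Proof.
rewrite leqNgt; apply/negP => big.
have [Z ZU cardZ] : exists2 Z : {set G}, Z \subset universal & #|Z| = t.
  by apply: exists_subset; move: big; rewrite subn1 prednK // ltnW.
apply: (@too_many_disjoint (kplus ns) G t [seq [set v] | v <- enum Z]) => //.
- by rewrite size_map -cardE.
- exact: pairwise_singletons (enum_uniq _).
- move=> _ /mapP[v + ->]; rewrite mem_enum => /(subsetP ZU) vU; rewrite cards1; split=> // Y YB.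
  exact: universal_robust.
Qed.

(** The edge would give a t-th copy, next to one for each universal vertex. *)
Lemma full_universal_no_edge u v : #|universal| = (t - 1)%N ->
  u \notin universal -> v \notin universal ->
  (forall Y : {set G}, (#|Y| <= B)%N -> u \notin Y -> v \notin Y ->
     copy_avoiding (kplus ns) Y) -> False.
Proof.
move=> cardU uU vU robust.
apply: (@too_many_disjoint (kplus ns) G t ([set u; v] :: [seq [set w] | w <- enum universal])) => //.
- by rewrite /= size_map -cardE cardU subn1 prednK // ltnW.
- rewrite pairwise_cons pairwise_singletons ?enum_uniq // andbT.
  apply/allP => _ /mapP[w + ->]; rewrite mem_enum => wU.
  rewrite disjoint_sym disjoints1 !inE negb_or.
  by apply/andP; split; [apply: contraNneq uU => <-|apply: contraNneq vU => <-].
- move=> O; rewrite inE => /predU1P[->|/mapP[w + ->]].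
    rewrite cards2; split=> [|Y YB]; first by case: eqP.
    rewrite disjoints_subset => /subsetP sub; apply: robust => //.
      by have := sub u; rewrite !inE eqxx => /(_ isT).
    by have := sub v; rewrite !inE eqxx orbT => /(_ isT).
  by rewrite mem_enum => wU; rewrite cards1; split=> // Y YB; apply: universal_robust.
Qed.

(** The default i0 is reached only at universal vertices outside the classes,
    which receive no colour. *)
Definition home_class (i0 : 'I_r) (v : G) : 'I_r :=
  if [pick i | v \in A i] is Some i then i else
  if [pick i | #|nbrs_in i v|%:R < th * n] is Some i then i else i0.

Let i0 : 'I_r := Ordinal (ltnW r2).
Let home := home_class i0.

Lemma home_in i v : v \in A i -> home v = i.
Proof.
move=> vA; rewrite /home /home_class; case: pickP => [j vj|/(_ i)]; last by rewrite vA.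
exact: Adisj vj vA.
Qed.

Lemma home_few v : v \notin universal -> #|nbrs_in (home v) v|%:R < th * n.
Proof.
move=> vU; rewrite /home /home_class; case: pickP => [j vj|_].
  by rewrite nbrs_in_own // cards0 mulr_gt0.
case: pickP => [//|none]; case/negP: vU; rewrite inE; apply/forallP => i.
by rewrite leNgt none.
Qed.

Variable P : {set G}.
Hypotheses (PA : P \subset A i0) (cardP : (#|universal| + #|P|)%N = (t - 1)%N).

(** P consists of promoted vertices, which bring the number of uncoloured vertices
    up to t - 1. *)
Definition new_colour (v : G) : option 'I_r :=
  if v \in universal :|: P then None else Some (home v).

Lemma new_colour_none : #|[set v | new_colour v == None]| = (t - 1)%N.
Proof.
have disj : universal :&: P = set0.
  apply/setP => v; rewrite in_set0; apply/negbTE/negP => /setIP[vU vP].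
  by move: vU; apply/negP; apply: universal_notin (subsetP PA _ vP).
rewrite -cardP -cardsUI disj cards0 addn0; apply: eq_card => v.
by rewrite inE /new_colour; case: (v \in universal :|: P).
Qed.

Lemma new_colour_in i v : v \in A i -> v \notin P -> new_colour v = Some i.
Proof.
move=> vA vP; rewrite /new_colour inE (negbTE (universal_notin vA)) (negbTE vP) /=.
by rewrite (home_in vA).
Qed.

Lemma new_colour_some v i : new_colour v = Some i ->
  [/\ v \notin universal, v \notin P & home v = i].
Proof.
by rewrite /new_colour; case: ifPn => //; rewrite inE negb_or => /andP[vU vP] [].
Qed.

Lemma card_P_small : #|P|%:R <= eta * n.
Proof.
apply: le_trans Bn; rewrite ler_nat; apply: leq_trans (_ : t <= _)%N.
  by apply: leq_trans (leq_subr 1 t); rewrite -cardP leq_addl.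
by apply: leq_trans (leq_addl _ _); rewrite leq_pmull.
Qed.

Lemma eta_class : eta * n <= n / (16 * r%:R).
Proof.
have rp' := rp; have th2' := th2; have th_r' := th_r.
rewrite mulrC ler_pM2l //; have -> : (16 * r%:R)^-1 = (8 * r%:R)^-1 / 2 :> R by field; lra.
by lra.
Qed.

Lemma class_minus_P i : n / (4 * r%:R) <= #|A i :\: P|%:R.
Proof.
have : (#|A i| <= #|A i :\: P| + #|P|)%N.
  by rewrite -(cardsID P (A i)) addnC leq_add2l subset_leq_card // subsetIr.
have rp' := rp; have e2 : n / (2 * r%:R) = 8 * (n / (16 * r%:R)) by field; lra.
have -> : n / (4 * r%:R) = 4 * (n / (16 * r%:R)) by field; lra.
have q0 : 0 <= n / (16 * r%:R) by rewrite divr_ge0 ?(ltW npos) //; lra.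
by rewrite -(ler_nat R) natrD; have := Abig i; have := card_P_small; have := eta_class; lra.
Qed.

Lemma new_class_nonempty i : (0 < class_size new_colour i)%N.
Proof.
have : (0 < #|A i :\: P|)%N.
  rewrite -(ltr0n R); apply: lt_le_trans (class_minus_P i).
  by rewrite divr_gt0 // mulr_gt0 //; have := rp; lra.
move=> /card_gt0P[v]; rewrite inE => /andP[vP vA]; apply/card_gt0P; exists v.
by rewrite inE (new_colour_in vA vP).
Qed.

Definition atypical : {set G} := [set v | (v \notin universal :|: P) &&
  [exists j, (j != home v) && ((8 * r%:R)^-1 * n < #|non_nbrs_in j v|%:R)]].

Definition lost : rel G := fun u v => adj u v && ~~ col_adj new_colour u v.

Lemma lost_sym : symmetric lost.
Proof. by move=> u v; rewrite /lost adj_sym col_sym. Qed.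

Lemma lostP u v : lost u v -> exists i, [/\ adj u v, new_colour u = Some i & new_colour v = Some i].
Proof.
move=> /andP[uv /col_nonadjP[e|[i ui vi]]]; first by rewrite e adj_irr in uv.
by exists i.
Qed.

(** A vertex has few neighbours in its home class, and few vertices lie outside
    all the classes. *)
Lemma lost_few u : #|[set v | lost u v]|%:R <= 2 * th * n.
Proof.
have [ne|none] := set_0Vmem [set v | lost u v].
  by rewrite ne cards0 !mulr_ge0 ?(ltW npos) ?(ltW th0).
case: none => v0; rewrite inE => /lostP[i [_ ui _]].
have [uU _ hu] := new_colour_some ui.
have few := home_few uU.
have : (#|[set v | lost u v]| <= #|nbrs_in (home u) u| + #|~: \bigcup_j A j|)%N.
  apply: leq_trans (leq_card_setU _ _); apply/subset_leq_card/subsetP => v.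
  rewrite inE => /lostP[i' [uv ui' vi]].
  have [_ vP hv] := new_colour_some vi; have [_ _ hu'] := new_colour_some ui'.
  rewrite inE in_setC; have [/bigcupP[j _ vj]|_] := boolP (v \in \bigcup_j A j); last by rewrite orbT.
  by rewrite orbF inE uv andbT hu' -hv (home_in vj).
have en : 0 < eta * n by rewrite mulr_gt0.
by rewrite -(ler_nat R) natrD; have := Acompl; have := ler_wpM2r (ltW npos) th2; lra.
Qed.

(** Both ends of a lost edge between typical vertices are joined to most of the
    other classes, so the edge lies in copies avoiding any prescribed small set. *)
Lemma lost_typical u v : lost u v -> u \notin atypical -> v \notin atypical ->
  (#|universal| < t - 1)%N /\ ((u \in W) || (v \in W)).
Proof.
move=> uv uD vD; have [i [adj_uv ui vi]] := lostP uv.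
have [uU uP hu] := new_colour_some ui; have [vU vP hv] := new_colour_some vi.
have typ w : w \notin universal -> w \notin P -> w \notin atypical ->
    forall j, j != home w -> #|[set a in A j | ~~ adj w a]|%:R <= (8 * r%:R)^-1 * n.
  move=> wU wP; rewrite inE in_setU (negbTE wU) (negbTE wP) /= negb_exists => /forallP H j jw.
  by have := H j; rewrite jw /= -leNgt.
have robust (Y : {set G}) : (#|Y| <= B)%N -> u \notin Y -> v \notin Y ->
    copy_avoiding (kplus ns) Y.
  move=> YB uY vY; apply: (robust_edge r2 nsm nc Bn bn th_eta thr4 adj_uv _ _ YB uY vY (i := i)).
    by move=> j ji; apply: typ uU uP uD _ _; rewrite hu.
  by move=> j ji; apply: typ vU vP vD _ _; rewrite hv.
split.
  rewrite ltn_neqAle card_universal andbT; apply/eqP => cU.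
  exact: (full_universal_no_edge cU uU vU robust).
rewrite -[_ || _]negbK negb_or; apply/negP => /andP[uW vW]; apply: noW.
exact: robust.
Qed.

Variable x : G -> R.
Hypotheses (x0 : forall v, 0 <= x v) (xC : forall v, x v <= C) (C1 : 1 <= C).
Hypotheses (xA : forall i v, v \in A i -> 2^-1 <= x v) (xn : \sum_v x v <= n).

Let K : R := ((32 * r%:R)^-1) ^+ k.+1.
Let s2 : R := (k.+2 * k.+2)%:R.
Hypothesis K_atypical : s2 * (4 * th * C) <= K / 2.
Hypothesis K_removed : s2 * (4 * th * C) * (B%:R * C) <= K / 4.

Let H := colour_graph new_colour.
Let missing : R := (#|universal| < t - 1)%N%:R.
Let XD : R := \sum_(v in atypical) x v.

(** A vertex cover of the lost edges.  If there are already t - 1 universal vertices,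
    then W is not required, so that nothing is lost without atypical vertices. *)
Definition culprits : {set G} :=
  if (#|universal| < t - 1)%N then atypical :|: W else atypical.

Lemma lost_culprit u v : lost u v -> (u \in culprits) || (v \in culprits).
Proof.
move=> uv; rewrite /culprits.
have [uD|uD] := boolP (u \in atypical); first by case: ifP; rewrite ?in_setU uD.
have [vD|vD] := boolP (v \in atypical); first by case: ifP; rewrite ?in_setU vD ?orbT.
by have [-> /orP[w|w]] := lost_typical uv uD vD; rewrite !in_setU w ?orbT.
Qed.

Lemma culprits_weight : \sum_(v in culprits) x v <= XD + missing * (B%:R * C).
Proof.
rewrite /culprits /missing; case: ifP => _; last by rewrite mul0r addr0.
rewrite mul1r; apply: le_trans (_ : XD + \sum_(v in W) x v <= _).
  rewrite /XD big_mkcond [X in _ <= X + _]big_mkcond [X in _ <= _ + X]big_mkcond -big_split /=.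
  by apply: ler_sum => v _; rewrite in_setU; case: (v \in atypical); case: (v \in W);
    rewrite /= ?addr0 ?add0r // lerDl.
rewrite lerD2l; apply: le_trans (_ : \sum_(v in W) C <= _); first exact: ler_sum.
by rewrite sumr_const -[leLHS]mulr_natl ler_wpM2r ?ler_nat // (le_trans ler01).
Qed.

(** Sum over the end in the cover: each vertex is on few lost edges. *)
Lemma lost_weight :
  \sum_a \sum_(a' | lost a a') x a * x a' <= 4 * th * C * n * \sum_(v in culprits) x v.
Proof.
pose S := \sum_(v in culprits) \sum_(a' | lost v a') x v * x a'.
have half : S <= 2 * th * C * n * \sum_(v in culprits) x v.
  rewrite /S big_distrr; apply: ler_sum => v _ /=.
  rewrite -big_distrr /= [leLHS]mulrC; apply: ler_wpM2r => //.
  apply: le_trans (_ : \sum_(a' | lost v a') C <= _); first exact: ler_sum.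
  rewrite sumr_const -[leLHS]mulr_natl.
  rewrite [leRHS](_ : _ = 2 * th * n * C); last by ring.
  apply: ler_wpM2r; first exact: le_trans ler01 C1.
  by have := lost_few v; rewrite cardsE.
apply: le_trans (_ : S + S <= _); last by lra.
have SE : S = \sum_a \sum_(a' | lost a a') if a' \in culprits then x a * x a' else 0.
  rewrite /S big_mkcond; transitivity (\sum_a' \sum_(a | lost a' a) if a' \in culprits then x a' * x a else 0).
    by apply: eq_bigr => a _; case: ifP => // _; rewrite big1.
  under [LHS]eq_bigr do rewrite big_mkcond.
  rewrite exchange_big; apply: eq_bigr => a _ /=; rewrite [RHS]big_mkcond; apply: eq_bigr => a' _.
  by rewrite lost_sym mulrC.
rewrite {2}SE /S [X in _ <= X + _]big_mkcond -big_split; apply: ler_sum => a _ /=.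
case: ifP => aS.
  by rewrite lerDl; apply: sumr_ge0 => a' _; case: ifP => // _; apply: mulr_ge0.
rewrite add0r; apply: ler_sum => a' aa'.
by have := lost_culprit aa'; rewrite aS /= => ->.
Qed.

Definition transversal (f : {ffun 'I_k.+2 -> G}) : bool :=
  clique_map (f : {ffun 'I_k.+2 -> H}) && ~~ clique_map f.

(** The new cliques through an atypical or promoted vertex v: a non-neighbour of
    v in some class, and vertices of other classes avoiding that of v. *)
Lemma gained_weight :
  K * n ^+ k.+1 * (XD + missing / 2) <=
  \sum_(f : {ffun 'I_k.+2 -> G} | transversal f) \prod_l x (f l).
Proof.
have rp' := rp; have n0' := ltW npos.
have c32 : n / (4 * r%:R) = 8 * (n / (32 * r%:R)) by field; lra.
have c16 : n / (16 * r%:R) = 2 * (n / (32 * r%:R)) by field; lra.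
have c8 : (8 * r%:R)^-1 * n = 4 * (n / (32 * r%:R)) by field; lra.
have q0 : 0 < n / (32 * r%:R) by rewrite divr_gt0 //; lra.
have half_sum (i : 'I_r) (X : {set G}) : X \subset A i -> #|X|%:R / 2 <= \sum_(u in X) x u.
  move=> XA; apply: le_trans (_ : \sum_(u in X) 2^-1 <= _).
    by rewrite sumr_const -[leRHS]mulr_natl.
  by apply: ler_sum => u uX; apply: (xA (i := i)); apply: (subsetP XA).
apply: le_trans (_ : K * n ^+ k.+1 * (\sum_(v in atypical :|: P) x v) <= _).
  rewrite ler_wpM2l ?mulr_ge0 ?exprn_ge0 ?invr_ge0 //; first by lra.
  have disj v : v \in P -> v \notin atypical.
    by move=> vP; rewrite !inE vP orbT.
  apply: le_trans (_ : XD + \sum_(v in P) x v <= _); last first.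
    rewrite /XD big_mkcond [X in _ + X]big_mkcond [leRHS]big_mkcond -big_split /=.
    apply: ler_sum => v _; rewrite in_setU; case vP: (v \in P).
      by rewrite (negbTE (disj v vP)) orbT add0r.
    by rewrite orbF addr0.
  rewrite lerD2l /missing; case: ltnP => Ut; last by rewrite mul0r sumr_ge0.
  have /card_gt0P[p pP] : (0 < #|P|)%N by move: Ut; rewrite -cardP -[X in (X < _)%N]addn0 ltn_add2l.
  rewrite (bigD1 p) //= mul1r -[leLHS]addr0 lerD ?sumr_ge0 //.
  exact: xA (subsetP PA _ pP).
apply: sum_transversals => // v vL.
have [i [j [Q [ij vi QA Qv Qbig]]]] : exists i j (Q : {set G}),
    [/\ i != j, new_colour v = None \/ new_colour v = Some i, Q \subset A j :\: P,
        forall u, u \in Q -> ~~ adj v u & 2 * (n / (32 * r%:R)) <= #|Q|%:R].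
  move: vL; rewrite in_setU => /orP[vD|vP].
    move: (vD); rewrite inE => /andP[vU /existsP[j /andP[jv many]]].
    exists (home v), j, (non_nbrs_in j v :\: P); split.
    - by rewrite eq_sym.
    - by right; rewrite /new_colour (negbTE vU).
    - by apply: setSD; apply/subsetP => u; rewrite inE => /andP[].
    - by move=> u; rewrite !inE => /and3P[].
    have : (#|non_nbrs_in j v| <= #|non_nbrs_in j v :\: P| + #|P|)%N.
      by rewrite -(cardsID P (non_nbrs_in j v)) addnC leq_add2l subset_leq_card // subsetIr.
    by rewrite -(ler_nat R) natrD; have := card_P_small; have := eta_class; lra.
  have vA := subsetP PA _ vP.
  exists (Ordinal r2), i0, (A i0 :\: P); split=> //.
  - by left; rewrite /new_colour in_setU vP orbT.
  - by move=> u; rewrite inE => /andP[_ uA]; apply: Aindep vA uA.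
  - by have := class_minus_P i0; lra.
have [g [ginj g0 g1]] := two_point_enum ij.
pose X (l : 'I_k.+1) := if l == ord0 then Q else A (g l.+1) :\: P.
have XA l : X l \subset A (g l.+1) :\: P.
  by rewrite /X; case: eqP => [->|//]; rewrite g1.
have lr (l : 'I_k.+1) : (l.+1 < r)%N by apply: leq_trans kr; rewrite ltnS.
exists X => [h hX|].
  have hc l : new_colour (h l) = Some (g l.+1).
    have /(subsetP (XA l)) := hX l; rewrite inE => /andP[hP hA].
    exact: new_colour_in hA hP.
  rewrite /transversal (@clique_finsert H) (@clique_finsert G).
  apply/andP; split.
    apply/andP; split.
      apply: (clique_map_colours (h := fun l : 'I_k.+1 => g l.+1)) => // l l'.
      by move=> /ginj; rewrite !inE !lr => /(_ isT isT) [] /val_inj.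
    apply/forallP => l; rewrite /= /col_adj.
    have ne : new_colour v != new_colour (h l).
      rewrite hc; case: vi => -> //; rewrite (inj_eq Some_inj) -g0.
      by apply/eqP => /ginj; rewrite !inE lr (leq_trans _ kr) // => /(_ isT isT).
    by rewrite ne orbT andbT; apply: contra_neq ne => ->.
  rewrite negb_and; apply/orP; right; rewrite negb_forall; apply/existsP; exists ord0.
  by apply: Qv; have := hX ord0; rewrite /X eqxx.
have qE : K * n ^+ k.+1 = \prod_(l < k.+1) (n / (32 * r%:R)).
  by rewrite prodr_const card_ord exprMn mulrC.
rewrite qE; apply: ler_prod => l _; rewrite (ltW q0) /=.
have Xbig : 2 * (n / (32 * r%:R)) <= #|X l|%:R.
  by rewrite /X; case: eqP => // _; have := class_minus_P (g l.+1); lra.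
have XA' : X l \subset A (g l.+1) by apply: subset_trans (XA l) _; apply: subsetDl.
by have := half_sum _ _ XA'; lra.
Qed.

(** A lost clique contains a lost edge.  The two bounds on K are what makes the
    total at most half of gained_weight. *)
Lemma lost_clique_weight :
  \sum_(f : {ffun 'I_k.+2 -> G} | clique_map f && ~~ clique_map (f : {ffun 'I_k.+2 -> H}))
    \prod_l x (f l) <= K * n ^+ k.+1 * (XD / 2 + missing / 4).
Proof.
have n0' := ltW npos; have sum0 : 0 <= \sum_v x v by apply: sumr_ge0.
apply: le_trans (_ : \sum_(f : {ffun 'I_k.+2 -> G} |
    [exists l, exists l', (l != l') && lost (f l) (f l')]) \prod_l x (f l) <= _).
  rewrite big_mkcond [leRHS]big_mkcond; apply: ler_sum => f _ /=.
  have w0 : 0 <= \prod_l x (f l) by apply: prodr_ge0.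
  case: ifP => [/andP[/clique_mapP fG fH]|_]; last by case: ifP.
  rewrite ifT //; apply: contraNT fH => none; apply/clique_mapP => l l' ll'.
  apply: contraT => nH; case/negP: none; apply/existsP; exists l; apply/existsP; exists l'.
  by rewrite ll' /lost fG.
apply: le_trans (@sum_with_pair R G x x0 k lost) _; rewrite -/s2.
have s20 : 0 <= s2 by exact: ler0n.
have XS := culprits_weight; have LW := lost_weight.
have XS0 : 0 <= \sum_(v in culprits) x v by apply: sumr_ge0.
have LW0 : 0 <= \sum_a \sum_(a' | lost a a') x a * x a'.
  by apply: sumr_ge0 => a _; apply: sumr_ge0 => a' _; apply: mulr_ge0.
have c0 : 0 <= 4 * th * C by rewrite !mulr_ge0 ?(ltW th0) // (le_trans ler01).
apply: le_trans (_ : s2 * (4 * th * C * n * (XD + missing * (B%:R * C)) * n ^+ k) <= _).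
  rewrite ler_wpM2l // ler_pM ?exprn_ge0 //; last by rewrite lerXn2r ?nnegrE.
  by apply: le_trans LW _; rewrite ler_wpM2l // mulr_ge0.
have XD0 : 0 <= XD by apply: sumr_ge0 => v _.
have m0 : 0 <= missing by exact: ler0n.
have h1 := ler_wpM2r XD0 K_atypical; have h2 := ler_wpM2l m0 K_removed.
rewrite [leLHS](_ : _ = n ^+ k.+1 * (s2 * (4 * th * C) * XD + missing * (s2 * (4 * th * C) * (B%:R * C)))); last first.
  by rewrite exprSr; ring.
rewrite [leRHS](_ : _ = n ^+ k.+1 * (K / 2 * XD + missing * (K / 4))); last by ring.
by rewrite ler_wpM2l ?exprn_ge0 // lerD.
Qed.

Lemma compare_clique_sums :
  clique_sum k.+2 x + K * n ^+ k.+1 * (XD / 2 + missing / 4) <= clique_sum k.+2 (x : H -> R).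
Proof.
have := clique_sum_exchange (col_sym new_colour) (col_irr new_colour) k.+2 x.
by have := gained_weight; have := lost_clique_weight; rewrite /transversal; lra.
Qed.

(** For positive weights, equality leaves no atypical vertex and the maximal
    number of universal ones, hence no lost edge; and then no gained edge, since
    each lies in a gained clique. *)
Lemma compare_equality : (forall v, 0 < x v) ->
  clique_sum k.+2 (x : H -> R) <= clique_sum k.+2 x ->
  forall u v, adj u v = col_adj new_colour u v.
Proof.
move=> xpos le_TH; have cmp := compare_clique_sums.
have K0 : 0 < K by rewrite exprn_gt0 // invr_gt0 mulr_gt0 //; have := rp; lra.
have Kn : 0 < K * n ^+ k.+1 by apply: mulr_gt0 => //; apply: exprn_gt0.
have XD0 : 0 <= XD by apply: sumr_ge0 => v _.
have m0 : 0 <= missing by exact: ler0n.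
have sum0 : XD / 2 + missing / 4 <= 0.
  rewrite -(pmulr_rle0 _ Kn) -(lerD2l (clique_sum k.+2 x)) addr0.
  exact: le_trans cmp le_TH.
have [XD_0 missing0] : XD = 0 /\ missing = 0.
  by move: sum0 XD0 m0; move: XD missing => d h ? ? ?; split; lra.
have noD v : v \notin atypical.
  apply/negP => vD; suff : 0 < XD by rewrite XD_0 ltxx.
  by rewrite /XD (bigD1 v) //=; apply: ltr_pwDl => //; apply: sumr_ge0.
have no_lost u v : ~~ lost u v.
  apply/negP => uv; have [Ut _] := lost_typical uv (noD u) (noD v).
  by move: missing0; rewrite /missing Ut => /eqP; rewrite oner_eq0.
move=> u v; apply/idP/idP => [uv|uvH].
  by have := no_lost u v; rewrite /lost uv /= negbK.
apply: contraT => nuv.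
have [f [fcl f0 f1]] := extend_edge kr new_class_nonempty uvH.
have f_gain : transversal f.
  rewrite /transversal fcl /=; apply/negP => /clique_mapP/(_ ord0 (lift ord0 ord0) isT).
  by rewrite f0 f1; apply/negP.
have := clique_sum_exchange (col_sym new_colour) (col_irr new_colour) k.+2 x.
rewrite [X in _ + X = _]big_pred0 => [|h]; last first.
  apply/negbTE/negP => /andP[/clique_mapP hG /clique_mapP[]] l l' ll'.
  have := no_lost (h l) (h l'); rewrite /lost hG //= negbK //.
rewrite addr0 => E; move: le_TH; rewrite -/H E gerDl leNgt => /negP[].
rewrite (bigD1 f) //=; apply: ltr_pwDl; first by apply: prodr_gt0.
by apply: sumr_ge0 => h _; apply: prodr_ge0.
Qed.

End Compare.

(** * The maximum over free graphs *)

Section SparseCliques.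
Variables (R : realType) (r : nat) (ns : r.-tuple nat) (m : nat).
Hypotheses (r2 : (2 <= r)%N) (nsm : forall i, (tnth ns i <= m)%N).

(** Otherwise the (r+1)-cliques avoiding W contain a complete (r+1)-partite
    graph with large parts; an edge from one of its parts to another serves as
    the additional edge of a copy. *)
Lemma sparse_cliques (w0 : nat) (eps : R) : 0 < eps ->
  exists N : nat, forall (G : sgraph) (W : {set G}) (C : R) (x : G -> R),
    (N <= #|G|)%N -> (#|W| <= w0)%N -> ~ copy_avoiding (kplus ns) W ->
    (forall v, 0 <= x v) -> (forall v, x v <= C) ->
    clique_sum r.+1 x <= C ^+ r.+1 * (eps * #|G|%:R ^+ r.+1).
Proof.
move=> eps0; have m1 : (0 < m + 2)%N by rewrite addn2.
have e20 : 0 < eps / 2 by rewrite divr_gt0.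
have [N1 box] := box_of_cliques (ltnW (r2 : (1 < r)%N) : (2 <= r.+1)%N) m1 e20.
have [N2 arch] := archimedean_le (r.+1%:R * w0%:R) e20.
exists (maxn 1 (maxn N1 N2)) => G W C x; rewrite !geq_max => /and3P[n0 n1 n2] Ww noW x0 xC.
set n : R := #|G|%:R; have npos : 0 < n by rewrite ltr0n.
have C0 : 0 <= C by have /card_gt0P[v _] := n0; apply: le_trans (xC v).
pose Hs := [set f : {ffun 'I_r.+1 -> G} | clique_map f && [forall i, f i \in ~: W]].
have few : #|Hs|%:R < eps / 2 * n ^+ r.+1.
  rewrite ltNge; apply/negP => many; apply: noW.
  have [S [S_size SW S_adj]] := box G (~: W) n1 many.
  have S_W i a : a \in S i -> a \notin W by move=> /(subsetP (SW i)); rewrite inE.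
  have rep i : exists v, v \in S i by apply/card_gt0P; rewrite S_size.
  pose s0 i := sval (cid (rep i)).
  have s0P i : s0 i \in S i by rewrite /s0; case: cid.
  have r1 : (0 < r)%N := ltnW r2; pose z := Ordinal r1.
  pose S' (i : 'I_r) := S (lift ord0 i); pose v := s0 ord0; pose u := s0 (lift ord0 z).
  have lift0 (i : 'I_r) : ord0 != lift ord0 i := neq_lift _ _.
  have lift_neq (i j : 'I_r) : i != j -> lift ord0 i != lift ord0 j by rewrite (inj_eq lift_inj).
  apply: (@kplus_copy r ns m nsm G W S' z u v).
  - by move=> i; rewrite S_size.
  - by move=> i j a d /lift_neq; apply: S_adj.
  - by rewrite adj_sym; apply: S_adj (lift0 z) (s0P _) (s0P _).
  - move=> i a iz aS; split; last exact: S_adj (lift0 i) (s0P _) aS.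
    by rewrite eq_sym in iz; apply: S_adj (lift_neq _ _ iz) (s0P _) aS.
  - exact: S_W (s0P _).
  - exact: S_W (s0P _).
  - by move=> i; rewrite disjoints_subset; apply: SW.
have total : clique_sum r.+1 (fun _ : G => 1 : R) <= #|Hs|%:R + r.+1%:R * (#|W|%:R * n ^+ r).
  have touch : \sum_(i < r.+1) \sum_(f : {ffun 'I_r.+1 -> G}) (if f i \in W then 1 else 0) =
      r.+1%:R * (#|W|%:R * n ^+ r) :> R.
    rewrite mulr_natl -[X in _ *+ X]card_ord -sumr_const; apply: eq_bigr => i _.
    rewrite (sum_finsert i) -[#|W|]sum1_card natr_sum big_distrl [RHS]big_mkcond /=.
    apply: eq_bigr => v _; under eq_bigr do rewrite finsert_at.
    case: ifP => _; last by rewrite big1.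
    by rewrite sumr_const card_ffun card_ord natrX mul1r.
  rewrite -touch exchange_big -sum1dep_card natr_sum /clique_sum.
  rewrite big_mkcond [X in _ <= X + _]big_mkcond -big_split; apply: ler_sum => f _ /=.
  have tail0 : 0 <= \sum_(i < r.+1) (if f i \in W then 1 else 0) :> R.
    by apply: sumr_ge0 => i _; case: ifP.
  rewrite big1 //; case: ifP => fc /=; last first.
    by rewrite add0r.
  case: ifP => [_|/negbT]; first by rewrite lerDl.
  rewrite negb_forall => /existsP[i fi]; rewrite add0r (bigD1 i) //=.
  rewrite in_setC negbK in fi; rewrite fi lerDl.
  by apply: sumr_ge0 => j _; case: ifP.
have T1 : clique_sum r.+1 (fun _ : G => 1 : R) <= eps * n ^+ r.+1.
  apply: le_trans total _.
  have h1 : #|W|%:R <= w0%:R :> R by rewrite ler_nat.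
  have h2 := arch _ n2; rewrite -/n in h2.
  have nr : 0 < n ^+ r by rewrite exprn_gt0.
  have h3 : r.+1%:R * (#|W|%:R * n ^+ r) <= eps / 2 * n * n ^+ r.
    rewrite mulrA ler_pM2r //; apply: le_trans h2.
    by rewrite ler_wpM2l.
  by move: few; rewrite exprS; lra.
apply: le_trans (_ : C ^+ r.+1 * clique_sum r.+1 (fun _ : G => 1 : R) <= _); last first.
  by rewrite ler_wpM2l ?exprn_ge0.
rewrite -clique_sumZ; apply: ler_sum => f _; apply: ler_prod => i _.
by rewrite x0 mulr1 xC.
Qed.

End SparseCliques.

Section Main.
Variables (R : realType) (s t r : nat) (ns : r.-tuple nat).
Hypotheses (s2 : (2 <= s)%N) (sr : (s <= r)%N) (t2 : (2 <= t)%N).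

(** The values of the form increase along G, the recoloured graph, the host, by
    compare_clique_sums and colour_le_host; the hypothesis closes the circle. *)
Lemma free_graph_below_host : exists N : nat, forall G : sgraph, (N <= #|G|)%N ->
  free_of (copies t (kplus ns)) G ->
  form_max R s (host r t #|G|) <= form_max R s G -> isomorphic G (host r t #|G|).
Proof.
have r2 : (2 <= r)%N := leq_trans s2 sr.
have [k sk] : exists k, s = k.+2 by exists s.-2; case: (s) s2 => [|[]].
have kr : (k.+2 <= r)%N by rewrite -sk.
have rp : 2 <= r%:R :> R by rewrite ler_nat.
have half_r (y : R) : y / (2 * r%:R) = 8 * (y / (16 * r%:R)).
  by field; rewrite gt_eqF // (lt_le_trans _ rp).
pose m := \max_(i < r) tnth ns i.
have nsm i : (tnth ns i <= m)%N by apply: leq_bigmax.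
pose B := copies_room t ns.
have dens0 := turan_density_gt0 R sr.
have dens1 := turan_density_le1 R sr.
set dens := turan_density R r s in dens0 dens1.
(* C bounds the entries of the maximiser, by the eigen-equation; K is the constant
   of gained_weight; th is so small that the cliques lost weigh at most half as
   much as those gained. *)
pose C := 2 / dens.
have C1 : 1 <= C by rewrite ler_pdivlMr //; lra.
have C0 : 0 < C by lra.
pose K : R := ((32 * r%:R)^-1) ^+ k.+1.
have K0 : 0 < K by rewrite exprn_gt0 // invr_gt0 mulr_gt0 //; lra.
pose D : R := (k.+2 * k.+2)%:R * (4 * C).
have D0 : 0 < D by rewrite mulr_gt0 ?ltr0n // mulr_gt0.
have BC0 : 0 <= B%:R * C by rewrite mulr_ge0 // ltW.
pose th := Num.min (8 * r%:R)^-1 (K / (4 * D * (1 + B%:R * C))).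
have BC1 : 0 < 1 + B%:R * C by rewrite ltr_wpDr.
have den0 : 0 < 4 * D * (1 + B%:R * C) by apply: mulr_gt0 => //; apply: mulr_gt0.
have th0 : 0 < th by rewrite lt_min invr_gt0 divr_gt0 // andbT mulr_gt0 //; lra.
have th_r : th <= (8 * r%:R)^-1 by rewrite ge_min lexx.
have thD : D * th * (1 + B%:R * C) <= K / 4.
  have : th <= K / (4 * D * (1 + B%:R * C)) by rewrite ge_min lexx orbT.
  by rewrite ler_pdivlMr //; lra.
have DthE : (k.+2 * k.+2)%:R * (4 * th * C) = D * th by rewrite /D; ring.
have Dth0 : 0 <= D * th by rewrite mulr_ge0 // ltW.
have Dth1 : 0 <= D * th * (B%:R * C) by rewrite mulr_ge0.
have K_atypical : (k.+2 * k.+2)%:R * (4 * th * C) <= K / 2 by rewrite DthE; lra.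
have K_removed : (k.+2 * k.+2)%:R * (4 * th * C) * (B%:R * C) <= K / 4 by rewrite DthE; lra.
pose eta := th / ((r * (m + 2))%:R + 2).
have rb0 : 0 < (r * (m + 2))%:R + 2 :> R by rewrite ltr_wpDl.
have eta0 : 0 < eta by rewrite divr_gt0.
have th_eta : ((r * (m + 2))%:R + 2) * eta <= th by rewrite /eta mulrC divfK // gt_eqF.
have [e [e0 [N1 partition]]] := near_complete_partition r2 nsm (t * #|kplus ns|) eta0.
have [d1 d10 good] := good_vertices s2 sr e0.
pose del := Num.min d1 (dens / 2).
have del0 : 0 < del by rewrite lt_min d10 divr_gt0.
have del_d1 : del <= d1 by rewrite ge_min lexx.
have del_dens : del <= dens / 2 by rewrite ge_min lexx orbT.
have [N2 lower] := host_form_max_lower s2 sr t2 del0.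
have eps0 : 0 < d1 / C ^+ r.+1 by rewrite divr_gt0 ?exprn_gt0.
have [N3 sparse] := sparse_cliques r2 nsm (t * #|kplus ns|) eps0.
have [N4 large] := archimedean_le (B%:R + (m + 2)%:R) eta0.
exists (maxn (maxn 1 t) (maxn (maxn N1 N2) (maxn N3 N4))) => G.
rewrite !geq_max => /and3P[/andP[n0 tn] /andP[n1 n2] /andP[n3 n4]] Gfree hostG.
set n : R := #|G|%:R; have npos : 0 < n by rewrite ltr0n.
have BbN : B%:R + (m + 2)%:R <= eta * n := large _ n4.
have Bn : B%:R <= eta * n by apply: le_trans BbN; rewrite lerDl.
have bn : (m + 2)%:R <= eta * n by apply: le_trans BbN; rewrite lerDr.
have [W [Ww noW]] := hitting_set Gfree.
have [x [x0 xs xT]] := form_max_attained s2 n0 npos.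
have xn : \sum_v x v <= n by apply: sum_le_card s2 x0 xs.
have tau_lower : (dens - del) * n ^+ s.-1 <= form_max R s G.
  exact: le_trans (lower _ n2) hostG.
have sE : s.-1.+1 = s by rewrite prednK // ltnW.
have xC v : x v <= C.
  have s1 : (0 < s.-1)%N by rewrite -ltnS sE.
  have xT' : clique_sum s x = form_max R s G * \sum_v x v ^+ s by rewrite xT xs.
  have eig := maximiser_eigen (ltnW s2) (esym sE) s1 (@form_max_bound R s s2 G) x0 xT' v.
  have : form_max R s G * x v ^+ s.-1 <= n ^+ s.-1.
    rewrite -eig; apply: le_trans (link_sum_le x0 _ _) _.
    by rewrite lerXn2r ?nnegrE ?(ltW npos) ?sumr_ge0.
  have nP : 0 < n ^+ s.-1 by rewrite exprn_gt0.
  have xP : 0 <= x v ^+ s.-1 by rewrite exprn_ge0.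
  have h1 : dens / 2 * n ^+ s.-1 * x v ^+ s.-1 <= form_max R s G * x v ^+ s.-1.
    rewrite ler_wpM2r //; apply: le_trans tau_lower; rewrite ler_pM2r //; lra.
  move=> h2; have : dens / 2 * x v ^+ s.-1 <= 1.
    rewrite -(ler_pM2r nP) mul1r mulrAC; exact: le_trans h1 h2.
  move=> h3; have h4 : x v ^+ s.-1 <= C by rewrite ler_pdivlMr //; lra.
  have [small|big] := leP (x v) 1; first exact: le_trans small C1.
  by apply: le_trans h4; rewrite -[leLHS]expr1 ler_weXn2l // ltW.
have Ts : (dens - d1) * n ^+ s <= clique_sum s x.
  rewrite xT -[in n ^+ s]sE exprSr mulrA ler_pM2r //; apply: le_trans tau_lower.
  by rewrite ler_pM2r ?exprn_gt0 // lerD2l lerN2.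
have Tr : clique_sum r.+1 x <= d1 * n ^+ r.+1.
  apply: le_trans (sparse G W C x n3 Ww noW x0 xC) _.
  by rewrite mulrA [C ^+ _ * _]mulrC divfK // gt_eqF // exprn_gt0.
have [U [cU Ugood]] := good G x n0 x0 xs Ts Tr.
have [A nc AU] := partition G W U n1 Ww noW cU (fun v vU => (Ugood v vU).2).
have xA i v : v \in A i -> 2^-1 <= x v.
  by move=> /(subsetP (AU i)); rewrite inE => /andP[_ /Ugood[]].
have WB : (#|W| <= B)%N by apply: leq_trans Ww (leq_addr _ _).
pose i0 := Ordinal (ltnW r2).
have [P PA cardP] : exists2 P : {set G}, P \subset A i0 & #|P| = (t - 1 - #|universal th A|)%N.
  apply: exists_subset; rewrite -(ler_nat R).
  have tB : (t <= B)%N by apply: leq_trans (leq_addl _ _); rewrite leq_pmull.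
  apply: (@le_trans _ R t%:R).
    by rewrite ler_nat; apply: leq_trans (leq_subr _ _) (leq_subr _ _).
  have : t%:R <= eta * n by apply: le_trans Bn; rewrite ler_nat.
  have [_ _ _ _ /(_ i0)] := nc; have := eta_class r2 n0 th_eta th_r eta0; rewrite -/n.
  rewrite half_r.
  have : 0 <= n / (16 * r%:R) by rewrite divr_ge0 ?(ltW npos) //; lra.
  by lra.
have Ut := card_universal r2 t2 nsm Gfree nc Bn bn th_eta th_r.
have cardUP : (#|universal th A| + #|P|)%N = (t - 1)%N by rewrite cardP subnKC.
pose c := new_colour r2 th A P.
have c_none : #|[set v | c v == None]| = (t - 1)%N := new_colour_none nc n0 th_eta eta0 PA cardUP.
have c_ne : forall l, (0 < class_size c l)%N := new_class_nonempty r2 nc n0 Bn th_eta th_r eta0 cardUP.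
have cmp := compare_clique_sums kr t2 nsm Gfree noW nc WB n0 Bn bn th_eta th_r eta0 PA cardUP
  x0 xC C1 xA xn K_atypical K_removed.
have eqG := compare_equality kr t2 nsm Gfree noW nc WB n0 Bn bn th_eta th_r eta0 PA cardUP
  x0 xC C1 xA xn K_atypical K_removed.
rewrite -/c in cmp eqG.
have le_T : clique_sum k.+2 x <= clique_sum k.+2 (x : colour_graph c -> R).
  apply: le_trans cmp; rewrite lerDl; apply: mulr_ge0.
    by apply: mulr_ge0; [exact: ltW K0 | rewrite exprn_ge0 // ltW].
  by rewrite addr_ge0 // divr_ge0 // sumr_ge0.
have [le_host _] := colour_le_host R s2 sr t2 (G := colour_graph c) (c := c) tn
  (fun u v => erefl) c_none c_ne.
have bound := @form_max_bound R s s2 (colour_graph c) x x0; rewrite xs in bound.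
rewrite -sk in le_T eqG.
have chain : form_max R s G * n <= form_max R s (colour_graph c) * n.
  by rewrite -xT; apply: le_trans le_T bound.
have le_GH : form_max R s G <= form_max R s (colour_graph c) by rewrite -(ler_pM2r npos).
have tau_eq : form_max R s (colour_graph c) = form_max R s G.
  by apply/eqP; rewrite eq_le le_GH andbT; apply: le_trans le_host hostG.
have T_eq : clique_sum s (x : colour_graph c -> R) = form_max R s (colour_graph c) * n.
  by apply/eqP; rewrite eq_le bound tau_eq -xT le_T.
have tau0 : 0 < form_max R s G.
  by apply: lt_le_trans tau_lower; rewrite mulr_gt0 ?exprn_gt0 //; lra.
have xpos v : 0 < x v.
  have T_eq' : clique_sum k.+2 (x : colour_graph c -> R) =
      form_max R k.+2 (colour_graph c) * \sum_v x v ^+ k.+2 by rewrite -sk xs.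
  apply: (@maximiser_gt0 R r (colour_graph c) c (fun _ _ => erefl) k.+1 x (ltn0Sn k) x0 T_eq').
  by rewrite -sk T_eq tau_eq mulr_gt0.
have adjE : forall u v, adj u v = col_adj c u v.
  by apply: eqG xpos _; rewrite T_eq tau_eq xT.
have [le2 iso] := colour_le_host R s2 sr t2 tn adjE c_none c_ne.
by apply: iso; apply/eqP; rewrite eq_le le2 hostG.
Qed.

End Main.

Local Close Scope ring_scope.

Theorem theorem1p3 (R : realType) (s t r : nat) (ns : r.-tuple nat)
    (hs : 2 <= s) (hsr : s <= r) (ht : 2 <= t)
    (hns : forall i : 'I_r, 0 < tnth ns i) (hn1 : 2 <= head 0 ns) :
  exists N : nat, forall n : nat, N <= n ->
    let F := copies t (kplus ns) in
    let H := graph_join (complete_graph (t - 1)) (turan_graph r (n - t + 1)) in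
    [/\ #|H| = n,
        free_of F H &
        forall G : sgraph, #|G| = n -> free_of F G ->
          (clique_spectral_radius R s G <= clique_spectral_radius R s H)%R /\
          (clique_spectral_radius R s G = clique_spectral_radius R s H ->
             isomorphic G H)].
Proof.
have [N below] := @free_graph_below_host R s t r ns hs hsr ht.
exists (maxn N t) => n; rewrite geq_max => /andP[Nn tn] F H.
have card_H : #|H| = n by exact: (card_host r (ltnW ht) tn).
split=> //; first exact: (host_free hs hsr ht hns hn1).
move=> G card_G Gfree.
have f0 : (0 < ((s.-1)`!)%:R :> R)%R by rewrite ltr0n fact_gt0.
have HE : host r t #|G| = H by rewrite card_G.
have {below} below : (clique_spectral_radius R s H <= clique_spectral_radius R s G)%R -> isomorphic G H.
  rewrite -(ler_pM2r f0) => le_HG; rewrite -HE; apply: below => //; first by rewrite card_G.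
  by rewrite HE.
split; last by move=> eq_r; apply: below; rewrite eq_r.
rewrite leNgt; apply/negP => lt_HG; have G0 : 0 < #|G| by rewrite card_G; lia.
have := form_max_iso R hs G0 (below (ltW lt_HG)).
by move=> /(mulIf (lt0r_neq0 f0)) e; rewrite e ltxx in lt_HG.
Qed.
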